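(* Let $\ell\ge0$, $\beta\in\mathbb{R}$, $\gamma>\max\{0,-\frac{\beta}{4\pi^2}\}$ and $\theta>0$. There exists $\delta>0$ such that, whenever $\phi\in H^\ell_{per,0}$ and $f\in L^\infty([0,\infty);H^\ell_{per,0})$ is $\theta$-periodic in time with $\langle f(t)\rangle=0$ for $t\in[0,\theta)$, and $$\|\phi\|_{H^{\ell}_{per,0}}+\|f\|_{L^{\infty}([0,\infty);H^{\ell}_{per,0})}\le\delta,$$ the equation $$u_t+u_x-u_{xxt}+uu_x+\beta u-\gamma u_{xx}=f(x,t)\ \text{ on }\mathbb{T}\times[0,\infty)$$ has a unique time-periodic (with period $\theta$) solution $\tilde u$ in $H^\ell_{per,0}$, and $\tilde u$ is locally stable in $H^\ell_{per,0}$.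
   Context: $\mathbb{T}=\mathbb{R}/\mathbb{Z}$ and $\Delta=\partial_x^2$. For $\ell\in\mathbb{R}$, $H^\ell_{per}$ is the space of 1-periodic distributions $g$ with $\|g\|_{H^\ell_{per}}=\big(\sum_{k\in\mathbb{Z}}(1+(2\pi k)^2)^\ell|\widehat g(k)|^2\big)^{1/2}<\infty$, where $\widehat g(k)=\int_0^1 e^{-2\pi i kx}g(x)\,dx$. We write $\langle g\rangle=\int_{\mathbb{T}}g\,dx=\widehat g(0)$; $H^\ell_{per,0}$ is the subspace of $g\in H^\ell_{per}$ with $\langle g\rangle=0$, with the same norm. Let $Av=(I-\Delta)^{-1}(-v_x-\beta v+\gamma v_{xx})$, which generates a $C_0$-semigroup $e^{At}$ on $H^\ell_{per,0}$. Solutions are mild solutions: $u(t)\in H^\ell_{per,0}$ and $$u(t)=e^{At}u(0)+\int_0^t e^{A(t-s)}(I-\Delta)^{-1}\big[f(s)-u(s)u_x(s)\big]ds,\qquad t\ge0,$$ where $uu_x$ means $\tfrac12\partial_x(u^2)$. A solution $\tilde u$ is $\theta$-periodic if $\tilde u(t+\theta)=\tilde u(t)$ for all $t\ge0$. A solution $\tilde u$ is locally stable in a space $X$ if there is $\varepsilon>0$ such that every solution $u$ with $u(0)\in X$ and $\|u(0)-\tilde u(0)\|_X<\varepsilon$ satisfies $\|u(t)-\tilde u(t)\|_X\to0$ as $t\to\infty$. *)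

(* Defs.v *)
From HB Require Import structures.
From mathcomp Require Import all_boot all_order all_algebra.
From mathcomp Require Import all_classical all_reals all_analysis ess_sup_inf.
From mathcomp Require Import complex ring.

Set Implicit Arguments.
Unset Strict Implicit.
Unset Printing Implicit Defensive.

Import Order.TTheory GRing.Theory Num.Theory.
Import numFieldNormedType.Exports.

Local Open Scope classical_set_scope.
Local Open Scope ring_scope.
Local Open Scope complex_scope.

Section Defs.
Context {R : realType}.

Notation mu := (@lebesgue_measure R).

Definition cexp (z : R[i]) : R[i] :=
  (expR (complex.Re z) * cos (complex.Im z)) +i*
  (expR (complex.Re z) * sin (complex.Im z)).

Definition cintegral (D : set R) (F : R -> R[i]) : R[i] :=
  Rintegral mu D (fun x => complex.Re (F x)) +i*
  Rintegral mu D (fun x => complex.Im (F x)).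

(* A function on T is a 1-periodic function on R; elements of the Sobolev
   spaces are such functions up to almost everywhere equality. *)
Definition aeeq (g h : R -> R) : Prop := \forall x \ae mu, g x = h x.

Definition periodic1 (g : R -> R) : Prop := forall x, g (x + 1) = g x.

Definition L2T (g : R -> R) : Prop :=
  [/\ periodic1 g, measurable_fun [set: R] g &
      mu.-integrable `[0, 1] (EFin \o (fun x => g x ^+ 2))].

Definition mean (g : R -> R) : R := Rintegral mu `[0, 1] g.

(* 2 pi k *)
Definition freq (k : int) : R := 2 * pi * k%:~R.

Definition fourier (g : R -> R) (k : int) : R[i] :=
  cintegral `[0, 1] (fun x => cexp (0 -i* (freq k * x)) * (g x)%:C).

Definition Hnorm (l : R) (g : R -> R) : \bar R :=
  sqrte (\esum_(k in [set: int])
           ((1 + freq k ^+ 2) `^ l * ComplexField.Normc.normc (fourier g k) ^+ 2)%:E).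

(* H^l_per for l >= 0 only: a periodic distribution with finite H^l norm is
   then a square-integrable function. Functions are real-valued. *)
Definition Hper (l : R) (g : R -> R) : Prop :=
  L2T g /\ (Hnorm l g < +oo)%E.

Definition Hper0 (l : R) (g : R -> R) : Prop := Hper l g /\ mean g = 0.

(* Periodic distributions that need not be functions, such as u u_x for u in
   L^2, are represented by their Fourier coefficients. *)
Definition coefs := int -> R[i].

Definition Dx (v : coefs) : coefs := fun k => (0 +i* freq k) * v k.

(* (I - Delta)^-1 *)
Definition resolvent (v : coefs) : coefs :=
  fun k => ((1 + freq k ^+ 2)^-1)%:C * v k.

Definition Aop (beta gamma : R) (v : coefs) : coefs :=
  resolvent (fun k => - Dx v k - beta%:C * v k + gamma%:C * Dx (Dx v) k).

(* A acts diagonally on Fourier coefficients, with eigenvalue [Asymbol k] on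
   the mode k, so that e^{At} multiplies the k-th coefficient by
   e^{t Asymbol k}. *)
Definition Asymbol (beta gamma : R) (k : int) : R[i] :=
  Aop beta gamma (fun=> 1) k.

Lemma Aop_diag beta gamma (v : coefs) k :
  Aop beta gamma v k = Asymbol beta gamma k * v k.
Proof. rewrite /Asymbol /Aop /resolvent /Dx; ring. Qed.

Definition semigroup (beta gamma t : R) (v : coefs) : coefs :=
  fun k => cexp (t%:C * Asymbol beta gamma k) * v k.

(* u u_x understood as (u^2)_x / 2 *)
Definition convection (u : R -> R) : coefs :=
  fun k => (2^-1)%:C * Dx (fourier (fun x => u x ^+ 2)) k.

(* Functions of time with values in H^l_{per,0}: only the times t >= 0 matter
   below. *)

(* Bochner measurability: almost everywhere limit of simple functions. *)
Definition strongly_measurable (l : R) (f : R -> R -> R) : Prop :=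
  exists s : nat -> R -> (R -> R),
    [/\ forall n t, 0 <= t -> Hper0 l (s n t),
        forall n, finite_set (s n @` `[0, +oo[),
        forall n g, measurable [set t | 0 <= t /\ s n t = g] &
        \forall t \ae mu, 0 <= t ->
          Hnorm l (s n t \- f t) @[n --> \oo] --> 0%E].

Definition Linf_norm (l : R) (f : R -> R -> R) : \bar R :=
  ess_sup mu ((fun t => Hnorm l (f t)) \_ `[0, +oo[).

Definition Linf (l : R) (f : R -> R -> R) : Prop :=
  [/\ \forall t \ae mu, 0 <= t -> Hper0 l (f t),
      strongly_measurable l f &
      (Linf_norm l f < +oo)%E].

Definition continuous_Hper (l : R) (u : R -> R -> R) : Prop :=
  forall t, 0 <= t ->
    Hnorm l (u s \- u t) @[s --> within `[0, +oo[ (nbhs t)] --> 0%E.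

(* The H^l-valued Duhamel integral is a Bochner integral, and Fourier
   coefficients are continuous linear functionals on H^l: the identity is
   written coefficient by coefficient. Continuity in time is what makes the
   integrand Bochner integrable on [0, t]. *)
Definition mild_solution (l beta gamma : R) (f u : R -> R -> R) : Prop :=
  [/\ forall t, 0 <= t -> Hper0 l (u t),
      continuous_Hper l u &
      forall t, 0 <= t -> forall k,
        fourier (u t) k =
          semigroup beta gamma t (fourier (u 0)) k +
          cintegral `[0, t] (fun s =>
            semigroup beta gamma (t - s)
              (resolvent (fun j => fourier (f s) j - convection (u s) j)) k)].

Definition time_periodic (theta : R) (u : R -> R -> R) : Prop :=
  forall t, 0 <= t -> aeeq (u (t + theta)) (u t).

(* For the elements of L^oo([0, oo[; H^l_{per,0}), which are defined up to a
   negligible set of times. *)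
Definition ae_time_periodic (theta : R) (f : R -> R -> R) : Prop :=
  \forall t \ae mu, 0 <= t -> aeeq (f (t + theta)) (f t).

Definition locally_stable (l beta gamma : R) (f ut : R -> R -> R) : Prop :=
  exists2 eps : R, 0 < eps &
    forall u, mild_solution l beta gamma f u ->
      (Hnorm l (u 0 \- ut 0)%R < eps%:E)%E ->
      Hnorm l (u t \- ut t) @[t --> +oo] --> 0%E.

End Defs.

(* Main.v *)
(* Everything is done on Fourier coefficients, where A is diagonal and, by the
   condition on gamma, has real part at most -c0 < 0 on nonzero modes.
   Write V_k = (1 + (2 pi k)^2)^(l/2 + 1).

   Existence: since (I - Delta)^-1 d_x gains a derivative and the weight V_k is
   stable under convolution, the map sending a periodic trajectory to the
   periodic solution of the linear equation it forces contracts a small ball of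
   coefficients bounded by rho / V_k.

   Uniqueness: in the difference w of two periodic solutions the forcing cancels,
   and every function of time attains its maximum at a point where its derivative
   vanishes.  This bounds each mode of w by its nonlinear term, so that w gains
   decay in k by bootstrapping, until it is smooth enough for the energy
   estimate; there the cubic term integrates to zero, and the
   term containing the small solution is absorbed by the dissipation.

   Stability: the dissipation is at least c0 in the weighted norm of every mode,
   so that the squared H^l norm y of the perturbation satisfies
   y' <= -c0 y + C (rho^2 + y) y and decays exponentially as long as y is small. *)
Require Import Defs.
From mathcomp Require Import all_boot all_order all_algebra.
From mathcomp Require Import all_classical all_reals all_analysis.
From mathcomp Require Import measurable_realfun ess_sup_inf complex ring lra zify.

Set Implicit Arguments.
Unset Strict Implicit.
Unset Printing Implicit Defensive.

Import Order.TTheory GRing.Theory Num.Theory.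
Import numFieldNormedType.Exports.

Local Open Scope classical_set_scope.
Local Open Scope ring_scope.

Local Notation normc := ComplexField.Normc.normc.
Local Notation Re := (@complex.Re _).
Local Notation Im := (@complex.Im _).
Local Notation "x %:C" := (real_complex _ x).
Local Notation "x +i* y" := (Complex x y).
Local Notation "R [i]" := (complex R) (at level 1, left associativity, format "R [i]").

(** * Complex numbers and sums over the integers *)

(** For small [l] the space H^l is not an algebra and u^2 is merely integrable, so the fixed point
    is not sought in H^l itself. Nor does the semigroup smooth, A being of order zero: all
    regularity comes from (I - Delta)^-1. Acting on f, it gives the periodic solution coefficients
    of size rho / V_k, which are summable and so control the sup norm; uniqueness and stability use
    the constructed solution only through such bounds. The competitor v in the uniqueness statement
    may be large, so the part of the flux that is quadratic in the difference w cannot be absorbed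
    and has to cancel exactly; this cancellation holds for a truncation of w, and the bootstrap
    serves to make the truncation error small. Truncation is forced because differentiability in
    time is known mode by mode, hence for finite sums only. No Cauchy problem is solved: stability
    quantifies over given mild solutions, and the periodic solution is found by inverting 1 -
    e^(theta A) on each mode, of modulus at least 1 - e^(- c0 theta). The radius rho is fixed before
    delta. *)

Section Complex.
Variable R : realType.
Implicit Types (z w : R[i]) (x y : R).

Lemma ReD z w : Re (z + w) = Re z + Re w. Proof. by case: z; case: w. Qed.
Lemma ImD z w : Im (z + w) = Im z + Im w. Proof. by case: z; case: w. Qed.
Lemma ReN z : Re (- z) = - Re z. Proof. by case: z. Qed.
Lemma ImN z : Im (- z) = - Im z. Proof. by case: z. Qed.
Lemma ReB z w : Re (z - w) = Re z - Re w. Proof. by rewrite ReD ReN. Qed.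
Lemma ImB z w : Im (z - w) = Im z - Im w. Proof. by rewrite ImD ImN. Qed.
Lemma ReM z w : Re (z * w) = Re z * Re w - Im z * Im w.
Proof. by case: z; case: w. Qed.
Lemma ImM z w : Im (z * w) = Re z * Im w + Im z * Re w.
Proof. by case: z; case: w. Qed.

Lemma Re_sum (I : Type) (s : seq I) (F : I -> R[i]) :
  Re (\sum_(i <- s) F i) = \sum_(i <- s) Re (F i).
Proof. by rewrite (big_morph Re ReD (erefl : Re (0 : R[i]) = 0)). Qed.

Lemma Im_sum (I : Type) (s : seq I) (F : I -> R[i]) :
  Im (\sum_(i <- s) F i) = \sum_(i <- s) Im (F i).
Proof. by rewrite (big_morph Im ImD (erefl : Im (0 : R[i]) = 0)). Qed.

Lemma complex_eqP z w : Re z = Re w -> Im z = Im w -> z = w.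
Proof. by case: z w => a b [c d] /= -> ->. Qed.

Lemma normc_ge0 z : 0 <= normc z.
Proof. by case: z => a b; exact: sqrtr_ge0. Qed.

Lemma sqr_normcE z : normc z ^+ 2 = Re z ^+ 2 + Im z ^+ 2.
Proof. by case: z => a b /=; rewrite sqr_sqrtr// addr_ge0// sqr_ge0. Qed.

Lemma normcM z w : normc (z * w) = normc z * normc w.
Proof. exact: ComplexField.Normc.normcM. Qed.

Lemma normcD z w : normc (z + w) <= normc z + normc w.
Proof. exact: le_normcD. Qed.

Lemma normcN z : normc (- z) = normc z.
Proof. by rewrite normcN. Qed.

Lemma normcB z w : normc (z - w) <= normc z + normc w.
Proof. by rewrite (le_trans (normcD _ _))// normcN. Qed.

Lemma normc_distC z w : normc (z - w) = normc (w - z).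
Proof. by rewrite -normcN opprB. Qed.

Lemma normc0 : normc (0 : R[i]) = 0.
Proof. exact: ComplexField.Normc.normc0. Qed.

Lemma normc_real x : normc (x%:C) = `|x|.
Proof. by rewrite /= expr0n /= addr0 sqrtr_sqr. Qed.

Lemma ler_Re z : `|Re z| <= normc z.
Proof.
by rewrite -(ler_sqr (normr_ge0 _) (normc_ge0 _)) sqr_normcE real_normK ?num_real// lerDl sqr_ge0.
Qed.

Lemma ler_Im z : `|Im z| <= normc z.
Proof.
by rewrite -(ler_sqr (normr_ge0 _) (normc_ge0 _)) sqr_normcE real_normK ?num_real// lerDr sqr_ge0.
Qed.

Lemma normc_le_ReIm z : normc z <= `|Re z| + `|Im z|.
Proof.
rewrite -(ler_sqr (normc_ge0 _)) ?nnegrE ?addr_ge0// sqr_normcE.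
rewrite -[Re z ^+ 2]real_normK ?num_real// -[Im z ^+ 2]real_normK ?num_real//.
by have := normr_ge0 (Re z); have := normr_ge0 (Im z); nra.
Qed.

Lemma normc_sum (I : Type) (s : seq I) (F : I -> R[i]) :
  normc (\sum_(i <- s) F i) <= \sum_(i <- s) normc (F i).
Proof.
elim/big_ind2 : _ => [|x1 y1 x2 y2 h1 h2|//]; first by rewrite normc0.
by rewrite (le_trans (normcD _ _))// lerD.
Qed.

Lemma normc0_eq0 z : normc z <= 0 -> z = 0.
Proof.
move=> h; apply: ComplexField.Normc.eq0_normc.
by apply/eqP; rewrite eq_le h normc_ge0.
Qed.

Lemma cexpD z w : cexp (z + w) = cexp z * cexp w.
Proof.
apply: complex_eqP; rewrite ?ReM ?ImM /cexp /= ReD ImD expRD ?cosD ?sinD; ring.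
Qed.

Lemma cexp0 : cexp (0 : R[i]) = 1.
Proof. by apply: complex_eqP; rewrite /cexp /= expR0 ?cos0 ?sin0 ?mulr1 ?mulr0. Qed.

Lemma normc_cexp z : normc (cexp z) = expR (Re z).
Proof.
apply/eqP; rewrite -(eqrXn2 (n:=2))// ?normc_ge0 ?expR_ge0//.
rewrite sqr_normcE /cexp /= !exprMn -mulrDr cos2Dsin2 mulr1//.
Qed.

End Complex.

(** * Nonnegative series over the integers, through symmetric partial sums *)

Section FiniteSums.
Variable R : realType.
Implicit Types (F G : int -> R) (n : nat) (s : seq int).

Lemma sum_uniq_sub (T : eqType) (s t : seq T) (F : T -> R) : (forall k, 0 <= F k) -> uniq s -> uniq t ->
  {subset s <= t} -> \sum_(k <- s) F k <= \sum_(k <- t) F k.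
Proof.
move=> F0 us ut st; rewrite [leRHS](bigID (fun k => k \in s))/=.
rewrite -[X in X + _]big_filter.
have -> : \sum_(i <- [seq i <- t | i \in s]) F i = \sum_(k <- s) F k.
  apply: perm_big; apply: uniq_perm => //; first exact: filter_uniq.
  by move=> k; rewrite mem_filter; case: (boolP (k \in s)) => // /st ->.
by rewrite lerDl sumr_ge0.
Qed.

Lemma cauchy_schwarz_sum (I : Type) (s : seq I) (a b : I -> R) :
  (\sum_(i <- s) a i * b i) ^+ 2 <=
  (\sum_(i <- s) a i ^+ 2) * (\sum_(i <- s) b i ^+ 2).
Proof.
elim: s => [|i s ih]; first by rewrite !big_nil expr0n mul0r.
rewrite !big_cons.
set A := \sum_(j <- s) a j * b j in ih *.
set P := \sum_(j <- s) a j ^+ 2 in ih *.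
set Q := \sum_(j <- s) b j ^+ 2 in ih *.
have P0 : 0 <= P by apply: sumr_ge0 => j _; exact: sqr_ge0.
have Q0 : 0 <= Q by apply: sumr_ge0 => j _; exact: sqr_ge0.
(* The induction hypothesis gives A^2 <= P Q, so the square of the cross term is at most 4 (P b^2)
   (Q a^2), hence at most (P b^2 + Q a^2)^2. *)
suff h : 2 * (A * (a i * b i)) <= P * b i ^+ 2 + Q * a i ^+ 2 by nra.
set Y := leRHS; set X := leLHS.
have Y0 : 0 <= Y by rewrite addr_ge0// mulr_ge0// sqr_ge0.
have XY : X ^+ 2 <= Y ^+ 2.
  rewrite /X /Y; apply: (@le_trans _ _ (4 * (P * Q) * (a i * b i) ^+ 2)).
    have := sqr_ge0 (a i * b i); nra.
  have := sqr_ge0 (P * b i ^+ 2 - Q * a i ^+ 2); nra.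
by rewrite (le_trans (ler_norm _))// -(ler_sqr (normr_ge0 _) Y0) real_normK// num_real.
Qed.

(** Windows symmetric under k -> -k: odd summands cancel over them, and conjugate modes always occur
    together. *)
Definition box n : seq int := [seq (i%:Z - n%:Z)%R | i <- iota 0 (2 * n).+1].

Lemma mem_box n (k : int) : (k \in box n) = (`|k| <= n)%N.
Proof.
apply/mapP/idP => [[m]|h].
  by rewrite mem_iota add0n => /andP[_ hi] ->; lia.
by exists (absz (k + n%:Z)); [rewrite mem_iota add0n; apply/andP; split; lia | lia].
Qed.

Lemma box_uniq n : uniq (box n).
Proof. by rewrite map_inj_uniq ?iota_uniq// => i j; lia. Qed.

Lemma box_sub m n : (m <= n)%N -> {subset box m <= box n}.
Proof. by move=> mn k; rewrite !mem_box => /leq_trans; apply. Qed.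

Lemma seq_sub_box s : exists n, {subset s <= box n}.
Proof.
elim: s => [|k s [n ih]]; first by exists 0%N.
exists (maxn `|k|%N n) => j; rewrite inE => /predU1P[->|/ih].
  by rewrite mem_box leq_maxl.
by rewrite !mem_box => /leq_trans; apply; rewrite leq_maxr.
Qed.

Lemma ler_sum_box m n F : (forall k, 0 <= F k) -> (m <= n)%N ->
  \sum_(k <- box m) F k <= \sum_(k <- box n) F k.
Proof.
by move=> F0 mn; apply: sum_uniq_sub => //; [exact: box_uniq|exact: box_uniq|exact: box_sub].
Qed.

(** Summability of a nonnegative family as a uniform bound on its partial sums. The estimates stay
    in [R], and [esum_leP] translates them to the extended sum inside [Hnorm]. *)
Definition sumle F (B : R) := forall n, \sum_(k <- box n) F k <= B.

Lemma sumle_seq F B s : (forall k, 0 <= F k) -> sumle F B -> uniq s ->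
  \sum_(k <- s) F k <= B.
Proof.
move=> F0 FB us; have [n sn] := seq_sub_box s.
exact: le_trans (sum_uniq_sub F0 us (box_uniq n) sn) (FB n).
Qed.

Lemma sumle_shift F B (k : int) n : (forall k, 0 <= F k) -> sumle F B ->
  \sum_(j <- box n) F (k - j) <= B.
Proof.
move=> F0 FB; rewrite -(big_map (fun j => k - j) predT F).
by apply: sumle_seq => //; rewrite map_inj_uniq ?box_uniq// => i j; lia.
Qed.

Lemma sumle1 F B k : (forall k, 0 <= F k) -> sumle F B -> F k <= B.
Proof.
by move=> F0 FB; have := sumle_seq (s:=[:: k]) F0 FB erefl; rewrite big_seq1.
Qed.

Lemma le_sumle F G B : (forall k, F k <= G k) -> sumle G B -> sumle F B.
Proof. by move=> FG GB n; apply: le_trans (GB n); exact: ler_sum. Qed.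

Lemma sumleZ F B c : 0 <= c -> sumle F B -> sumle (fun k => c * F k) (c * B).
Proof. by move=> c0 FB n; rewrite -mulr_sumr ler_wpM2l. Qed.

Lemma sumleD F G B C : sumle F B -> sumle G C -> sumle (F \+ G) (B + C).
Proof. by move=> FB GC n; rewrite big_split lerD. Qed.

Lemma esum_leP F B : (forall k, 0 <= F k) ->
  (\esum_(k in [set: int]) (F k)%:E <= B%:E)%E <-> sumle F B.
Proof.
move=> F0; split=> [h n|h].
  rewrite -lee_fin -sumEFin; apply: le_trans h.
  apply: esum_ge; exists [set` box n]; first by split => //; exact: finite_seq.
  by rewrite fsbig_seq ?box_uniq.
apply: ub_ereal_sup => _ [X [finX _] <-].
rewrite fsbig_finite//= sumEFin lee_fin.
by apply: sumle_seq => //; exact: finmap.fset_uniq.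
Qed.

(** Otherwise m disjoint blocks of mass more than e could be stacked, and m e exceeds B for large
    m. *)
Lemma sumle_tail F B : (forall k, 0 <= F k) -> sumle F B ->
  forall e : R, 0 < e -> exists N, forall n, \sum_(k <- box n | (N < `|k|)%N) F k <= e.
Proof.
move=> F0 FB e e0; apply: contrapT => /forallNP h.
have [m hm] : exists m : nat, B < m%:R * e.
  exists (Num.truncn (B / e)).+1; rewrite -ltr_pdivrMr//.
  by rewrite truncnS_gt.
have step : forall j : nat, exists n, j%:R * e <= \sum_(k <- box n) F k.
  elim=> [|j [n ih]]; first by exists 0%N; rewrite mul0r sumr_ge0.
  have /existsNP[p /negP] := h n; rewrite -ltNge => hp.
  exists (maxn n p); rewrite -natr1 mulrDl mul1r.
  rewrite (bigID (fun k : int => (n < `|k|)%N))/= addrC lerD//.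
    rewrite (le_trans ih)// -[leRHS]big_filter.
    apply: sum_uniq_sub; rewrite ?filter_uniq ?box_uniq// => k kn.
    rewrite mem_filter -leqNgt -mem_box kn /=.
    by apply: box_sub kn; rewrite leq_maxl.
  rewrite (le_trans (ltW hp))// -[leLHS]big_filter -[leRHS]big_filter.
  apply: sum_uniq_sub; rewrite ?filter_uniq ?box_uniq// => k.
  rewrite !mem_filter => /andP[-> /=].
  by apply: box_sub; rewrite leq_maxr.
have [n hn] := step m.
by have := FB n; rewrite leNgt (lt_le_trans hm).
Qed.

End FiniteSums.

(** * Square integrable functions on the unit interval *)

Section SquareIntegrable.
Variable R : realType.
Notation mu := (@lebesgue_measure R).
Implicit Types (f g h : R -> R) (c : R).

Definition itg g := mu.-integrable `[0, 1] (EFin \o g).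
Definition int01 g : R := Rintegral mu `[0, 1] g.
(** [L2T] without periodicity, which Fourier coefficients do not see. Measurability is required on
    the whole line so that it passes through sums and products without restricting domains. *)
Definition sqint g := measurable_fun [set: R] g /\ itg (fun x => g x ^+ 2).

Let mI : measurable (`[0, 1]%classic : set (measurableTypeR R)).
Proof. exact: measurable_itv. Qed.

Lemma mu01 : mu `[0, 1] = 1%E.
Proof. by rewrite lebesgue_measure_itv/= lte_fin ltr01 sube0. Qed.

Lemma itgD f g : itg f -> itg g -> itg (fun x => f x + g x).
Proof. by move=> hf hg; apply: (eq_integrable mI _ _ _ (integrableD mI hf hg)) => x _. Qed.

Lemma itgZ c f : itg f -> itg (fun x => c * f x).
Proof. by move=> hf; apply: (eq_integrable mI _ _ _ (integrableZl mI c hf)) => x _. Qed.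

Lemma itgN f : itg f -> itg (fun x => - f x).
Proof. by move=> /(itgZ (-1)); under eq_fun do rewrite mulN1r. Qed.

Lemma itgB f g : itg f -> itg g -> itg (fun x => f x - g x).
Proof. by move=> hf hg; apply: itgD => //; exact: itgN. Qed.

Lemma itg_le f g : measurable_fun [set: R] f -> itg g ->
  (forall x, `|f x| <= g x) -> itg f.
Proof.
move=> mf hg fg; apply: (le_integrable mI _ _ hg).
  by apply/measurable_EFinP; exact: measurable_funS mf.
by move=> x _ /=; rewrite lee_fin (le_trans (fg x))// ler_norm.
Qed.

Lemma itg_cst c : itg (fun=> c).
Proof.
apply: measurable_bounded_integrable => //.
  by have h := mu01; apply: (@le_lt_trans _ _ 1%E); [rewrite -h|exact: ltry].
exact: bounded_cst.
Qed.

Lemma itg_bounded f c : measurable_fun [set: R] f -> (forall x, `|f x| <= c) -> itg f.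
Proof. by move=> mf fc; apply: itg_le mf (itg_cst c) fc. Qed.

Lemma itg_norm f : itg f -> itg (fun x => `|f x|).
Proof. by move=> hf; exact: integrable_norm. Qed.

Lemma itg_sum (I : Type) (s : seq I) (F : I -> R -> R) :
  (forall i, itg (F i)) -> itg (fun x => \sum_(i <- s) F i x).
Proof.
move=> h; elim: s => [|i s ih].
  by under eq_fun do rewrite big_nil; exact: itg_cst.
by under eq_fun do rewrite big_cons; exact: itgD.
Qed.

Lemma int01D f g : itg f -> itg g -> int01 (fun x => f x + g x) = int01 f + int01 g.
Proof. exact: RintegralD. Qed.

Lemma int01B f g : itg f -> itg g -> int01 (fun x => f x - g x) = int01 f - int01 g.
Proof. exact: RintegralB. Qed.

Lemma int01Z c f : itg f -> int01 (fun x => c * f x) = c * int01 f.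
Proof. exact: RintegralZl. Qed.

Lemma int01_cst c : int01 (fun=> c) = c.
Proof. by rewrite /int01 Rintegral_cst// (_ : fine _ = 1) ?mulr1//; exact: (congr1 fine mu01). Qed.

Lemma int01_sum (I : Type) (s : seq I) (F : I -> R -> R) :
  (forall i, itg (F i)) ->
  int01 (fun x => \sum_(i <- s) F i x) = \sum_(i <- s) int01 (F i).
Proof.
move=> h; elim: s => [|i s ih].
  by under [in LHS]eq_fun do rewrite big_nil; rewrite int01_cst big_nil.
under [in LHS]eq_fun do rewrite big_cons.
by rewrite big_cons int01D ?ih//; exact: itg_sum.
Qed.

Lemma int01_le f g : itg f -> itg g -> (forall x, f x <= g x) -> int01 f <= int01 g.
Proof. by move=> hf hg fg; apply: le_Rintegral => // x _; exact: fg. Qed.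

Lemma int01_ge0 f : (forall x, 0 <= f x) -> 0 <= int01 f.
Proof. by move=> h; apply: Rintegral_ge0 => x _. Qed.

Lemma int01_norm f : itg f -> `|int01 f| <= int01 (fun x => `|f x|).
Proof. by move=> hf; exact: le_normr_Rintegral. Qed.

Lemma sqint_mul f g : sqint f -> sqint g -> itg (fun x => f x * g x).
Proof.
move=> [mf f2] [mg g2]; apply: (itg_le _ (itgD f2 g2)).
  exact: measurable_funM.
move=> x; rewrite normrM -[f x ^+ 2]real_normK ?num_real// -[g x ^+ 2]real_normK ?num_real//.
by have := normr_ge0 (f x); have := normr_ge0 (g x); nra.
Qed.

Lemma sqintM_bounded f g c : sqint f -> measurable_fun [set: R] g ->
  (forall x, `|g x| <= c) -> sqint (fun x => f x * g x).
Proof.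
move=> [mf f2] mg gc; split; first exact: measurable_funM.
apply: (itg_le _ (itgZ (c ^+ 2) f2)).
  by apply: measurable_funX; exact: measurable_funM.
move=> x; rewrite ger0_norm ?sqr_ge0// exprMn mulrC ler_wpM2r ?sqr_ge0//.
rewrite -[g x ^+ 2]real_normK ?num_real// ler_sqr ?nnegrE//.
exact: le_trans (gc x).
Qed.

Lemma sqint_bounded f c : measurable_fun [set: R] f -> (forall x, `|f x| <= c) -> sqint f.
Proof.
move=> mf fc; split => //; apply: (itg_bounded (c := c ^+ 2)).
  exact: measurable_funX.
move=> x; rewrite ger0_norm ?sqr_ge0//.
rewrite -[f x ^+ 2]real_normK ?num_real// ler_sqr ?nnegrE//.
exact: le_trans (fc x).
Qed.

Lemma sqint_cst c : sqint (fun=> c).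
Proof. exact: (@sqint_bounded _ `|c|). Qed.

Lemma sqint_itg f : sqint f -> itg f.
Proof.
move=> hf; have := sqint_mul hf (sqint_cst 1).
by under eq_fun do rewrite mulr1.
Qed.

Lemma sqintZ c f : sqint f -> sqint (fun x => c * f x).
Proof.
move=> hf; under eq_fun do rewrite mulrC.
exact: (@sqintM_bounded _ _ `|c|).
Qed.

Lemma sqintD f g : sqint f -> sqint g -> sqint (fun x => f x + g x).
Proof.
move=> hf hg; split; first by apply: measurable_funD; [case: hf|case: hg].
have -> : (fun x => (f x + g x) ^+ 2) = (fun x => (f x ^+ 2 + 2 * (f x * g x)) + g x ^+ 2).
  by apply/funext => x; ring.
by apply: itgD; [apply: itgD; [case: hf|apply/itgZ/sqint_mul]|case: hg].
Qed.

Lemma sqintB f g : sqint f -> sqint g -> sqint (fun x => f x - g x).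
Proof.
move=> hf hg; have := sqintD hf (sqintZ (-1) hg).
by under eq_fun do rewrite mulN1r.
Qed.

Lemma sqint_sum (I : Type) (s : seq I) (F : I -> R -> R) :
  (forall i, sqint (F i)) -> sqint (fun x => \sum_(i <- s) F i x).
Proof.
move=> h; elim: s => [|i s ih].
  by under eq_fun do rewrite big_nil; exact: sqint_cst.
by under eq_fun do rewrite big_cons; exact: sqintD.
Qed.

Lemma int01_sqD_le f g : sqint f -> sqint g ->
  int01 (fun x => (f x + g x) ^+ 2) <=
  2 * int01 (fun x => f x ^+ 2) + 2 * int01 (fun x => g x ^+ 2).
Proof.
move=> hf hg; have [_ h] := sqintD hf hg; case: (hf) => _ hf2; case: (hg) => _ hg2.
rewrite -!int01Z// -int01D; [|exact: itgZ..].
apply: int01_le => //; first by apply: itgD; exact: itgZ.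
by move=> x; have := sqr_ge0 (f x - g x); nra.
Qed.

Lemma int01_dominated (f_ : nat -> R -> R) f (G : R -> R) :
  (forall n, measurable_fun [set: R] (f_ n)) -> measurable_fun [set: R] f ->
  itg G -> (forall n x, `|f_ n x| <= G x) ->
  {ae mu, forall x, 0 <= x <= 1 -> f_ ^~ x @ \oo --> f x} ->
  int01 (fun x => `|f_ n x - f x|) @[n --> \oo] --> 0.
Proof.
move=> mf_ mf iG fG cv.
have m1 n : measurable_fun (`[0, 1]%classic : set (measurableTypeR R)) (EFin \o f_ n).
  by apply/measurable_EFinP; exact: measurable_funS (mf_ n).
have m2 : measurable_fun (`[0, 1]%classic : set (measurableTypeR R)) (EFin \o f).
  by apply/measurable_EFinP; exact: measurable_funS mf.
have c1 : {ae mu, forall x, `[0, 1]%classic x -> (EFin \o f_ ^~ x) @ \oo --> (EFin \o f) x}.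
  apply: (@filterS _ _ (ae_filter_ringOfSetsType mu) _ _ _ cv) => x {}cv /=; rewrite in_itv/= => x01.
  by apply: cvg_EFin; [exact: nearW|exact: cv].
have b1 : {ae mu, forall x n, `[0, 1]%classic x -> (`|(EFin \o f_ n) x| <= (EFin \o G) x)%E}.
  by apply: aeW => x n _ /=; rewrite lee_fin.
have [_ cv' _] := @dominated_convergence _ _ _ mu _ mI (fun n => EFin \o f_ n) (EFin \o f) (EFin \o G) m1 m2 c1 iG b1.
by move: cv' => /fine_cvgP[_].
Qed.

End SquareIntegrable.

(** * Cosines, sines and trigonometric polynomials *)

Section Trig.
Variable R : realType.
Notation mu := (@lebesgue_measure R).
Implicit Types (f g h T : R -> R) (c : R) (k j : int).

Lemma derivable_cont (F : R -> R) (x : R) : derivable F x 1 -> {for x, continuous F}.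
Proof. by move=> h; apply/differentiable_continuous/derivable1_diffP. Qed.

Lemma isd_eq f (x d d' : R) : is_derive x 1 f d -> d = d' -> is_derive x 1 f d'.
Proof. by move=> h <-. Qed.

Lemma isdD f g (x a b : R) : is_derive x 1 f a -> is_derive x 1 g b ->
  is_derive x 1 (fun y => f y + g y) (a + b).
Proof. by move=> hf hg; exact: is_deriveD. Qed.

Lemma isdM f g (x a b : R) : is_derive x 1 f a -> is_derive x 1 g b ->
  is_derive x 1 (fun y => f y * g y) (a * g x + f x * b).
Proof.
move=> hf hg; apply: (isd_eq (is_deriveM hf hg)).
by rewrite /GRing.scale/= addrC; congr (_ + _); exact: mulrC.
Qed.

Lemma isd_cst c (x : R) : is_derive x 1 (fun=> c) 0.
Proof. exact: is_derive_cst. Qed.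

Lemma isd_id (x : R) : is_derive x 1 (fun y : R => y) 1.
Proof. exact: is_derive_id. Qed.

Lemma isdZ c f (x a : R) : is_derive x 1 f a -> is_derive x 1 (fun y => c * f y) (c * a).
Proof. by move=> h; apply: isd_eq (isdM (isd_cst c x) h) _; rewrite mul0r add0r. Qed.

Lemma isd_comp f g (x a b : R) : is_derive (g x) 1 f a -> is_derive x 1 g b ->
  is_derive x 1 (fun y => f (g y)) (a * b).
Proof. by move=> hf hg; exact: is_derive1_comp. Qed.

Lemma isd_sum (I : Type) (s : seq I) (F : I -> R -> R) (d : I -> R) (x : R) :
  (forall i, is_derive x 1 (F i) (d i)) ->
  is_derive x 1 (fun y => \sum_(i <- s) F i y) (\sum_(i <- s) d i).
Proof.
move=> h; elim: s => [|i s ih].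
  by under eq_fun do rewrite big_nil; rewrite big_nil; exact: isd_cst.
by under eq_fun do rewrite big_cons; rewrite big_cons; exact: isdD.
Qed.

Lemma isd_cont f (x a : R) : is_derive x 1 f a -> {for x, continuous f}.
Proof. by move=> h; apply: derivable_cont; apply: ex_derive. Qed.

Lemma FTC01 (f F : R -> R) : (forall x : R, is_derive x 1 F (f x)) -> continuous f ->
  int01 f = F 1 - F 0.
Proof.
move=> dF cf; have cF (x : R) : {for x, continuous F}.
  by apply: derivable_cont; apply: ex_derive.
rewrite /int01 /Rintegral (@continuous_FTC2 _ f F) ?ltr01//.
- exact: continuous_subspaceT.
- split.
  + by move=> x _; apply: ex_derive.
  + by apply: cvg_at_right_filter; exact: cF.
  + by apply: cvg_at_left_filter; exact: cF.
- by move=> x _; rewrite derive1E; apply: derive_val.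
Qed.

Lemma freqD k j : freq (k + j) = freq k + freq j :> R.
Proof. by rewrite /freq intrD mulrDr. Qed.
Lemma freqN k : freq (- k) = - freq k :> R.
Proof. by rewrite /freq mulrNz mulrN. Qed.
Lemma freq0 : freq 0 = 0 :> R.
Proof. by rewrite /freq mulr0. Qed.
Lemma freq_eq0 k : (freq k == 0 :> R) = (k == 0).
Proof.
by rewrite /freq mulf_eq0 intr_eq0 mulf_eq0 pnatr_eq0/= gt_eqF ?pi_gt0.
Qed.

Lemma cos_sin_freq k : cos (freq k) = 1 :> R /\ sin (freq k) = 0 :> R.
Proof.
have hn (n : nat) : cos (freq n) = 1 :> R /\ sin (freq n) = 0 :> R.
  elim: n => [|n [c s]]; first by rewrite freq0 cos0 sin0.
  have -> : freq n.+1 = freq n + pi *+ 2 :> R.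
    by rewrite /freq intS intrD mulrDr mulr1 addrC mulr_natl.
  by rewrite cosD2pi sinD2pi.
case: k => n; first exact: hn.
rewrite NegzE freqN cosN sinN; have [-> ->] := hn n.+1.
by rewrite oppr0.
Qed.

Definition cosk k : R -> R := fun x => cos (freq k * x).
Definition sink k : R -> R := fun x => sin (freq k * x).

Lemma cosk_periodic k x : cosk k (x + 1) = cosk k x.
Proof.
by have [c s] := cos_sin_freq k; rewrite /cosk mulrDr mulr1 cosD c s mulr1 mulr0 subr0.
Qed.
Lemma sink_periodic k x : sink k (x + 1) = sink k x.
Proof.
by have [c s] := cos_sin_freq k; rewrite /sink mulrDr mulr1 sinD c s mulr1 mulr0 addr0.
Qed.

Lemma is_derive_cosk k (x : R) : is_derive x 1 (cosk k) (- freq k * sink k x).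
Proof.
by apply: isd_eq (isd_comp (is_derive_cos _) (isdZ (freq k) (isd_id x))) _; rewrite /sink /cosk; ring.
Qed.

Lemma is_derive_sink k (x : R) : is_derive x 1 (sink k) (freq k * cosk k x).
Proof.
by apply: isd_eq (isd_comp (is_derive_sin _) (isdZ (freq k) (isd_id x))) _; rewrite /sink /cosk; ring.
Qed.

Lemma continuous_cosk k : continuous (cosk k).
Proof. by move=> x; apply: isd_cont (is_derive_cosk k x). Qed.
Lemma continuous_sink k : continuous (sink k).
Proof. by move=> x; apply: isd_cont (is_derive_sink k x). Qed.
Lemma measurable_cosk k : measurable_fun [set: R] (cosk k).
Proof. by apply: continuous_measurable_fun; exact: continuous_cosk. Qed.
Lemma measurable_sink k : measurable_fun [set: R] (sink k).
Proof. by apply: continuous_measurable_fun; exact: continuous_sink. Qed.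
Lemma cosk_max k x : `|cosk k x| <= 1. Proof. exact: cos_max. Qed.
Lemma sink_max k x : `|sink k x| <= 1. Proof. exact: sin_max. Qed.
Lemma sqint_cosk k : sqint (cosk k).
Proof. exact: sqint_bounded (measurable_cosk k) (cosk_max k). Qed.
Lemma sqint_sink k : sqint (sink k).
Proof. exact: sqint_bounded (measurable_sink k) (sink_max k). Qed.

Lemma cosk0 x : cosk 0 x = 1. Proof. by rewrite /cosk freq0 mul0r cos0. Qed.
Lemma sink0 x : sink 0 x = 0. Proof. by rewrite /sink freq0 mul0r sin0. Qed.
Lemma coskN k x : cosk (- k) x = cosk k x.
Proof. by rewrite /cosk freqN mulNr cosN. Qed.
Lemma sinkN k x : sink (- k) x = - sink k x.
Proof. by rewrite /sink freqN mulNr sinN. Qed.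
Lemma coskD k j x : cosk (k + j) x = cosk k x * cosk j x - sink k x * sink j x.
Proof. by rewrite /cosk /sink freqD mulrDl cosD. Qed.
Lemma sinkD k j x : sink (k + j) x = sink k x * cosk j x + cosk k x * sink j x.
Proof. by rewrite /cosk /sink freqD mulrDl sinD. Qed.

Lemma int01_cosk k : int01 (cosk k) = (k == 0)%:R.
Proof.
have [->|k0] := eqVneq k 0.
  have -> : cosk 0 = fun=> 1 by apply/funext => x; rewrite cosk0.
  by rewrite int01_cst.
have dF (x : R) : is_derive x 1 (fun x => (freq k)^-1 * sink k x) (cosk k x).
  apply: isd_eq (isdZ _ (is_derive_sink k x)) _.
  by rewrite mulrA mulVf ?mul1r// freq_eq0.
rewrite (FTC01 dF (@continuous_cosk k)).
by rewrite /sink mulr1 mulr0 sin0 (cos_sin_freq k).2 mulr0 subrr.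
Qed.

Lemma int01_sink k : int01 (sink k) = 0.
Proof.
have [->|k0] := eqVneq k 0.
  have -> : sink 0 = fun=> 0 by apply/funext => x; rewrite sink0.
  by rewrite int01_cst.
have dF (x : R) : is_derive x 1 (fun x => - (freq k)^-1 * cosk k x) (sink k x).
  apply: isd_eq (isdZ _ (is_derive_cosk k x)) _.
  by rewrite mulrA mulrNN mulVf ?mul1r// freq_eq0.
rewrite (FTC01 dF (@continuous_sink k)).
by rewrite /cosk mulr1 mulr0 cos0 (cos_sin_freq k).1 mulr1 subrr.
Qed.

Lemma int01_coscos k j :
  int01 (fun x => cosk k x * cosk j x) = ((k == j)%:R + (k == - j)%:R) / 2.
Proof.
have -> : (fun x => cosk k x * cosk j x) =
    fun x => 2^-1 * (cosk (k - j) x + cosk (k + j) x).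
  by apply/funext => x; rewrite !coskD coskN sinkN; field.
rewrite int01Z ?int01D ?int01_cosk ?subr_eq0 ?addr_eq0 1?mulrC//;
  by rewrite ?itgD//; exact/sqint_itg/sqint_cosk.
Qed.

Lemma int01_sinsin k j :
  int01 (fun x => sink k x * sink j x) = ((k == j)%:R - (k == - j)%:R) / 2.
Proof.
have -> : (fun x => sink k x * sink j x) =
    fun x => 2^-1 * (cosk (k - j) x - cosk (k + j) x).
  by apply/funext => x; rewrite !coskD coskN sinkN; field.
rewrite int01Z ?int01B ?int01_cosk ?subr_eq0 ?addr_eq0 1?mulrC//;
  by rewrite ?itgB//; exact/sqint_itg/sqint_cosk.
Qed.

Lemma int01_sincos k j : int01 (fun x => sink k x * cosk j x) = 0.
Proof.
have -> : (fun x => sink k x * cosk j x) =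
    fun x => 2^-1 * (sink (k - j) x + sink (k + j) x).
  by apply/funext => x; rewrite !sinkD coskN sinkN; field.
rewrite int01Z ?int01D ?int01_sink ?addr0 ?mulr0//;
  by rewrite ?itgD//; exact/sqint_itg/sqint_sink.
Qed.

(** No normal form for the coefficients is kept: closure under sums and products, and induction on
    the number of terms, are all that density and orthogonality require. *)
Inductive trig : (R -> R) -> Prop :=
| trig0 : trig (fun=> 0)
| trig_cos c k T : trig T -> trig (fun x => c * cosk k x + T x)
| trig_sin c k T : trig T -> trig (fun x => c * sink k x + T x).

Lemma trig_ext T T' : T =1 T' -> trig T -> trig T'.
Proof. by move=> /funext ->. Qed.

Lemma trigD T T' : trig T -> trig T' -> trig (fun x => T x + T' x).
Proof.
move=> hT hT'; elim: hT => [|c k U _ ih|c k U _ ih].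
- by apply: trig_ext hT' => x; rewrite add0r.
- by apply: trig_ext (trig_cos c k ih) => x; rewrite addrA.
- by apply: trig_ext (trig_sin c k ih) => x; rewrite addrA.
Qed.

Lemma trigZ c T : trig T -> trig (fun x => c * T x).
Proof.
elim => [|b k U _ ih|b k U _ ih].
- by apply: trig_ext trig0 => x; rewrite mulr0.
- by apply: trig_ext (trig_cos (c * b) k ih) => x; rewrite mulrDr mulrA.
- by apply: trig_ext (trig_sin (c * b) k ih) => x; rewrite mulrDr mulrA.
Qed.

Lemma trig_cosk k : trig (cosk k).
Proof. by apply: trig_ext (trig_cos 1 k trig0) => x; rewrite mul1r addr0. Qed.
Lemma trig_sink k : trig (sink k).
Proof. by apply: trig_ext (trig_sin 1 k trig0) => x; rewrite mul1r addr0. Qed.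
Lemma trig_cst c : trig (fun=> c).
Proof. by apply: trig_ext (trig_cos c 0 trig0) => x; rewrite cosk0 mulr1 addr0. Qed.

Lemma trigM_cos j T : trig T -> trig (fun x => cosk j x * T x).
Proof.
elim => [|b k U _ ih|b k U _ ih].
- by apply: trig_ext trig0 => x; rewrite mulr0.
- apply: trig_ext (trig_cos (b / 2) (j - k) (trig_cos (b / 2) (j + k) ih)) => x.
  by rewrite !coskD coskN sinkN; field.
- apply: trig_ext (trig_sin (- b / 2) (j - k) (trig_sin (b / 2) (j + k) ih)) => x.
  by rewrite !sinkD coskN sinkN; field.
Qed.

Lemma trigM_sin j T : trig T -> trig (fun x => sink j x * T x).
Proof.
elim => [|b k U _ ih|b k U _ ih].
- by apply: trig_ext trig0 => x; rewrite mulr0.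
- apply: trig_ext (trig_sin (b / 2) (j - k) (trig_sin (b / 2) (j + k) ih)) => x.
  by rewrite !sinkD coskN sinkN; field.
- apply: trig_ext (trig_cos (b / 2) (j - k) (trig_cos (- b / 2) (j + k) ih)) => x.
  by rewrite !coskD coskN sinkN; field.
Qed.

Lemma trigM T U : trig T -> trig U -> trig (fun x => T x * U x).
Proof.
move=> hT hU; elim: hT => [|c k T' _ ih|c k T' _ ih].
- by apply: trig_ext trig0 => x; rewrite mul0r.
- apply: trig_ext (trigD (trigZ c (trigM_cos k hU)) ih) => x; ring.
- apply: trig_ext (trigD (trigZ c (trigM_sin k hU)) ih) => x; ring.
Qed.

Lemma sqint_trig T : trig T -> sqint T.
Proof.
elim => [|c k U _ ih|c k U _ ih].
- exact: sqint_cst.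
- by apply: sqintD => //; apply: sqintZ; exact: sqint_cosk.
- by apply: sqintD => //; apply: sqintZ; exact: sqint_sink.
Qed.

Lemma trig_sum (I : Type) (s : seq I) (F : I -> R -> R) :
  (forall i, trig (F i)) -> trig (fun x => \sum_(i <- s) F i x).
Proof.
move=> h; elim: s => [|i s ih].
  by apply: trig_ext trig0 => x; rewrite big_nil.
by apply: trig_ext (trigD (h i) ih) => x; rewrite big_cons.
Qed.

End Trig.

(** * Density of trigonometric polynomials *)

Section Density.
Variable R : realType.
Notation mu := (@lebesgue_measure R).
Implicit Types (f g h T : R -> R) (c : R) (k j : int).

Lemma ae_finite (X : seq R) (P : R -> Prop) : (forall x, x \notin X -> P x) ->
  {ae mu, forall x, P x}.
Proof.
have cX : countable [set` X] by apply: finite_set_countable; exact: finite_seq.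
move=> h; exists [set` X]; split.
- by apply: (@countable_measurable _ (measurableTypeR R)) cX => t; exact: measurable_set1.
- exact: countable_lebesgue_measure0.
- move=> x /=; case: (boolP (x \in X)) => // xX nP.
  by exfalso; apply: nP; exact: h.
Qed.

Definition L2_trig_closure g := forall e : R, 0 < e ->
  exists T, trig T /\ int01 (fun x => (g x - T x) ^+ 2) <= e.

Local Notation close := L2_trig_closure.

Lemma close_trig T : trig T -> close T.
Proof.
move=> hT e e0; exists T; split=> //.
by under eq_fun do rewrite subrr expr0n; rewrite int01_cst ltW.
Qed.

Lemma closeD f g : sqint f -> sqint g -> close f -> close g -> close (fun x => f x + g x).
Proof.
move=> sf sg cf cg e e0; have e4 : 0 < e / 4 by rewrite divr_gt0.
have [T [hT h1]] := cf _ e4; have [U [hU h2]] := cg _ e4.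
exists (fun x => T x + U x); split; first exact: trigD.
have -> : (fun x => (f x + g x - (T x + U x)) ^+ 2) = (fun x => ((f x - T x) + (g x - U x)) ^+ 2).
  by apply/funext => x; congr (_ ^+ 2); ring.
apply: (le_trans (int01_sqD_le _ _)); last by move: h1 h2; lra.
  by apply: sqintB => //; exact: sqint_trig.
by apply: sqintB => //; exact: sqint_trig.
Qed.

Lemma closeZ c f : sqint f -> close f -> close (fun x => c * f x).
Proof.
move=> sf cf e e0; have e4 : 0 < e / (c ^+ 2 + 1).
  by rewrite divr_gt0// ltr_pwDr// sqr_ge0.
have [T [hT h1]] := cf _ e4.
exists (fun x => c * T x); split; first exact: trigZ.
have -> : (fun x => (c * f x - c * T x) ^+ 2) = (fun x => c ^+ 2 * (f x - T x) ^+ 2).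
  by apply/funext => x; ring.
have [_ i2] := sqintB sf (sqint_trig hT).
rewrite int01Z//; move: h1; rewrite ler_pdivlMr ?ltr_pwDr ?sqr_ge0//.
have : 0 <= int01 (fun x => (f x - T x) ^+ 2) by apply: int01_ge0 => x; exact: sqr_ge0.
by have := sqr_ge0 c; nra.
Qed.

(** Dominated convergence makes the closure stable under dominated almost everywhere limits; every
    later extension, from arcs to Borel sets to arbitrary functions, goes through this. *)
Lemma close_lim (g_ : nat -> R -> R) g (G : R -> R) :
  (forall n, measurable_fun [set: R] (g_ n)) -> measurable_fun [set: R] g ->
  sqint G -> (forall n x, `|g_ n x| <= G x) -> (forall x, `|g x| <= G x) ->
  {ae mu, forall x, 0 <= x <= 1 -> g_ ^~ x @ \oo --> g x} ->
  (forall n, close (g_ n)) -> close g.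
Proof.
move=> mg_ mg sG bg_ bg cv cg e e0.
have hd n x : `|g x - g_ n x| <= 2 * G x.
  by rewrite (le_trans (ler_normB _ _))//; have := bg x; have := bg_ n x; lra.
have m1 n : measurable_fun [set: R] (fun x => (g x - g_ n x) ^+ 2).
  by apply: measurable_funX; exact: measurable_funB.
have i1 : itg (fun x => 4 * G x ^+ 2) by apply: itgZ; case: sG.
have b1 n x : `|(g x - g_ n x) ^+ 2| <= 4 * G x ^+ 2.
  rewrite ger0_norm ?sqr_ge0// -real_normK ?num_real//.
  have -> : 4 * G x ^+ 2 = (2 * G x) ^+ 2 by ring.
  by rewrite ler_sqr ?nnegrE// (le_trans _ (hd n x)).
have c1 : {ae mu, forall x, 0 <= x <= 1 -> (fun n => (g x - g_ n x) ^+ 2) @ \oo --> (0 : R)}.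
  apply: (@filterS _ _ (ae_filter_ringOfSetsType mu) _ _ _ cv) => x {}cv x01.
  have : (fun n => (g x - g_ n x) ^+ 2) @ \oo --> (g x - g x) ^+ 2.
    apply: (@cvg_comp _ _ _ (fun n => g x - g_ n x) (fun y => y ^+ 2)).
      by apply: cvgB; [exact: cvg_cst|exact: cv].
    exact: exprn_continuous.
  by rewrite subrr expr0n.
have /cvgrPdist_le /(_ (e / 4)) [] := int01_dominated m1 (measurable_cst (0:R)) i1 b1 c1.
  by rewrite divr_gt0.
move=> n _ /(_ n (leqnn n)) /=; rewrite sub0r normrN => hn.
have e4 : 0 < e / 4 by rewrite divr_gt0.
have [T [hT h1]] := cg n _ e4; exists T; split=> //.
have sgn : sqint (g_ n).
  by split => //; apply: (itg_le _ (proj2 sG)); [exact: measurable_funX|move=> x;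
   rewrite ger0_norm ?sqr_ge0// -real_normK ?num_real// ler_sqr ?nnegrE// (le_trans _ (bg_ n x))].
have sg : sqint g.
  by split => //; apply: (itg_le _ (proj2 sG)); [exact: measurable_funX|move=> x;
   rewrite ger0_norm ?sqr_ge0// -real_normK ?num_real// ler_sqr ?nnegrE// (le_trans _ (bg x))].
have -> : (fun x => (g x - T x) ^+ 2) = (fun x => ((g x - g_ n x) + (g_ n x - T x)) ^+ 2).
  by apply/funext => x; rewrite addrA subrK.
apply: (le_trans (int01_sqD_le (sqintB sg sgn) (sqintB sgn (sqint_trig hT)))).
have : int01 (fun x => (g x - g_ n x) ^+ 2) <= e / 4.
  have -> : (fun x => (g x - g_ n x) ^+ 2) = (fun x => `|(g x - g_ n x) ^+ 2 - 0|).
    by apply/funext => x; rewrite subr0 ger0_norm// sqr_ge0.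
  exact: le_trans (ler_norm _) hn.
by move: h1; lra.
Qed.

(* The iterates of this odd cubic map converge boundedly to the sign function
   on [-1, 1], so they turn a trigonometric polynomial into an approximation of
   the indicator of the arc where it is positive. *)
Definition sgn_step (y : R) : R := (3 * y - y ^+ 3) / 2.

Lemma sgn_step_range y : `|y| <= 1 -> `|sgn_step y| <= 1.
Proof.
rewrite /sgn_step !ler_norml => /andP[h1 h2].
(* This product is twice 1 - [sgn_step y], and the next one twice 1 + [sgn_step y]. *)
have : 0 <= (1 - y) ^+ 2 * (y + 2) by rewrite mulr_ge0 ?sqr_ge0//; lra.
have : 0 <= (1 + y) ^+ 2 * (2 - y) by rewrite mulr_ge0 ?sqr_ge0//; lra.
by move=> a b; apply/andP; split; nra.
Qed.

Lemma iter_sgn_step_range n y : `|y| <= 1 -> `|iter n sgn_step y| <= 1.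
Proof. by move=> h; elim: n => //= n ih; exact: sgn_step_range. Qed.

Lemma sgn_stepN y : sgn_step (- y) = - sgn_step y.
Proof. by rewrite /sgn_step; field. Qed.

Lemma iter_sgn_stepN n y : iter n sgn_step (- y) = - iter n sgn_step y.
Proof. by elim: n => //= n ->; rewrite sgn_stepN. Qed.

Lemma cvg_iter_sgn_step y : 0 < y <= 1 -> iter n sgn_step y @[n --> \oo] --> (1 : R).
Proof.
move=> /andP[y0 y1].
have h n : y <= iter n sgn_step y <= 1 /\ 1 - iter n sgn_step y <= (1 - y / 2) ^+ n.
  elim: n => [|n [/andP[h1 h2] h3]]; first by rewrite expr0 /= lexx y1; split => //; lra.
  rewrite iterS exprS; set z := iter n sgn_step y in h1 h2 h3 *.
  have z0 : 0 < z by exact: lt_le_trans h1.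
  have hz : z <= sgn_step z <= 1.
    have : 0 <= z * (1 - z) * (1 + z) by apply: mulr_ge0; [apply: mulr_ge0|]; lra.
    have : 0 <= (1 - z) ^+ 2 * (z + 2) by apply: mulr_ge0; [exact: sqr_ge0|lra].
    by rewrite /sgn_step => a b; apply/andP; split; nra.
  split; first by case/andP: hz => a b; rewrite b (le_trans h1 a).
  apply: (@le_trans _ _ ((1 - y / 2) * (1 - z))); last first.
    by rewrite ler_wpM2l//; lra.
  (* The distance to 1 is multiplied by (1 - z)(z + 2) / 2 = 1 - (z + z^2) / 2, which is at most 1 -
     y / 2 because the iterates never fall below y. *)
  have -> : 1 - sgn_step z = (1 - z) * ((1 - z) * (z + 2) / 2) by rewrite /sgn_step; field.
  rewrite mulrC ler_wpM2r ?subr_ge0//; nra.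
apply/cvgrPdist_le => e e0.
have c0 : (1 - y / 2) ^+ n @[n --> \oo] --> (0 : R).
  by apply: cvg_expr; rewrite ger0_norm; lra.
move/cvgrPdist_le : c0 => /(_ e e0); apply: filterS => n.
have [/andP[a b] c] := h n.
rewrite sub0r normrN ger0_norm ?exprn_ge0//; last by lra.
by rewrite ger0_norm ?subr_ge0//; exact: le_trans.
Qed.

Lemma cosk1_lt (d w : R) : 0 <= w -> w <= 1 / 2 -> w < d -> d < 1 - w -> cosk 1 d < cosk 1 w.
Proof.
have pi0 : 0 < pi :> R := pi_gt0 R.
have f1 : freq 1 = 2 * pi :> R by rewrite /freq mulr1.
have main (d' : R) : w <= 1 / 2 -> 0 <= w -> w < d' -> d' <= 1 / 2 -> cosk 1 d' < cosk 1 w.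
  by move=> w2 w0 wd d2; rewrite /cosk f1 ltr_cos ?in_itv/=; nra.
move=> w0 w2 wd dw; have [d2|d2] := leP d (1 / 2); first exact: main.
have -> : cosk 1 d = cosk 1 (1 - d).
  have [c1 s1] := cos_sin_freq R 1.
  by rewrite /cosk mulrBr mulr1 cosB c1 s1 mul1r mul0r addr0.
by apply: main => //; lra.
Qed.

Lemma trig_iter_sgn_step T n : trig T -> trig (fun x => iter n sgn_step (T x)).
Proof.
move=> hT; elim: n => [//|n ih].
apply: trig_ext (trigD (trigZ (3 / 2) ih) (trigZ (- 1 / 2) (trigM ih (trigM ih ih)))) => x.
by rewrite /= /sgn_step; field.
Qed.

(** The polynomial [hh] compares the angular distance from x to the midpoint m with the half-width
    w: it is positive inside the arc and negative outside. Its iterates under [sgn_step] tend to the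
    sign, and (sign + 1) / 2 is the indicator. *)
Lemma close_arc a b : 0 <= a -> a < b -> b <= 1 -> close (\1_(`]a, b]%classic : set R)).
Proof.
move=> a0 ab b1; pose m := (a + b) / 2; pose w := (b - a) / 2.
pose hh x := (cosk 1 (x - m) - cosk 1 w) / 2.
have th : trig hh.
  apply: (trig_ext _ (trigD (trigD (trigZ (cosk 1 m / 2) (trig_cosk R 1)) (trigZ (sink 1 m / 2) (trig_sink R 1))) (trig_cst (- cosk 1 w / 2)))) => x.
  by rewrite /hh /cosk /sink mulrBr cosB; field.
have h1 x : `|hh x| <= 1.
  have := cosk_max 1 (x - m); have := cosk_max 1 w.
  by rewrite /hh !ler_norml => /andP[? ?] /andP[? ?]; apply/andP; split; lra.
have tn n : trig (fun x => 2^-1 * (iter n sgn_step (hh x) + 1)).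
  by apply: trigZ; apply: trigD; [exact: trig_iter_sgn_step|exact: trig_cst].
apply: (@close_lim (fun n x => 2^-1 * (iter n sgn_step (hh x) + 1)) _ (fun=> 1)).
- by move=> n; have [] := sqint_trig (tn n).
- exact: measurable_indic.
- exact: sqint_cst.
- move=> n x; have := iter_sgn_step_range n (h1 x).
  by rewrite !ler_norml => /andP[? ?]; apply/andP; split; lra.
- by move=> x; rewrite indicE; case: (_ \in _); rewrite /= ?normr0 ?normr1.
(* [hh] vanishes at a and b, where the iterates stay at 0. Discarding 0 and 1 keeps x away from the
   points identified with an endpoint modulo 1. *)
- apply: (@ae_finite [:: 0; 1; a; b]) => x.
  rewrite !inE !negb_or => /and4P[x0 x1 xa xb] /andP[x0' x1'].
  have {}x0 : 0 < x by rewrite lt_neqAle eq_sym x0.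
  have {}x1 : x < 1 by rewrite lt_neqAle x1.
  have hm : cosk 1 (x - m) = cosk 1 `|x - m|.
    by rewrite /cosk -cos_norm normrM (_ : `|freq 1| = freq 1)// ger0_norm// /freq !mulr_ge0// pi_ge0.
  have hw : cosk 1 w = cosk 1 `|w|.
    by rewrite ger0_norm// /w; lra.
  have [xin|xout] := boolP (a < x < b).
    have -> : \1_(`]a, b]%classic : set R) x = 2^-1 * (1 + 1) :> R.
      rewrite indicE mem_set/=; last by rewrite in_itv/=; case/andP: xin => -> /ltW ->.
      by field.
    apply: cvgMr; apply: cvgD; last exact: cvg_cst.
    apply: cvg_iter_sgn_step; rewrite (le_trans (ler_norm _) (h1 x)) andbT.
    have hin : `|x - (a + b) / 2| < (b - a) / 2.
      by case/andP: xin => ? ?; rewrite ltr_norml; apply/andP; split; lra.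
    by rewrite /hh divr_gt0// subr_gt0 hm; apply: cosk1_lt; rewrite /w /m //; lra.
  have -> : \1_(`]a, b]%classic : set R) x = 2^-1 * (- 1 + 1) :> R.
    rewrite indicE memNset ?addNr ?mulr0//= in_itv/= => /andP[ax bx].
    by move: xout; rewrite ax lt_neqAle xb bx.
  apply: cvgMr; apply: cvgD; last exact: cvg_cst.
  have -> : (fun n => iter n sgn_step (hh x)) = (fun n => - iter n sgn_step (- hh x)).
    by apply/funext => n; rewrite iter_sgn_stepN opprK.
  apply: cvgN; apply: cvg_iter_sgn_step.
  have := h1 x; rewrite -normrN => h1'; rewrite (le_trans (ler_norm _) h1') andbT.
  rewrite oppr_gt0 /hh pmulr_llt0 ?invr_gt0// subr_lt0 hm; apply: cosk1_lt; rewrite /w; try lra.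
    have : (x < a) || (b < x).
      by move: xout; rewrite negb_and -!leNgt le_eqVlt (negbTE xa) /= le_eqVlt eq_sym (negbTE xb).
    by rewrite ltr_normr /m => /orP[?|?]; apply/orP; [right|left]; lra.
  by rewrite ltr_norml /m; apply/andP; split; lra.
- by move=> n; exact: close_trig.
Qed.

End Density.

(** * From arcs to all square integrable functions *)

Section Completeness.
Variable R : realType.
Notation mu := (@lebesgue_measure R).
Implicit Types (f g h T : R -> R) (c : R) (k j : int).
Local Notation close := L2_trig_closure.

Lemma close_ae f g c : measurable_fun [set: R] f -> measurable_fun [set: R] g ->
  (forall x, `|f x| <= c) -> (forall x, `|g x| <= c) ->
  {ae mu, forall x, 0 <= x <= 1 -> f x = g x} -> close f -> close g.
Proof.
move=> mf mg fc gc fg cf.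
apply: (@close_lim _ (fun=> f) g (fun=> c)) => //; first exact: sqint_cst.
apply: (@filterS _ _ (ae_filter_ringOfSetsType mu) _ _ _ fg) => x {}fg x01.
by rewrite -(fg x01); exact: cvg_cst.
Qed.

Lemma indic_le1 (A : set R) x : `|\1_A x : R| <= 1.
Proof. by rewrite indicE; case: (_ \in _); rewrite /= ?normr0 ?normr1. Qed.

Lemma close_ocitv (A : set R) : ocitv A -> close (\1_A).
Proof.
move=> /[dup] oA /ocitvP[->|[[a b] /= ab ->]].
  by rewrite indic0; exact/close_trig/trig0.
pose a' := Num.max a 0; pose b' := Num.min b 1.
have [ab'|ba'] := ltP a' b'; last first.
  apply: (@close_ae (fun=> 0) _ 1); rewrite ?normr0//.
  - exact: indic_le1.
  - apply: (@ae_finite _ [:: 0]) => x; rewrite inE => x0 /andP[x0' x1].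
    rewrite indicE memNset//= in_itv/= => /andP[ax xb].
    have a'x : a' < x by rewrite gt_max ax lt_neqAle eq_sym x0.
    have xb' : x <= b' by rewrite le_min xb.
    by have := lt_le_trans a'x xb'; rewrite ltNge ba'.
  - exact/close_trig/trig0.
apply: (@close_ae (\1_(`]a', b']%classic : set R)) _ 1).
- exact: measurable_indic.
- exact: measurable_indic.
- exact: indic_le1.
- exact: indic_le1.
- apply: (@ae_finite _ [:: 0]) => x; rewrite inE => x0 /andP[x0' x1].
  rewrite !indicE; congr (_%:R); congr (nat_of_bool _); apply/idP/idP; rewrite !inE/= !in_itv/= /a' /b' gt_max le_min.
    by move=> /andP[/andP[-> _] /andP[-> _]].
  by move=> /andP[-> ->]; rewrite x1 lt_neqAle x0' eq_sym x0.
- apply: close_arc => //.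
    by rewrite /a' le_max lexx orbT.
  by rewrite /b' ge_min lexx orbT.
Qed.

(** A pi-lambda argument: half-open intervals are stable under intersection and generate the Borel
    sets, while the sets with indicator in the closure form a lambda-system. *)
Lemma close_indic (A0 : set (measurableTypeR R)) : measurable A0 -> close (\1_A0 : R -> R).
Proof.
pose H := [set A : set (measurableTypeR R) | measurable A /\ close (\1_A : R -> R)].
suff h : <<s [set: R], @ocitv R >> `<=` H by move=> /h[].
apply: lambda_system_subset => //; first exact: ocitvI.
  split.
  - by [].
  - split; first exact: measurableT.
    by rewrite indicT; exact/close_trig/trig_cst.
  - move=> A B BA [mA cA] [mB cB]; split; first exact: measurableD.
    have -> : \1_(A `\` B) = (fun x => \1_A x + (- 1) * \1_B x) :> (R -> R).
      apply/funext => x; rewrite !indicE in_setD.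
      have [xB|xB] := boolP (x \in B).
        have -> : x \in A by move: xB; rewrite !inE; exact: BA.
        by rewrite /= mulr1 addrN.
      by rewrite /= mulr0 addr0 andbT.
    have s1 (C : set (measurableTypeR R)) : measurable C -> sqint (\1_C : R -> R).
      by move=> mC; apply: sqint_bounded (@indic_le1 C); exact: measurable_indic.
    by apply: closeD; [exact: s1|apply/sqintZ/s1|exact: cA|apply: closeZ => //; exact: s1].
  - move=> F ndF HF; have mF n : measurable (F n) by have [] := HF n.
    split; first exact: bigcupT_measurable.
    apply: (@close_lim _ (fun n => \1_(F n)) _ (fun=> 1)).
    + by move=> n; exact: measurable_indic.
    + by apply: measurable_indic; exact: bigcupT_measurable.
    + exact: sqint_cst.
    + by move=> n x; exact: indic_le1.
    + exact: indic_le1.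
    + apply: aeW => x _.
      have [[n _ Fnx]|nF] := pselect ((\bigcup_n F n) x).
        apply: (@cvg_near_cst _ _ _ _ _ eventually_filter); exists n => // m /= nm.
        rewrite !indicE !mem_set//; first by exists n.
        by have /subsetPset := ndF _ _ nm; apply.
      apply: (@cvg_near_cst _ _ _ _ _ eventually_filter); apply: nearW => m.
      rewrite !indicE !memNset//= => Fx; apply: nF; by exists m.
    + by move=> n; have [] := HF n.
by move=> A oA; split; [exact: sub_sigma_algebra|exact: close_ocitv].
Qed.

Lemma close_sum (I : Type) (s : seq I) (F : I -> R -> R) :
  (forall i, sqint (F i)) -> (forall i, close (F i)) ->
  close (fun x => \sum_(i <- s) F i x).
Proof.
move=> sF cF; elim: s => [|i s ih].
  by under eq_fun do rewrite big_nil; exact/close_trig/trig0.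
under eq_fun do rewrite big_cons.
by apply: closeD => //; exact: sqint_sum.
Qed.

Import HBNNSimple HBSimple.

Lemma close_nnsfun (p : {nnsfun (measurableTypeR R) >-> R}) : close (p : R -> R).
Proof.
have -> : (p : R -> R) = fun x => \sum_(y <- finmap.enum_fset (fset_set (range p))) y * \1_(p @^-1` [set y]) x.
  by apply/funext => x; rewrite fimfunE fsbig_finite.
have mp y : measurable (p @^-1` [set y]) by exact: measurable_sfunP.
have s1 (C : set (measurableTypeR R)) : measurable C -> sqint (\1_C : R -> R).
  by move=> mC; apply: sqint_bounded (@indic_le1 C); exact: measurable_indic.
apply: close_sum => y; first exact/sqintZ/s1.
by apply: closeZ; [exact: s1|exact: close_indic].
Qed.

Lemma close_nneg g : (forall x, 0 <= g x) -> sqint g -> close g.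
Proof.
move=> g0 sg; have mg : measurable_fun [set: measurableTypeR R] (EFin \o g).
  by apply/measurable_EFinP; case: sg.
have g0' (x : measurableTypeR R) : [set: measurableTypeR R] x -> (0 <= (EFin \o g) x)%E by rewrite lee_fin.
pose p := nnsfun_approx measurableT mg.
apply: (@close_lim _ (fun n => p n : R -> R) g g).
- by move=> n; exact: (@measurable_funP _ _ (measurableTypeR R) _ setT (p n)).
- by case: sg.
- exact: sg.
- move=> n x; rewrite ger0_norm ?fun_ge0// /p nnsfun_approxE -lee_fin.
  exact: (le_approx n g0').
- by move=> x; rewrite ger0_norm.
- apply: aeW => x _.
  by have /fine_cvgP[_] := cvg_nnsfun_approx measurableT mg g0' (I : [set: measurableTypeR R] x).
- by move=> n; exact: close_nnsfun.
Qed.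

Lemma close_sqint g : sqint g -> close g.
Proof.
move=> sg; have [mg ig] := sg.
have -> : g = fun x => (`|g x| + g x) / 2 + (-1) * ((`|g x| - g x) / 2).
  by apply/funext => x; field.
have sn : sqint (fun x => `|g x|).
  split; first exact: measurableT_comp.
  by under eq_fun do rewrite real_normK ?num_real//.
have s1 : sqint (fun x => (`|g x| + g x) / 2).
  by under eq_fun do rewrite mulrC; apply/sqintZ/sqintD.
have s2 : sqint (fun x => (`|g x| - g x) / 2).
  by under eq_fun do rewrite mulrC; apply/sqintZ/sqintB.
have h1 x : 0 <= `|g x| + g x by have := ler_norm (- g x); rewrite normrN; lra.
have h2 x : 0 <= `|g x| - g x by have := ler_norm (g x); lra.
apply: closeD => //; first exact: sqintZ.
  by apply: close_nneg => // x; rewrite divr_ge0.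
by apply: closeZ => //; apply: close_nneg => // x; rewrite divr_ge0.
Qed.

End Completeness.

(** * Parseval identity and convolution of Fourier coefficients *)

Section Parseval.
Variable R : realType.
Notation mu := (@lebesgue_measure R).
Implicit Types (f g h T : R -> R) (c : R) (k j : int) (n : nat).

Definition ccoef g k : R := int01 (fun x => g x * cosk k x).
Definition scoef g k : R := int01 (fun x => g x * sink k x).

Lemma ccoefN g k : ccoef g (- k) = ccoef g k.
Proof. by rewrite /ccoef; under [in LHS]eq_fun do rewrite coskN. Qed.

Lemma sqint_itg_cos g k : sqint g -> itg (fun x => g x * cosk k x).
Proof. by move=> sg; apply: sqint_mul => //; exact: sqint_cosk. Qed.

Lemma sqint_itg_sin g k : sqint g -> itg (fun x => g x * sink k x).
Proof. by move=> sg; apply: sqint_mul => //; exact: sqint_sink. Qed.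

Lemma scoefN g k : sqint g -> scoef g (- k) = - scoef g k.
Proof.
move=> sg; rewrite /scoef -[RHS]mulN1r -int01Z; last exact: sqint_itg_sin.
by congr int01; apply/funext => x; rewrite sinkN; ring.
Qed.

Lemma Re_fourier g k : Re (fourier g k) = ccoef g k.
Proof.
rewrite /fourier /cintegral /cexp /=; congr Rintegral; apply/funext => x.
by rewrite expR0 !mul1r mulr0 subr0 cosN mulrC.
Qed.

Lemma Im_fourier g k : sqint g -> Im (fourier g k) = - scoef g k.
Proof.
move=> sg; rewrite /scoef -[RHS]mulN1r -int01Z; last exact: sqint_itg_sin.
rewrite /fourier /cintegral /cexp /=; congr Rintegral; apply/funext => x.
by rewrite expR0 !mul1r mulr0 add0r sinN; rewrite /sink; ring.
Qed.

Lemma sqr_normc_fourier g k : sqint g ->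
  normc (fourier g k) ^+ 2 = ccoef g k ^+ 2 + scoef g k ^+ 2.
Proof. by move=> sg; rewrite sqr_normcE Re_fourier Im_fourier// sqrrN. Qed.

Lemma fourierD f g k : sqint f -> sqint g ->
  fourier (fun x => f x + g x) k = fourier f k + fourier g k.
Proof.
move=> sf sg; have s := sqintD sf sg.
apply: complex_eqP; rewrite ?ReD ?ImD ?Re_fourier ?Im_fourier//.
  rewrite /ccoef -int01D; [|exact: sqint_itg_cos..].
  by congr int01; apply/funext => x; rewrite mulrDl.
rewrite -opprD /scoef -int01D; [|exact: sqint_itg_sin..].
by congr (- int01 _); apply/funext => x; rewrite mulrDl.
Qed.

Lemma fourierZ c f k : sqint f -> fourier (fun x => c * f x) k = c%:C * fourier f k.
Proof.
move=> sf; have s := sqintZ c sf.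
apply: complex_eqP; rewrite ?ReM ?ImM ?Re_fourier ?Im_fourier//= mul0r ?subr0 ?addr0.
  rewrite /ccoef -int01Z; last exact: sqint_itg_cos.
  by congr int01; apply/funext => x; rewrite mulrA.
rewrite mulrN /scoef -int01Z; last exact: sqint_itg_sin.
by congr (- int01 _); apply/funext => x; rewrite mulrA.
Qed.

Lemma fourierB f g k : sqint f -> sqint g ->
  fourier (fun x => f x - g x) k = fourier f k - fourier g k.
Proof.
move=> sf sg; have -> : (fun x => f x - g x) = (fun x => f x + (-1) * g x).
  by apply/funext => x; rewrite mulN1r.
rewrite fourierD//; last exact: sqintZ.
rewrite fourierZ// rmorphN1 mulN1r//.
Qed.

Lemma sum_box_sym n (F : int -> R) : \sum_(k <- box n) F (- k) = \sum_(k <- box n) F k.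
Proof.
rewrite -(big_map (fun k => - k) predT F); apply: perm_big; apply: uniq_perm.
- by rewrite map_inj_uniq ?box_uniq//; exact: oppr_inj.
- exact: box_uniq.
- move=> k; rewrite -{1}[k]opprK mem_map; last exact: oppr_inj.
  by rewrite !mem_box abszN.
Qed.

Lemma sum_box_odd n (F : int -> R) : (forall k, F (- k) = - F k) ->
  \sum_(k <- box n) F k = 0.
Proof.
move=> odd; have := sum_box_sym n F; under eq_bigr do rewrite odd.
by rewrite sumrN; lra.
Qed.

Lemma sum_box_delta n (F : int -> R) j : (`|j| <= n)%N ->
  \sum_(k <- box n) F k * (k == j)%:R = F j.
Proof.
move=> jn; rewrite (bigD1_seq j) ?box_uniq ?mem_box//= eqxx mulr1 big1 ?addr0//.
by move=> i /negbTE ->; rewrite mulr0.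
Qed.

(** The partial Fourier sum in real form. Each frequency occurs for k and for -k, which replaces the
    usual factor 2. *)
Definition psum g n : R -> R :=
  fun x => \sum_(k <- box n) (ccoef g k * cosk k x + scoef g k * sink k x).

Lemma trig_psum g n : trig (psum g n).
Proof.
apply: trig_sum => k; apply: trigD; apply: trigZ.
  exact: trig_cosk.
exact: trig_sink.
Qed.

Lemma sqint_psum g n : sqint (psum g n).
Proof. exact/sqint_trig/trig_psum. Qed.

Lemma int01_psum f g n : sqint f ->
  int01 (fun x => psum g n x * f x) =
  \sum_(k <- box n) (ccoef g k * ccoef f k + scoef g k * scoef f k).
Proof.
move=> sf; have -> : (fun x => psum g n x * f x) =
    (fun x => \sum_(k <- box n) (ccoef g k * (f x * cosk k x) + scoef g k * (f x * sink k x))).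
  by apply/funext => x; rewrite /psum mulr_suml; apply: eq_bigr => k _; ring.
have ic k : itg (fun x => ccoef g k * (f x * cosk k x)) by apply/itgZ/sqint_itg_cos.
have iss k : itg (fun x => scoef g k * (f x * sink k x)) by apply/itgZ/sqint_itg_sin.
rewrite int01_sum; last by move=> k; exact: itgD.
apply: eq_bigr => k _; rewrite int01D//.
by rewrite !int01Z//; [exact: sqint_itg_sin|exact: sqint_itg_cos].
Qed.

Lemma ccoef_cosk k j : ccoef (cosk j) k = ((k == j)%:R + (k == - j)%:R) / 2.
Proof.
rewrite /ccoef int01_coscos eq_sym; congr ((_ + _%:R) / _).
by congr nat_of_bool; apply/eqP/eqP => ->; rewrite opprK.
Qed.
Lemma scoef_cosk k j : scoef (cosk j) k = 0.
Proof.
by rewrite /scoef; under eq_fun do rewrite mulrC; rewrite int01_sincos.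
Qed.
Lemma ccoef_sink k j : ccoef (sink j) k = 0.
Proof. exact: int01_sincos. Qed.
Lemma scoef_sink k j : scoef (sink j) k = ((k == j)%:R - (k == - j)%:R) / 2.
Proof.
rewrite /scoef int01_sinsin eq_sym; congr ((_ - _%:R) / _).
by congr nat_of_bool; apply/eqP/eqP => ->; rewrite opprK.
Qed.

Lemma ccoef_psum g n j : (`|j| <= n)%N -> int01 (fun x => psum g n x * cosk j x) = ccoef g j.
Proof.
move=> jn; rewrite int01_psum; last exact: sqint_cosk.
under eq_bigr do rewrite ccoef_cosk scoef_cosk mulr0 addr0 mulrA mulrDr mulrDl ![_ * _ / 2]mulrAC.
by rewrite big_split/= !sum_box_delta ?abszN// ccoefN; field.
Qed.

Lemma scoef_psum g n j : sqint g -> (`|j| <= n)%N ->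
  int01 (fun x => psum g n x * sink j x) = scoef g j.
Proof.
move=> sg jn; rewrite int01_psum; last exact: sqint_sink.
under eq_bigr do rewrite ccoef_sink scoef_sink mulr0 add0r mulrA mulrBr mulrBl ![_ * _ / 2]mulrAC.
by rewrite sumrB/= !sum_box_delta ?abszN// scoefN//; field.
Qed.

(** N is the largest frequency occurring in T; from there on [psum g n] has the same coefficients as
    g on all frequencies of T. *)
Lemma resid_orth g T : sqint g -> trig T ->
  exists N, forall n, (N <= n)%N -> int01 (fun x => (g x - psum g n x) * T x) = 0.
Proof.
move=> sg; elim => [|c k U hU [N ih]|c k U hU [N ih]].
- exists 0%N => m _; under eq_fun do rewrite mulr0; exact: int01_cst.
- exists (maxn N `|k|%N) => m; rewrite geq_max => /andP[Nm km].
  have sr := sqintB sg (sqint_psum g m).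
  have -> : (fun x => (g x - psum g m x) * (c * cosk k x + U x)) =
    (fun x => c * ((g x * cosk k x) - (psum g m x * cosk k x)) + (g x - psum g m x) * U x).
    by apply/funext => x; ring.
  have i1 := sqint_itg_cos k sg; have i2 := sqint_itg_cos k (sqint_psum g m).
  have i3 := itgB i1 i2; have i4 := sqint_mul sr (sqint_trig hU).
  by rewrite int01D ?int01Z ?int01B ?ccoef_psum ?ih ?subrr ?mulr0 ?addr0//; exact: itgZ.
- exists (maxn N `|k|%N) => m; rewrite geq_max => /andP[Nm km].
  have sr := sqintB sg (sqint_psum g m).
  have -> : (fun x => (g x - psum g m x) * (c * sink k x + U x)) =
    (fun x => c * ((g x * sink k x) - (psum g m x * sink k x)) + (g x - psum g m x) * U x).
    by apply/funext => x; ring.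
  have i1 := sqint_itg_sin k sg; have i2 := sqint_itg_sin k (sqint_psum g m).
  have i3 := itgB i1 i2; have i4 := sqint_mul sr (sqint_trig hU).
  by rewrite int01D ?int01Z ?int01B ?scoef_psum ?ih ?subrr ?mulr0 ?addr0//; exact: itgZ.
Qed.

Lemma int01_psum_psum g n : sqint g ->
  int01 (fun x => psum g n x * psum g n x) = int01 (fun x => psum g n x * g x).
Proof.
move=> sg; rewrite !int01_psum//; last exact: sqint_psum.
rewrite big_seq [RHS]big_seq; apply: eq_bigr => k; rewrite mem_box => kn.
by rewrite [ccoef (psum _ _) _]ccoef_psum// [scoef (psum _ _) _]scoef_psum.
Qed.

Lemma int01_resid_sqr g n : sqint g ->
  int01 (fun x => (g x - psum g n x) ^+ 2) =
  int01 (fun x => g x ^+ 2) - \sum_(k <- box n) normc (fourier g k) ^+ 2.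
Proof.
move=> sg; have sp := sqint_psum g n.
have -> : (fun x => (g x - psum g n x) ^+ 2) =
  (fun x => (g x ^+ 2 - 2 * (psum g n x * g x)) + psum g n x * psum g n x).
  by apply/funext => x; ring.
have [_ i1] := sg; have i2 := sqint_mul sp sg; have i3 := sqint_mul sp sp.
rewrite int01D//; last by apply: itgB => //; exact: itgZ.
rewrite int01B//; last exact: itgZ.
rewrite int01Z// int01_psum_psum// int01_psum//.
rewrite -[RHS]addr0 -!addrA; congr (_ + _).
under [in RHS]eq_bigr do rewrite sqr_normc_fourier// !expr2.
by lra.
Qed.

Lemma bessel g : sqint g -> sumle (fun k => normc (fourier g k) ^+ 2) (int01 (fun x => g x ^+ 2)).
Proof.
move=> sg n; rewrite -subr_ge0 -int01_resid_sqr//.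
by apply: int01_ge0 => x; exact: sqr_ge0.
Qed.

(** Partial sums are orthogonal projections: by Pythagoras they are at least as close to g as the
    polynomial T given by density, once n reaches the degree of T. *)
Lemma psum_cvg g : sqint g -> forall e : R, 0 < e ->
  exists N, forall n, (N <= n)%N -> int01 (fun x => (g x - psum g n x) ^+ 2) <= e.
Proof.
move=> sg e e0; have [T [hT h1]] := close_sqint sg e0.
have [N hN] := resid_orth sg hT.
exists N => n Nn; apply: le_trans h1.
have sp := sqint_psum g n; have sr := sqintB sg sp; have sT := sqint_trig hT.
have sU := sqintB sp sT.
have -> : (fun x => (g x - T x) ^+ 2) =
   (fun x => ((g x - psum g n x) ^+ 2 + 2 * ((psum g n x * g x - psum g n x * psum g n x) - (g x - psum g n x) * T x)) + (psum g n x - T x) ^+ 2).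
  by apply/funext => x; ring.
have i1 := sqint_mul sp sg; have i2 := sqint_mul sp sp; have i3 := sqint_mul sr sT.
have i4 := itgB i1 i2; have i5 := itgB i4 i3.
have [_ i6] := sr; have [_ i7] := sU; have i8 := itgZ 2 i5; have i9 := itgD i6 i8.
rewrite int01D// int01D// int01Z// int01B// int01B// hN// int01_psum_psum//.
rewrite !subrr mulr0 addr0 lerDl; apply: int01_ge0 => x; exact: sqr_ge0.
Qed.

Lemma parseval_le g B : sqint g -> sumle (fun k => normc (fourier g k) ^+ 2) B ->
  int01 (fun x => g x ^+ 2) <= B.
Proof.
move=> sg hB; apply/ler_addgt0Pr => e e0.
have [N /(_ N (leqnn N))] := psum_cvg sg e0.
by rewrite int01_resid_sqr//; have := hB N; lra.
Qed.

Lemma fourier_psum_mul g h k n : sqint g -> sqint h ->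
  fourier (fun x => psum g n x * h x) k =
  \sum_(j <- box n) fourier g j * fourier h (k - j).
Proof.
move=> sg sh; have mp := sqint_psum g n.
have sph : sqint (fun x => psum g n x * h x).
  under eq_fun do rewrite mulrC.
  apply: (@sqintM_bounded _ _ _ (\sum_(k <- box n) (`|ccoef g k| + `|scoef g k|))) => //; first by case: mp.
  move=> x; rewrite (le_trans (ler_norm_sum _ _ _))//; apply: ler_sum => j _.
  by rewrite (le_trans (ler_normD _ _))// lerD// normrM ler_piMr//; [exact: cosk_max|exact: sink_max].
have shc : sqint (fun x => h x * cosk k x).
  by apply: (@sqintM_bounded _ _ _ 1) => //; [exact: measurable_cosk|exact: cosk_max].
have shs : sqint (fun x => h x * sink k x).
  by apply: (@sqintM_bounded _ _ _ 1) => //; [exact: measurable_sink|exact: sink_max].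
have hc j : ccoef h (k - j) = ccoef (fun x => h x * cosk k x) j + scoef (fun x => h x * sink k x) j.
  rewrite /ccoef /scoef -int01D; [|by apply: sqint_itg_cos|by apply: sqint_itg_sin].
  by congr int01; apply/funext => x; rewrite coskD coskN sinkN; ring.
have hs j : scoef h (k - j) = ccoef (fun x => h x * sink k x) j - scoef (fun x => h x * cosk k x) j.
  rewrite /ccoef /scoef -int01B; [|by apply: sqint_itg_cos|by apply: sqint_itg_sin].
  by congr int01; apply/funext => x; rewrite sinkD coskN sinkN; ring.
apply: complex_eqP; rewrite ?Re_sum ?Im_sum ?Re_fourier ?Im_fourier//.
  transitivity (int01 (fun x => psum g n x * (h x * cosk k x))).
    by congr int01; apply/funext => x; rewrite mulrA.
  rewrite int01_psum//.
  (* Expanded in cosine and sine coefficients, the complex convolution differs from the real formula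
     by this sum, whose terms are odd in j and cancel over the symmetric box. *)
  have z : \sum_(j <- box n) (ccoef g j * scoef (fun x => h x * sink k x) j - scoef g j * ccoef (fun x => h x * sink k x) j) = 0.
    by apply: sum_box_odd => j; rewrite !ccoefN !scoefN//; ring.
  rewrite -[LHS]addr0 -[X in _ + X = _]z -big_split; apply: eq_bigr => j _.
  by rewrite ReM !Re_fourier !Im_fourier// hc hs /=; ring.
transitivity (- int01 (fun x => psum g n x * (h x * sink k x))).
  by congr (- int01 _); apply/funext => x; rewrite mulrA.
rewrite int01_psum//.
have z : \sum_(j <- box n) (ccoef g j * scoef (fun x => h x * cosk k x) j - scoef g j * ccoef (fun x => h x * cosk k x) j) = 0.
  by apply: sum_box_odd => j; rewrite !ccoefN !scoefN//; ring.
rewrite -[LHS]addr0 -[X in _ + X = _]z -sumrN -big_split; apply: eq_bigr => j _.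
by rewrite ImM !Re_fourier !Im_fourier// hc hs /=; ring.
Qed.

(* Products of square integrable functions are only integrable. *)
Lemma normc_fourier_mul f g k c : 0 < c -> sqint f -> sqint g ->
  normc (fourier (fun x => f x * g x) k) <=
  2 * (c * int01 (fun x => f x ^+ 2) + c^-1 * int01 (fun x => g x ^+ 2)).
Proof.
move=> c0 sf sg; have ifg := sqint_mul sf sg.
have [_ if2] := sf; have [_ ig2] := sg.
have hb : int01 (fun x => `|f x * g x|) <= c * int01 (fun x => f x ^+ 2) + c^-1 * int01 (fun x => g x ^+ 2).
  rewrite -!int01Z// -int01D; [|exact: itgZ..].
  apply: int01_le; [exact: itg_norm|by apply: itgD; exact: itgZ|].
  move=> x; rewrite normrM -[f x ^+ 2]real_normK ?num_real// -[g x ^+ 2]real_normK ?num_real//.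
  set a := `|f x|; set b := `|g x|.
  have : 0 <= (c * a - b) ^+ 2 / c by rewrite divr_ge0 ?sqr_ge0 ?ltW.
  have -> : (c * a - b) ^+ 2 / c = c * a ^+ 2 + c^-1 * b ^+ 2 - 2 * (a * b).
    by field; rewrite gt_eqF.
  have ab : 0 <= a * b by rewrite mulr_ge0 ?normr_ge0.
  by move: ab; lra.
have bd (w : R -> R) : measurable_fun [set: R] w -> (forall x, `|w x| <= 1) ->
   `|int01 (fun x => f x * g x * w x)| <= int01 (fun x => `|f x * g x|).
  move=> mw w1.
  have hle x : `|f x * g x * w x| <= `|f x * g x| by rewrite normrM ler_piMr.
  have iw : itg (fun x => f x * g x * w x).
    apply: (itg_le _ (itg_norm ifg)) => //.
    by apply: measurable_funM => //; apply: measurable_funM; [case: sf|case: sg].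
  rewrite (le_trans (int01_norm iw))//; apply: int01_le => //; exact: itg_norm.
rewrite (le_trans (normc_le_ReIm _))// mulr_natl mulr2n lerD//.
  rewrite Re_fourier (le_trans _ hb)//.
  by apply: bd; [exact: measurable_cosk|exact: cosk_max].
rewrite (le_trans _ hb)//.
have -> : Im (fourier (fun x => f x * g x) k) = int01 (fun x => f x * g x * - sink k x).
  rewrite /fourier /cintegral /cexp /=; congr Rintegral; apply/funext => x.
  by rewrite expR0 !mul1r mulr0 add0r sinN mulrC /sink.
apply: bd => [|x]; first by apply: measurableT_comp => //; exact: measurable_sink.
by rewrite normrN sink_max.
Qed.

(** The L^1 counterpart of [sqint]: for u in L^2 the square u^2 has Fourier coefficients but need
    not be square integrable. *)
Definition intg f := measurable_fun [set: R] f /\ itg f.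

Lemma intgM_bounded f g c : intg f -> measurable_fun [set: R] g ->
  (forall x, `|g x| <= c) -> itg (fun x => f x * g x).
Proof.
move=> [mf itf] mg gc; apply: (itg_le _ (itgZ c (itg_norm itf))).
  exact: measurable_funM.
by move=> x; rewrite normrM mulrC ler_wpM2r.
Qed.

Lemma intgB f g : intg f -> intg g -> intg (fun x => f x - g x).
Proof.
by move=> [mf itf] [mg itg']; split; [exact: measurable_funB|exact: itgB].
Qed.

Lemma sqint_intg f : sqint f -> intg f.
Proof. by move=> sf; split; [case: sf|exact: sqint_itg]. Qed.

Lemma intg_mul f g : sqint f -> sqint g -> intg (fun x => f x * g x).
Proof.
by move=> sf sg; split; [apply: measurable_funM; [case: sf|case: sg]|exact: sqint_mul].
Qed.

Lemma intg_sqr f : sqint f -> intg (fun x => f x ^+ 2).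
Proof. by move=> sf; have := intg_mul sf sf; under eq_fun do rewrite -expr2. Qed.

Lemma Im_fourier_intg g k : intg g -> Im (fourier g k) = - scoef g k.
Proof.
move=> sg; rewrite /scoef -[RHS]mulN1r -int01Z.
  rewrite /fourier /cintegral /cexp /=; congr Rintegral; apply/funext => x.
  by rewrite expR0 !mul1r mulr0 add0r sinN; rewrite /sink; ring.
by apply: intgM_bounded sg _ (sink_max k); exact: measurable_sink.
Qed.

Lemma fourierB_intg f g k : intg f -> intg g ->
  fourier (fun x => f x - g x) k = fourier f k - fourier g k.
Proof.
move=> sf sg; have s := intgB sf sg.
apply: complex_eqP; rewrite ?ReB ?ImB ?Re_fourier ?Im_fourier_intg//.
  rewrite /ccoef -int01B.
  - by congr int01; apply/funext => x; rewrite mulrBl.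
  - by apply: intgM_bounded sf _ (cosk_max k); exact: measurable_cosk.
  - by apply: intgM_bounded sg _ (cosk_max k); exact: measurable_cosk.
suff -> : scoef (fun x => f x - g x) k = scoef f k - scoef g k by rewrite opprB opprK addrC.
rewrite /scoef -int01B.
- by congr int01; apply/funext => x; rewrite mulrBl.
- by apply: intgM_bounded sf _ (sink_max k); exact: measurable_sink.
- by apply: intgM_bounded sg _ (sink_max k); exact: measurable_sink.
Qed.

Lemma convolution_cvg g h k : sqint g -> sqint h -> forall e : R, 0 < e ->
  exists N, forall n, (N <= n)%N ->
  normc (fourier (fun x => g x * h x) k - \sum_(j <- box n) fourier g j * fourier h (k - j)) <= e.
Proof.
move=> sg sh e e0; pose H := int01 (fun x => h x ^+ 2).
have H0 : 0 <= H by apply: int01_ge0 => x; exact: sqr_ge0.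
(* This weight makes c^-1 H at most e / 4; the residual of g is then taken below e / (4 c), so that
   each half of the product bound costs e / 2. *)
pose c := (4 * (H + 1)) / e; have c0 : 0 < c by rewrite divr_gt0// mulr_gt0// ltr_pwDr.
have [N hN] := psum_cvg sg (divr_gt0 (divr_gt0 e0 (ltr0n _ 4)) c0).
exists N => n /hN hn; rewrite -fourier_psum_mul//.
have sp := sqint_psum g n.
rewrite -fourierB_intg; [|exact: intg_mul..].
have -> : (fun x => g x * h x - psum g n x * h x) = (fun x => (g x - psum g n x) * h x).
  by apply/funext => x; rewrite mulrBl.
rewrite (le_trans (normc_fourier_mul k c0 (sqintB sg sp) sh))// -/H.
have h1 : c * int01 (fun x => (g x - psum g n x) ^+ 2) <= e / 4.
  by rewrite mulrC -ler_pdivlMr.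
have h2 : c^-1 * H <= e / 4.
  rewrite /c invf_div mulrAC ler_pdivrMr ?mulr_gt0 ?ltr_pwDr//.
  by nra.
lra.
Qed.

(** Bounds on finite convolution sums suffice, so that no convolution series has to be summed in the
    nonlinear estimates. *)
Lemma convolution_bound g h k B : sqint g -> sqint h ->
  (forall n, normc (\sum_(j <- box n) fourier g j * fourier h (k - j)) <= B) ->
  normc (fourier (fun x => g x * h x) k) <= B.
Proof.
move=> sg sh hB; apply/ler_addgt0Pr => e e0.
have [N /(_ N (leqnn N)) hN] := convolution_cvg k sg sh e0.
have := normcD (fourier (fun x => g x * h x) k - \sum_(j <- box N) fourier g j * fourier h (k - j)) (\sum_(j <- box N) fourier g j * fourier h (k - j)).
by rewrite subrK => /le_trans; apply; rewrite addrC lerD.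
Qed.

End Parseval.

(** * Integrals in time *)

Section AlmostEverywhere.
Context d (T : measurableType d) (R : realType).
Variable mu : {measure set T -> \bar R}.
Import HBNNSimple.
Local Open Scope ereal_scope.

(** A simple function below f, set to 0 on the exceptional null set, lies below g and has the same
    integral. This serves for the coefficients of the forcing, which agree only almost everywhere
    with measurable functions. *)
Lemma ge0_integral_le_ae (D : set T) (f g : T -> \bar R) :
  (forall x, D x -> 0 <= f x) -> (forall x, D x -> 0 <= g x) ->
  {ae mu, forall x, D x -> f x = g x} ->
  \int[mu]_(x in D) f x <= \int[mu]_(x in D) g x.
Proof.
move=> f0 g0 [N [mN N0 fgN]].
rewrite ge0_integralE// [leRHS]ge0_integralE//.
apply: ge_ereal_sup => _ /= [h hf <-].
have mNc : measurable (~` N) by exact: measurableC.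
apply: ereal_sup_ubound => /=; exists (proj_nnsfun h mNc) => [x|].
  rewrite /proj_nnsfun /= mindicE.
  have [xN|xN] := boolP (x \in ~` N).
    rewrite mulr1 (le_trans (hf x))// /patch; case: ifPn => //; rewrite inE => Dx.
    rewrite le_eqVlt; apply/orP; left; apply/eqP.
    apply: contrapT => fg; move: xN; rewrite inE; apply; apply: fgN => /=.
    by move=> /(_ Dx).
  by rewrite mulr0 /patch; case: ifPn => //; rewrite inE => /g0.
have E (p : {nnsfun T >-> R}) : sintegral mu p = \int[mu]_x (p x)%:E.
  by rewrite integral_nnsfun// patch_setT.
rewrite !E; apply: ge0_ae_eq_integral => //.
- by apply/measurable_EFinP; exact: measurable_funP.
- by apply/measurable_EFinP; exact: measurable_funP.
- by move=> x _; rewrite lee_fin; exact: fun_ge0.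
- by move=> x _; rewrite lee_fin; exact: fun_ge0.
exists N; split => // x /= hx; apply: contrapT => xN; apply: hx => _.
by rewrite /proj_nnsfun /= mindicE mem_set ?mulr1.
Qed.

(* No measurability is assumed: the integral of a nonnegative function is a
   supremum over the simple functions below it. *)
Lemma integral_ae_congr (D : set T) (f g : T -> \bar R) :
  {ae mu, forall x, D x -> f x = g x} ->
  \int[mu]_(x in D) f x = \int[mu]_(x in D) g x.
Proof.
move=> fg; rewrite integralE [RHS]integralE.
have e1 : {ae mu, forall x, D x -> f ^\+ x = g ^\+ x}.
  apply: (@filterS _ _ (ae_filter_ringOfSetsType mu) _ _ _ fg) => x h Dx.
  by rewrite !funeposE h.
have e2 : {ae mu, forall x, D x -> f ^\- x = g ^\- x}.
  apply: (@filterS _ _ (ae_filter_ringOfSetsType mu) _ _ _ fg) => x h Dx.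
  by rewrite !funenegE h.
have sym (p q : T -> \bar R) : {ae mu, forall x, D x -> p x = q x} ->
    {ae mu, forall x, D x -> q x = p x}.
  by move=> pq; apply: (@filterS _ _ (ae_filter_ringOfSetsType mu) _ _ _ pq) => x h Dx; rewrite h.
by congr (_ - _); apply/eqP; rewrite eq_le; apply/andP; split;
  apply: ge0_integral_le_ae => //; exact: sym.
Qed.

Lemma Rintegral_ae_congr (D : set T) (f g : T -> R) :
  {ae mu, forall x, D x -> f x = g x} ->
  (\int[mu]_(x in D) f x = \int[mu]_(x in D) g x)%R.
Proof.
move=> fg; congr fine; apply: integral_ae_congr.
by apply: (@filterS _ _ (ae_filter_ringOfSetsType mu) _ _ _ fg) => x h Dx; rewrite h.
Qed.

End AlmostEverywhere.

(** * Complex-valued integrals over time intervals *)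

Section TimeIntegral.
Variable R : realType.
Notation mu := (@lebesgue_measure R).
Implicit Types (F G : R -> R[i]) (a b t : R).

Lemma cintegral_ae_congr (D : set R) F G : {ae mu, forall s, D s -> F s = G s} ->
  cintegral D F = cintegral D G.
Proof.
move=> FG; rewrite /cintegral; congr (_ +i* _);
apply: Rintegral_ae_congr;
by apply: (@filterS _ _ (ae_filter_ringOfSetsType mu) _ _ _ FG) => x h Dx; rewrite h.
Qed.

Lemma cintegral_congr (D : set R) F G : (forall s, D s -> F s = G s) ->
  cintegral D F = cintegral D G.
Proof. by move=> FG; apply: cintegral_ae_congr; apply: aeW. Qed.

(** Locally bounded and measurable: a class of integrands stable under products and translations,
    and integrable on every compact interval. *)
Definition lbm F := [/\ measurable_fun [set: R] (fun s => Re (F s)),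
  measurable_fun [set: R] (fun s => Im (F s)) &
  forall T : R, exists M : R, forall s, `|s| <= T -> normc (F s) <= M].

Lemma lbmD F G : lbm F -> lbm G -> lbm (fun s => F s + G s).
Proof.
move=> [mF1 mF2 bF] [mG1 mG2 bG]; split.
- by under eq_fun do rewrite ReD; exact: measurable_funD.
- by under eq_fun do rewrite ImD; exact: measurable_funD.
- move=> T; have [M hM] := bF T; have [L hL] := bG T; exists (M + L) => s sT.
  by rewrite (le_trans (normcD _ _))// lerD ?hM ?hL.
Qed.

Lemma lbmM F G : lbm F -> lbm G -> lbm (fun s => F s * G s).
Proof.
move=> [mF1 mF2 bF] [mG1 mG2 bG]; split.
- by under eq_fun do rewrite ReM; apply: measurable_funB; exact: measurable_funM.
- by under eq_fun do rewrite ImM; apply: measurable_funD; exact: measurable_funM.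
- move=> T; have [M hM] := bF T; have [L hL] := bG T; exists (M * L) => s sT.
  by rewrite normcM ler_pM ?normc_ge0 ?hM ?hL.
Qed.

Lemma lbm_cst z : lbm (fun=> z).
Proof. by split => [||T]; [exact: measurable_cst|exact: measurable_cst|exists (normc z)]. Qed.

Lemma lbmB F G : lbm F -> lbm G -> lbm (fun s => F s - G s).
Proof.
move=> hF hG; have := lbmD hF (lbmM (lbm_cst (-1)) hG).
by under eq_fun do rewrite mulN1r.
Qed.

Lemma lbm_shift F c : lbm F -> lbm (fun s => F (s + c)).
Proof.
have ms : measurable_fun [set: R] (fun s : R => s + c).
  by apply: measurable_funD => //; exact: measurable_cst.
move=> [mF1 mF2 bF]; split.
- exact: (measurableT_comp mF1 ms).
- exact: (measurableT_comp mF2 ms).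
- move=> T; have [M hM] := bF (T + `|c|); exists M => s sT; apply: hM.
  by rewrite (le_trans (ler_normD _ _))// lerD2r.
Qed.

Lemma lbm_continuous F : continuous (fun s => Re (F s)) -> continuous (fun s => Im (F s)) -> lbm F.
Proof.
move=> c1 c2; split; [exact: continuous_measurable_fun..|].
move=> T; have [T0|T0] := ltP T 0.
  by exists 0 => s sT; have := le_lt_trans sT T0; rewrite normr_lt0.
have bd (f : R -> R) : continuous f -> exists M : R, forall s, `|s| <= T -> `|f s| <= M.
  move=> cf; have NTT : - T <= T by lra.
  have [x _ hx] := EVT_max NTT (continuous_subspaceT cf).
  have [y _ hy] := EVT_min NTT (continuous_subspaceT cf).
  exists (`|f x| + `|f y|) => s; rewrite ler_norml => sT.
  have := hx s; have := hy s; rewrite in_itv/= => /(_ sT) h1 /(_ sT) h2.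
  rewrite ler_norml; have := ler_norm (f x); have := ler_norm (- f y); rewrite normrN.
  by have := normr_ge0 (f x); have := normr_ge0 (f y) => *; apply/andP; split; lra.
have [M1 h1] := bd _ c1; have [M2 h2] := bd _ c2.
by exists (M1 + M2) => s sT; rewrite (le_trans (normc_le_ReIm _))// lerD ?h1 ?h2.
Qed.

Definition intgT a b (f : R -> R) := mu.-integrable `[a, b] (EFin \o f).

Lemma lbm_integrable a b F : lbm F ->
  intgT a b (fun s => Re (F s)) /\ intgT a b (fun s => Im (F s)).
Proof.
move=> [m1 m2 bF]; have [M hM] := bF (`|a| + `|b|).
have hs s : s \in `[a, b] -> normc (F s) <= M.
  rewrite in_itv/= => /andP[h1 h2]; apply: hM.
  have := ler_norm b; have := ler_norm (- a); rewrite normrN.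
  have := normr_ge0 b; have := normr_ge0 a; rewrite ler_norml => *; apply/andP; split; lra.
have fin : (mu `[a, b] < +oo)%E.
  by rewrite lebesgue_measure_itv/=; case: ifP => // _; rewrite -EFinB ltry.
split; apply: measurable_bounded_integrable => //.
- exact: measurable_funS m1.
- exists M; split; first exact: num_real.
  by move=> x Mx s /= sab; rewrite (le_trans (ler_Re _))// (le_trans (hs s sab))// ltW.
- exact: measurable_funS m2.
- exists M; split; first exact: num_real.
  by move=> x Mx s /= sab; rewrite (le_trans (ler_Im _))// (le_trans (hs s sab))// ltW.
Qed.

Lemma cintegralB a b F G : lbm F -> lbm G ->
  cintegral `[a, b] (fun s => F s - G s) = cintegral `[a, b] F - cintegral `[a, b] G.
Proof.
move=> /(lbm_integrable a b)[f1 f2] /(lbm_integrable a b)[g1 g2].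
apply: complex_eqP; rewrite ?ReB ?ImB /cintegral /=.
  by rewrite -RintegralB//; congr Rintegral; apply/funext => s; rewrite ReB.
by rewrite -RintegralB//; congr Rintegral; apply/funext => s; rewrite ImB.
Qed.

Lemma cintegralZ a b z F : lbm F ->
  cintegral `[a, b] (fun s => z * F s) = z * cintegral `[a, b] F.
Proof.
move=> /(lbm_integrable a b)[f1 f2].
have zi (c : R) f : intgT a b f -> intgT a b (fun s => c * f s).
  by move=> h; apply: (eq_integrable _ _ _ _ (integrableZl _ c h)) => // x _.
apply: complex_eqP; rewrite ?ReM ?ImM /cintegral /=.
  rewrite -!RintegralZl// -RintegralB//; [|exact: zi..].
  by congr Rintegral; apply/funext => s; rewrite ReM.
rewrite -!RintegralZl// -RintegralD//; [|exact: zi..].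
by congr Rintegral; apply/funext => s; rewrite ImM.
Qed.

(** Real and imaginary parts are bounded separately, whence the factor 2. *)
Lemma normc_cintegral a b F M : a <= b -> lbm F ->
  (forall s, a <= s <= b -> normc (F s) <= M) ->
  normc (cintegral `[a, b] F) <= 2 * M * (b - a).
Proof.
move=> ab hF hM; have [f1 f2] := lbm_integrable a b hF.
have bd (f : R -> R) : intgT a b f -> (forall s, a <= s <= b -> `|f s| <= M) ->
    `|Rintegral mu `[a, b] f| <= M * (b - a).
  move=> hf fM; rewrite (le_trans (le_normr_Rintegral _ hf))//.
  have fin : (mu `[a, b] < +oo)%E.
    by rewrite lebesgue_measure_itv/=; case: ifP => // _; rewrite -EFinB ltry.
  apply: (@le_trans _ _ (Rintegral mu `[a, b] (fun=> M))).
    have i1 : intgT a b (fun s => `|f s|) by exact: integrable_norm.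
    have i2 : intgT a b (fun=> M).
      by apply: measurable_bounded_integrable => //; exact: bounded_cst.
    have h s : `[a, b]%classic s -> `|f s| <= M by rewrite /= in_itv/= => /fM.
    exact: (le_Rintegral _ i1 i2 h).
  have -> : Rintegral mu `[a, b] (fun=> M) = M * fine (mu `[a, b]) by exact: Rintegral_cst.
  rewrite lebesgue_measure_itv/= lte_fin.
  have [ab'|ba] := ltP a b; first by rewrite -EFinB.
  by rewrite /= mulr0 (_ : b = a) ?subrr ?mulr0//; apply/eqP; rewrite eq_le ab ba.
rewrite (le_trans (normc_le_ReIm _))// -mulrA mulr_natl mulr2n lerD//.
  by apply: bd => // s /hM; apply: le_trans; exact: ler_Re.
by apply: bd => // s /hM; apply: le_trans; exact: ler_Im.
Qed.

Lemma cintegral_cat a b c F : lbm F -> a <= b -> b <= c ->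
  cintegral `[a, c] F = cintegral `[a, b] F + cintegral `[b, c] F.
Proof.
move=> hF ab bc; have [f1 f2] := lbm_integrable a c hF.
have [g1 g2] := lbm_integrable b c hF.
have cat (f : R -> R) : intgT a c f -> intgT b c f ->
    Rintegral mu `[a, c] f = Rintegral mu `[a, b] f + Rintegral mu `[b, c] f.
  move=> fac fbc; rewrite -(@Rintegral_itv_obnd_cbnd _ b).
    by rewrite -(@Rintegral_itvB _ _ _ _ b fac)// addrC subrK.
  apply: integrableS fbc => //; apply: subset_itvr.
  by rewrite bnd_simp.
by apply: complex_eqP; rewrite ?ReD ?ImD /cintegral /= cat.
Qed.

Lemma cintegral_itv1 a F : cintegral `[a, a] F = 0.
Proof. by rewrite /cintegral set_itv1 !Rintegral_set1. Qed.

End TimeIntegral.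

(** * Differentiation in time and the Duhamel formula *)

Section ComplexDerivative.
Variable R : realType.
Notation mu := (@lebesgue_measure R).
Implicit Types (F G : R -> R[i]) (a b t : R).

Definition cderiv F t (D : R[i]) :=
  is_derive t 1 (fun s => Re (F s)) (Re D) /\ is_derive t 1 (fun s => Im (F s)) (Im D).

Definition ccont F := continuous (fun s => Re (F s)) /\ continuous (fun s => Im (F s)).

Lemma cderiv_eq F t D D' : cderiv F t D -> D = D' -> cderiv F t D'.
Proof. by move=> h <-. Qed.

Lemma cderivD F G t D E : cderiv F t D -> cderiv G t E ->
  cderiv (fun s => F s + G s) t (D + E).
Proof.
move=> [f1 f2] [g1 g2]; split; rewrite ?ReD ?ImD.
  by under eq_fun do rewrite ReD; exact: isdD.
by under eq_fun do rewrite ImD; exact: isdD.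
Qed.

Lemma isdB (f g : R -> R) (x a b : R) : is_derive x 1 f a -> is_derive x 1 g b ->
  is_derive x 1 (fun y => f y - g y) (a - b).
Proof.
move=> hf hg; have := isdD hf (isdZ (-1) hg); rewrite mulN1r.
by under eq_fun do rewrite mulN1r.
Qed.

Lemma cderivM F G t D E : cderiv F t D -> cderiv G t E ->
  cderiv (fun s => F s * G s) t (D * G t + F t * E).
Proof.
move=> [f1 f2] [g1 g2]; split.
  under eq_fun do rewrite ReM.
  by apply: isd_eq (isdB (isdM f1 g1) (isdM f2 g2)) _; rewrite ReD !ReM; ring.
under eq_fun do rewrite ImM.
by apply: isd_eq (isdD (isdM f1 g2) (isdM f2 g1)) _; rewrite ImD !ImM; ring.
Qed.

Lemma cderiv_cst z t : cderiv (fun=> z) t 0.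
Proof. by split; exact: isd_cst. Qed.

Lemma cexp_scale (A : R[i]) (s : R) : cexp (s%:C * A) =
  (expR (s * Re A) * cos (s * Im A)) +i* (expR (s * Re A) * sin (s * Im A)).
Proof. by rewrite /cexp ReM ImM /= !mul0r subr0 addr0. Qed.

Lemma cderiv_cexp (A : R[i]) t : cderiv (fun s => cexp (s%:C * A)) t (A * cexp (t%:C * A)).
Proof.
have hl (c : R) : is_derive t 1 (fun s : R => s * c) c.
  by apply: isd_eq (isdM (isd_id t) (isd_cst c t)) _; rewrite mul1r mulr0 addr0.
have he : is_derive t 1 (fun s => expR (s * Re A)) (expR (t * Re A) * Re A).
  exact: isd_comp (is_derive_expR _) (hl _).
have hc : is_derive t 1 (fun s => cos (s * Im A)) (- sin (t * Im A) * Im A).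
  exact: isd_comp (is_derive_cos _) (hl _).
have hs : is_derive t 1 (fun s => sin (s * Im A)) (cos (t * Im A) * Im A).
  exact: isd_comp (is_derive_sin _) (hl _).
split; under eq_fun do rewrite cexp_scale.
  by apply: isd_eq (isdM he hc) _; rewrite cexp_scale ReM/=; ring.
by apply: isd_eq (isdM he hs) _; rewrite cexp_scale ImM/=; ring.
Qed.

Lemma cderiv_ccont F : (forall t, exists D, cderiv F t D) -> ccont F.
Proof.
by move=> h; split=> t; have [D [h1 h2]] := h t; [exact: isd_cont h1|exact: isd_cont h2].
Qed.

Lemma ccont_cexp A : ccont (fun s : R => cexp (s%:C * A)).
Proof. by apply: cderiv_ccont => t; exists (A * cexp (t%:C * A)); exact: cderiv_cexp. Qed.

Lemma ccont_lbm F : ccont F -> lbm F.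
Proof. by move=> [c1 c2]; exact: lbm_continuous. Qed.

Lemma ccontN_arg F : ccont F -> ccont (fun s => F (- s)).
Proof.
move=> [c1 c2]; split=> t.
  by apply: (@continuous_comp _ _ _ (fun s : R => - s) (fun s => Re (F s))); [exact: opp_continuous|exact: c1].
by apply: (@continuous_comp _ _ _ (fun s : R => - s) (fun s => Im (F s))); [exact: opp_continuous|exact: c2].
Qed.

Lemma ccontM F G : ccont F -> ccont G -> ccont (fun s => F s * G s).
Proof.
move=> [f1 f2] [g1 g2]; split=> t.
  by under eq_fun do rewrite ReM; apply: cvgB; apply: cvgM; [exact: f1|exact: g1|exact: f2|exact: g2].
by under eq_fun do rewrite ImM; apply: cvgD; apply: cvgM; [exact: f1|exact: g2|exact: f2|exact: g1].
Qed.

Lemma lbm_cexpN A : lbm (fun s : R => cexp ((- s)%:C * A)).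
Proof. exact/ccont_lbm/(ccontN_arg (ccont_cexp A)). Qed.

(** The lower limit -1 makes t = 0 an interior point, so the primitive has a two-sided derivative
    there. *)
Lemma cderiv_cintegral G t : ccont G -> -1 < t ->
  cderiv (fun s => cintegral `[-1, s] G) t (G t).
Proof.
move=> cG t1; have tt : t < t + 1 by rewrite ltrDl.
have [i1 i2] := lbm_integrable (-1) (t + 1) (ccont_lbm cG).
case: cG => c1 c2.
split=> /=.
  have [d e] := continuous_FTC1_closed tt i1 t1 (c1 t).
  by apply: DeriveDef; [exact: d|rewrite -derive1E; exact: e].
have [d e] := continuous_FTC1_closed tt i2 t1 (c2 t).
by apply: DeriveDef; [exact: d|rewrite -derive1E; exact: e].
Qed.

(** With e^(tA) factored out, t occurs in the integral only as its upper limit, so the product rule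
    applies; [duhamelE] recovers the usual form. *)
Definition duhamel (A w0 : R[i]) (g : R -> R[i]) t :=
  cexp (t%:C * A) * (w0 + cintegral `[0, t] (fun s => cexp ((- s)%:C * A) * g s)).

Lemma duhamelE A w0 g t : lbm g ->
  duhamel A w0 g t = cexp (t%:C * A) * w0 +
    cintegral `[0, t] (fun s => cexp ((t - s)%:C * A) * g s).
Proof.
move=> hg; have hG := lbmM (lbm_cexpN A) hg.
rewrite /duhamel mulrDr -cintegralZ//; congr (_ + _); apply: cintegral_congr => s _.
by rewrite mulrA -cexpD -mulrDl -rmorphD.
Qed.

Lemma duhamel_ode A w0 g : ccont g ->
  exists2 W : R -> R[i], (forall t, 0 <= t -> W t = duhamel A w0 g t) &
    (forall t, 0 <= t -> cderiv W t (A * W t + g t)).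
Proof.
move=> cg; pose G s := cexp ((- s)%:C * A) * g s.
have cG : ccont G by apply: ccontM => //; exact: (ccontN_arg (ccont_cexp A)).
(* Moving the base point from 0 to -1 and subtracting the integral over [-1, 0] changes nothing for
   t >= 0, but extends the function to the left of 0. *)
pose W t := cexp (t%:C * A) * ((w0 - cintegral `[-1, 0] G) + cintegral `[-1, t] G).
exists W => t t0.
  rewrite /W /duhamel; congr (_ * _); rewrite -addrA; congr (_ + _).
  rewrite (@cintegral_cat _ (-1) 0 t)//; last exact: ccont_lbm.
  by rewrite addrA addNr add0r.
have t1 : -1 < t by apply: lt_le_trans t0; rewrite ltrN10.
apply: cderiv_eq (cderivM (cderiv_cexp A t) (cderivD (cderiv_cst _ t) (cderiv_cintegral cG t1))) _.
rewrite add0r /W mulrA; congr (_ + _).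
by rewrite /G mulrA -cexpD -mulrDl -rmorphD subrr mul0r cexp0 mul1r.
Qed.

End ComplexDerivative.

(** * Translation invariance of Lebesgue measure *)

Section Translation.
Variable R : realType.
Notation mu := (@lebesgue_measure R).
Implicit Types (c : R).

Lemma lebesgue_measure_shift c (A : set (measurableTypeR R)) : measurable A ->
  mu A = pushforward mu (fun x : measurableTypeR R => x + c : measurableTypeR R) A.
Proof.
move=> mA; apply/lebesgue_measure_unique => //=.
  by apply: measurable_funD => //; exact: measurable_cst.
move=> _ _ [[a b]] _ <-.
rewrite /pushforward /= (_ : _ @^-1` _ = `]a - c, b - c]%classic).
  by rewrite !lebesgue_measure_itv/= !lte_fin ltrD2r; case: ifP => // _; rewrite -!EFinB; congr (_%:E); ring.
by apply/seteqP; split => x /=; rewrite !in_itv/= ltrBlDr lerBrDr.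
Qed.

Lemma ae_shift c (P : R -> Prop) : {ae mu, forall s, P s} -> {ae mu, forall s, P (s + c)}.
Proof.
have mc : measurable_fun [set: measurableTypeR R] (fun x : measurableTypeR R => x + c : measurableTypeR R).
  by apply: measurable_funD => //; exact: measurable_cst.
move=> [N [mN N0 PN]]; exists ((fun x => x + c) @^-1` N); split.
- by rewrite -[X in measurable X]setTI; exact: mc.
- by rewrite -N0 (lebesgue_measure_shift c mN).
- by move=> s /= h; apply: PN.
Qed.

Lemma Rintegral_shift c a b (f : R -> R) : measurable_fun [set: R] f ->
  mu.-integrable `[a, b] (EFin \o (fun s => f (s + c))) ->
  Rintegral mu `[a + c, b + c] f = Rintegral mu `[a, b] (fun s => f (s + c)).
Proof.
move=> mf hf; have mc : measurable_fun [set: measurableTypeR R] (fun x : measurableTypeR R => x + c : measurableTypeR R).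
  by apply: measurable_funD => //; exact: measurable_cst.
have pre : (fun x : measurableTypeR R => x + c : measurableTypeR R) @^-1` `[a + c, b + c]%classic = `[a, b]%classic.
  by apply/seteqP; split => x /=; rewrite !in_itv/= !lerD2r.
rewrite /Rintegral; congr fine.
rewrite (@eq_measure_integral _ _ _ _ (pushforward mu (fun x : measurableTypeR R => x + c : measurableTypeR R))).
  rewrite (@integral_pushforward _ _ _ _ _ _ mc mu _ (EFin \o f))//.
  - by rewrite pre.
  - exact/measurable_EFinP.
  - by rewrite pre.
by move=> A mA _; exact: lebesgue_measure_shift.
Qed.

Lemma cintegral_shift c a b (F : R -> R[i]) : lbm F ->
  cintegral `[a + c, b + c] F = cintegral `[a, b] (fun s => F (s + c)).
Proof.
move=> hF; have [i1 i2] := lbm_integrable a b (lbm_shift c hF).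
have [m1 m2 _] := hF.
by rewrite /cintegral !Rintegral_shift.
Qed.

End Translation.

(** * Sobolev weights *)

Section Weights.
Variable R : realType.
Implicit Types (k j : int) (l : R) (n : nat).

Definition br k : R := 1 + freq k ^+ 2.
Definition wt l k : R := br k `^ l.
(** Half-integer powers of 1 + |k|. The convolution of 1 / |k| with itself carries a logarithm;
    giving up half a power, from [rk ^ 2] to [rk], avoids it, and [rk ^ -3] is already summable. *)
Definition rk k : R := Num.sqrt (1 + `|k|%N%:R).

Lemma br_ge1 k : 1 <= br k. Proof. by rewrite /br lerDl sqr_ge0. Qed.
Lemma br_gt0 k : 0 < br k. Proof. exact: lt_le_trans ltr01 (br_ge1 k). Qed.
Lemma wt_gt0 l k : 0 < wt l k. Proof. exact/powR_gt0/br_gt0. Qed.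
Lemma wt_ge0 l k : 0 <= wt l k. Proof. exact/ltW/wt_gt0. Qed.
Lemma wtD l m k : wt (l + m) k = wt l k * wt m k.
Proof. by rewrite /wt powRD//; apply/implyP => _; rewrite gt_eqF// br_gt0. Qed.
Lemma wt1 k : wt 1 k = br k.
Proof. by rewrite /wt powRr1// ltW// br_gt0. Qed.
Lemma wt_ge1 l k : 0 <= l -> 1 <= wt l k.
Proof.
move=> l0; rewrite -(powRr0 (br k)); apply: ler_powR => //; exact: br_ge1.
Qed.
Lemma wt_half l k : wt (l / 2) k ^+ 2 = wt l k.
Proof. by rewrite expr2 -wtD -splitr. Qed.
Lemma wtN l k : wt l (- k) = wt l k.
Proof. by rewrite /wt /br freqN sqrrN. Qed.

Lemma brD k j : br k <= 2 * br j + 2 * br (k - j).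
Proof.
rewrite /br; have -> : freq k = freq j + freq (k - j) :> R by rewrite -freqD addrC subrK.
by have := sqr_ge0 (freq j - freq (k - j) : R); nra.
Qed.

(** The larger of br j and br (k - j) is at least br k / 4, and raising this to the power l gives
    the constant. *)
Lemma wt_quasi l k j : 0 <= l -> wt l k <= 4 `^ l * (wt l j + wt l (k - j)).
Proof.
move=> l0; have h4 : (0 : R) <= 4 by [].
have hb i : 0 <= br i by exact/ltW/br_gt0.
have mono (x y : R) : 0 <= x -> 0 <= y -> x <= 4 * y -> x `^ l <= 4 `^ l * y `^ l.
  move=> x0 y0 xy; rewrite -powRM//.
  by apply: ge0_ler_powR => //; rewrite nnegrE// mulr_ge0.
rewrite mulrDr /wt; have := brD k j; have [h|h] := leP (br j) (br (k - j)) => hk.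
  rewrite (le_trans (mono _ (br (k - j)) _ _ _))//; first by lra.
  by rewrite lerDr mulr_ge0 ?powR_ge0.
rewrite (le_trans (mono _ (br j) _ _ _))//; first by lra.
by rewrite lerDl mulr_ge0 ?powR_ge0.
Qed.

Lemma rk_ge1 k : 1 <= rk k.
Proof. by rewrite -{1}(sqrtr1 R) ler_sqrt ?lerDl// addr_ge0. Qed.
Lemma rk_gt0 k : 0 < rk k. Proof. exact: lt_le_trans ltr01 (rk_ge1 k). Qed.
Lemma sqr_rk k : rk k ^+ 2 = 1 + `|k|%N%:R.
Proof. by rewrite sqr_sqrtr// addr_ge0. Qed.
Lemma rkD k j : rk k <= rk j + rk (k - j).
Proof.
have a0 := ltW (rk_gt0 j); have b0 := ltW (rk_gt0 (k - j)).
rewrite -(ler_sqr (ltW (rk_gt0 k))) ?nnegrE ?addr_ge0// sqrrD !sqr_rk.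
have : (`|k|%N%:R : R) <= `|j|%N%:R + `|(k - j)%R|%N%:R.
  by rewrite -natrD ler_nat; lia.
by have := mulr_ge0 a0 b0; lra.
Qed.

Lemma natr_abs_le_freq k : (`|k|%N%:R : R) <= `|freq k|.
Proof.
rewrite /freq normrM [leRHS](_ : _ = 2 * pi * `|k|%N%:R).
  rewrite ler_peMl//; have := pi_ge2 R; lra.
by rewrite ger0_norm ?mulr_ge0 ?pi_ge0// natr_absz intr_norm.
Qed.

Lemma rk4_le_br k : rk k ^+ 4 <= 2 * br k.
Proof.
rewrite (exprM _ 2 2) sqr_rk /br -[freq k ^+ 2]real_normK ?num_real//.
have := natr_abs_le_freq k; set a := `|k|%N%:R; set b := `|freq k|.
have a0 : 0 <= a by []. 
have := sqr_ge0 (a - 1); nra.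
Qed.

Lemma rk3_le_br k : rk k ^+ 3 <= 2 * br k.
Proof.
apply: le_trans (rk4_le_br k); rewrite [leRHS]exprS ler_peMl ?rk_ge1//.
by rewrite exprn_ge0 ?ltW ?rk_gt0.
Qed.

Lemma rk2_freq_le_br k : rk k ^+ 2 * `|freq k| <= 2 * br k.
Proof.
rewrite sqr_rk /br -[freq k ^+ 2]real_normK ?num_real//.
have := natr_abs_le_freq k; set a := `|k|%N%:R; set b := `|freq k|.
have b0 : 0 <= b by exact: normr_ge0.
by have := sqr_ge0 (b - 1); nra.
Qed.

Lemma freq_le_br k : `|freq k : R| <= br k.
Proof.
rewrite /br -[freq k ^+ 2]real_normK ?num_real//.
by have := sqr_ge0 (`|freq k : R| - 1); have := normr_ge0 (freq k : R); nra.
Qed.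

Lemma sum_boxS (F : int -> R) n :
  \sum_(k <- box n.+1) F k = \sum_(k <- box n) F k + (F n.+1%:Z + F (- n.+1%:Z)).
Proof.
transitivity (\sum_(k <- box n ++ [:: n.+1%:Z; - n.+1%:Z]) F k).
  apply: perm_big; apply: uniq_perm; first exact: box_uniq.
    have h1 : n.+1%:Z \notin box n by rewrite mem_box; lia.
    have h2 : - n.+1%:Z \notin box n by rewrite mem_box; lia.
    rewrite cat_uniq box_uniq; apply/and3P; split => //.
      by apply/hasPn => k; rewrite !inE => /orP[|] /eqP ->.

  by move=> k; rewrite mem_cat !mem_box !inE; lia.
by rewrite big_cat/= big_cons big_seq1.
Qed.

(** Telescoping: with s_n = sqrt(n + 1), the two terms added at step n + 1 satisfy 2 / s_(n+1)^3 <=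
    4 / s_n - 4 / s_(n+1), and the sum starts at 1 = 5 - 4 / s_0. *)
Lemma sum_rk3 : sumle (fun k => (rk k ^+ 3)^-1) 5.
Proof.
pose s n : R := Num.sqrt n.+1%:R.
have s0 n : 0 < s n by rewrite sqrtr_gt0.
have s2 n : s n ^+ 2 = n.+1%:R by rewrite sqr_sqrtr.
suff h n : \sum_(k <- box n) (rk k ^+ 3)^-1 <= 5 - 4 / s n.
  by move=> n; rewrite (le_trans (h n))// lerBlDr lerDl divr_ge0// ltW.
elim: n => [|n ih].
  rewrite /box /= big_seq1 subrr /rk /s /= addr0 sqrtr1 expr1n invr1; lra.
rewrite sum_boxS.
have -> : rk (- n.+1%:Z) = s n.+1 by rewrite /rk abszN /s -natr1 addrC.
have -> : rk n.+1%:Z = s n.+1 by rewrite /rk /s -natr1 addrC.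
suff : 2 / s n.+1 ^+ 3 <= 4 / s n - 4 / s n.+1 by lra.
have hd : s n.+1 ^+ 2 = s n ^+ 2 + 1 by rewrite !s2 natr1.
have a0 := s0 n; have b0 := s0 n.+1; set a := s n in hd a0 *; set b := s n.+1 in hd b0 *.
have ab : a <= b by rewrite -(ler_sqr (ltW a0) (ltW b0)) hd lerDl.
have -> : 4 / a - 4 / b = 4 / (a * b * (a + b)).
  have -> : 4 / a - 4 / b = 4 * (b - a) / (a * b) by field; rewrite !gt_eqF.
  have e : (b - a) * (b + a) = 1 by rewrite -subr_sqr hd addrAC subrr add0r.
  have -> : 4 / (a * b * (a + b)) = 4 * ((b - a) * (b + a)) / (a * b * (a + b)) by rewrite e mulr1.
  by field; rewrite !gt_eqF// addr_gt0.
rewrite ler_pdivrMr ?exprn_gt0// mulrAC ler_pdivlMr ?mulr_gt0 ?addr_gt0//.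
have : a * b * (a + b) <= 2 * b ^+ 3.
  have : a * (a + b) <= 2 * b ^+ 2 by nra.
  have -> : a * b * (a + b) = b * (a * (a + b)) by ring.
  have -> : 2 * b ^+ 3 = b * (2 * b ^+ 2) by ring.
  by rewrite ler_pM2l.
lra.
Qed.

Lemma sum_br : sumle (fun k => (br k)^-1) 10.
Proof.
apply: le_sumle (_ : sumle (fun k => 2 * (rk k ^+ 3)^-1) 10).
  move=> k; rewrite -[leRHS]invrK lef_pV2 ?posrE ?br_gt0//.
    by rewrite invfM invrK mulrC ler_pdivrMr// mulrC rk3_le_br.
  by rewrite invr_gt0 mulr_gt0// invr_gt0 exprn_gt0 ?rk_gt0.
have -> : 10 = 2 * 5 :> R by ring.
by apply: sumleZ => //; exact: sum_rk3.
Qed.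

Lemma rk3_inv_ge0 k : 0 <= (rk k ^+ 3)^-1.
Proof. by rewrite invr_ge0 exprn_ge0// ltW// rk_gt0. Qed.

(** The common pattern of the convolution estimates: once the product of the two decays is split
    into a function of j plus the same function of k - j, each half is summable in j. *)
Lemma conv_sum_le (a b : int -> R[i]) (k : int) n (c : R) (G : int -> R) (B : R) :
  (forall j, 0 <= G j) -> sumle G B -> 0 <= c ->
  (forall j, normc (a j) * normc (b (k - j)) <= c * (G j + G (k - j))) ->
  normc (\sum_(j <- box n) a j * b (k - j)) <= 2 * c * B.
Proof.
move=> G0 GB c0 h; rewrite (le_trans (normc_sum _ _))//.
apply: (@le_trans _ _ (\sum_(j <- box n) c * (G j + G (k - j)))).
  by apply: ler_sum => j _; rewrite normcM.
rewrite -mulr_sumr big_split/= -mulrA mulrCA ler_wpM2l// mulr_natl mulr2n lerD//.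
exact: sumle_shift.
Qed.

(** Dividing the quasi-triangle inequality by the two weights leaves their inverses, each at most 1
    / br, with sum at most 10. The constant is 2 * 10 * 4^(l + 1). *)
Lemma conv_wt l (a b : int -> R[i]) (x y : R) k n : 0 <= l ->
  (forall j, normc (a j) <= x / wt (l + 1) j) ->
  (forall j, normc (b j) <= y / wt (l + 1) j) ->
  normc (\sum_(j <- box n) a j * b (k - j)) <= 20 * 4 `^ (l + 1) * (x * y) / wt (l + 1) k.
Proof.
move=> l0 ha hb; have w0 j := wt_gt0 (l + 1) j.
have x0 : 0 <= x by have := le_trans (normc_ge0 _) (ha 0); rewrite pmulr_lge0// invr_gt0.
have y0 : 0 <= y by have := le_trans (normc_ge0 _) (hb 0); rewrite pmulr_lge0// invr_gt0.
have -> : 20 * 4 `^ (l + 1) * (x * y) / wt (l + 1) k = 2 * (4 `^ (l + 1) * (x * y) / wt (l + 1) k) * 10 :> R.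
  by ring.
apply: (@conv_sum_le _ _ _ _ _ (fun j => (br j)^-1)) => //.
- by move=> j; rewrite invr_ge0 ltW// br_gt0.
- exact: sum_br.
- by rewrite divr_ge0 ?mulr_ge0 ?powR_ge0// ltW.
move=> j; apply: (@le_trans _ _ ((x / wt (l + 1) j) * (y / wt (l + 1) (k - j)))).
  by rewrite ler_pM ?normc_ge0.
have hw i : (wt (l + 1) i)^-1 <= (br i)^-1.
  by rewrite lef_pV2 ?posrE ?br_gt0// wtD wt1 ler_peMl ?wt_ge1// ltW// br_gt0.
have -> : x / wt (l + 1) j * (y / wt (l + 1) (k - j)) =
  (x * y) / wt (l + 1) k * (wt (l + 1) k / (wt (l + 1) j * wt (l + 1) (k - j))).
  by field; rewrite !gt_eqF.
have -> : 4 `^ (l + 1) * (x * y) / wt (l + 1) k * ((br j)^-1 + (br (k - j))^-1) =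
  x * y / wt (l + 1) k * (4 `^ (l + 1) * ((br j)^-1 + (br (k - j))^-1)) by ring.
rewrite ler_wpM2l//; first by rewrite divr_ge0 ?mulr_ge0// ltW.
apply: (@le_trans _ _ (4 `^ (l + 1) * ((wt (l + 1) j)^-1 + (wt (l + 1) (k - j))^-1))).
  rewrite ler_pdivrMr ?mulr_gt0//.
  apply: (le_trans (@wt_quasi (l + 1) k j _)); first by rewrite addr_ge0.
  rewrite -mulrA ler_wpM2l ?powR_ge0// le_eqVlt; apply/orP; left; apply/eqP.
  by field; rewrite !gt_eqF.
by rewrite ler_wpM2l ?powR_ge0// lerD.
Qed.

Lemma conv_rk1 (a b : int -> R[i]) (x y : R) k n :
  (forall j, normc (a j) <= x / rk j ^+ 2) -> (forall j, normc (b j) <= y / rk j ^+ 2) ->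
  normc (\sum_(j <- box n) a j * b (k - j)) <= 10 * (x * y) / rk k.
Proof.
move=> ha hb; have w0 j := rk_gt0 j.
have x0 : 0 <= x by have := le_trans (normc_ge0 _) (ha 0); rewrite pmulr_lge0// invr_gt0 exprn_gt0.
have y0 : 0 <= y by have := le_trans (normc_ge0 _) (hb 0); rewrite pmulr_lge0// invr_gt0 exprn_gt0.
have -> : 10 * (x * y) / rk k = 2 * (x * y / rk k) * 5 by ring.
apply: conv_sum_le rk3_inv_ge0 sum_rk3 _ _; first by rewrite divr_ge0 ?mulr_ge0// ltW.
move=> j; apply: (@le_trans _ _ ((x / rk j ^+ 2) * (y / rk (k - j) ^+ 2))).
  by rewrite ler_pM ?normc_ge0.
have := rkD k j; have p0 := w0 j; have r0 := w0 (k - j); have t0 := w0 k.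
set p := rk j in p0 *; set r := rk (k - j) in r0 *; set t := rk k in t0 * => ht.
have -> : x / p ^+ 2 * (y / r ^+ 2) = x * y / t * (t / (p ^+ 2 * r ^+ 2)).
  by field; rewrite !gt_eqF.
rewrite ler_wpM2l//; first by rewrite divr_ge0 ?mulr_ge0// ltW.
rewrite ler_pdivrMr ?mulr_gt0 ?exprn_gt0//.
apply: (le_trans ht).
have -> : ((p ^+ 3)^-1 + (r ^+ 3)^-1) * (p ^+ 2 * r ^+ 2) = (r ^+ 3 + p ^+ 3) / (p * r).
  by field; rewrite !gt_eqF.
rewrite ler_pdivlMr ?mulr_gt0//.
(* This is p^3 + r^3 - p r (p + r). *)
have : 0 <= (p - r) ^+ 2 * (p + r) by rewrite mulr_ge0 ?sqr_ge0 ?addr_ge0// ltW.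
nra.
Qed.

Lemma conv_rk3 (a b : int -> R[i]) (x y : R) k n :
  (forall j, normc (a j) <= x / rk j ^+ 3) -> (forall j, normc (b j) <= y / rk j ^+ 3) ->
  normc (\sum_(j <- box n) a j * b (k - j)) <= 40 * (x * y) / rk k ^+ 3.
Proof.
move=> ha hb; have w0 j := rk_gt0 j.
have x0 : 0 <= x by have := le_trans (normc_ge0 _) (ha 0); rewrite pmulr_lge0// invr_gt0 exprn_gt0.
have y0 : 0 <= y by have := le_trans (normc_ge0 _) (hb 0); rewrite pmulr_lge0// invr_gt0 exprn_gt0.
have -> : 40 * (x * y) / rk k ^+ 3 = 2 * (4 * (x * y) / rk k ^+ 3) * 5 by ring.
have t3 : 0 < rk k ^+ 3 by rewrite exprn_gt0.
apply: conv_sum_le rk3_inv_ge0 sum_rk3 _ _; first by rewrite divr_ge0 ?mulr_ge0// ltW.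
move=> j; apply: (@le_trans _ _ ((x / rk j ^+ 3) * (y / rk (k - j) ^+ 3))).
  by rewrite ler_pM ?normc_ge0.
have := rkD k j; have p0 := w0 j; have r0 := w0 (k - j); have t0 := w0 k.
set p := rk j in p0 *; set r := rk (k - j) in r0 *; set t := rk k in t0 t3 * => ht.
have -> : x / p ^+ 3 * (y / r ^+ 3) = 4 * (x * y) / t ^+ 3 * (t ^+ 3 / 4 / (p ^+ 3 * r ^+ 3)).
  by field; rewrite !gt_eqF.
rewrite ler_wpM2l//; first by rewrite divr_ge0 ?mulr_ge0// ltW.
rewrite ler_pdivrMr ?mulr_gt0 ?exprn_gt0//.
have -> : ((p ^+ 3)^-1 + (r ^+ 3)^-1) * (p ^+ 3 * r ^+ 3) = r ^+ 3 + p ^+ 3.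
  by field; rewrite !gt_eqF.
rewrite ler_pdivrMr//.
apply: (@le_trans _ _ ((p + r) ^+ 3)); first by rewrite lerXn2r// nnegrE ?addr_ge0// ltW.
(* Three times this is 4 (p^3 + r^3) - (p + r)^3. *)
have : 0 <= (p - r) ^+ 2 * (p + r) by rewrite mulr_ge0 ?sqr_ge0 ?addr_ge0// ltW.
nra.
Qed.

End Weights.

(** * Sobolev norms, and continuity in time of the coefficients of u^2 *)

Section Sobolev.
Variable R : realType.
Notation mu := (@lebesgue_measure R).
Implicit Types (k j : int) (l : R) (n : nat) (g h : R -> R) (u v : R -> R -> R).

Lemma Hnorm_leP l g (b : R) : 0 <= b ->
  (Hnorm l g <= b%:E)%E <-> sumle (fun k => wt l k * normc (fourier g k) ^+ 2) (b ^+ 2).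
Proof.
move=> b0; have F0 k : 0 <= wt l k * normc (fourier g k) ^+ 2.
  by rewrite mulr_ge0 ?wt_ge0 ?sqr_ge0.
have b2 : (0 <= (b ^+ 2)%:E)%E by rewrite lee_fin sqr_ge0.
rewrite -esum_leP// -(lee_sqrt _ b2).
by rewrite [sqrte (_ ^+ 2)%:E]/= sqrtr_sqr ger0_norm.
Qed.

Lemma Hnorm_ge0 l g : (0 <= Hnorm l g)%E.
Proof. exact: sqrte_ge0. Qed.

Lemma Hnorm_coef l g (b : R) k : 0 <= b -> (Hnorm l g <= b%:E)%E ->
  wt (l / 2) k * normc (fourier g k) <= b.
Proof.
move=> b0 /(Hnorm_leP _ _ b0) /(sumle1 k) h.
rewrite -(ler_sqr _ b0) ?nnegrE ?mulr_ge0 ?wt_ge0 ?normc_ge0// exprMn wt_half.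
by apply: h => j; rewrite mulr_ge0 ?wt_ge0 ?sqr_ge0.
Qed.

Lemma Hnorm_fin l g : (Hnorm l g < +oo)%E -> exists2 b : R, 0 <= b & (Hnorm l g <= b%:E)%E.
Proof.
move=> h; exists (fine (Hnorm l g)); first exact/fine_ge0/Hnorm_ge0.
by rewrite fineK// ge0_fin_numE// Hnorm_ge0.
Qed.

Lemma L2T_sqint g : L2T g -> sqint g.
Proof. by move=> [_ mg ig]; split. Qed.

Lemma Hper0_sqint l g : Hper0 l g -> sqint g.
Proof. by move=> [[/L2T_sqint]]. Qed.

Lemma fourier0 g : sqint g -> fourier g 0 = (mean g)%:C.
Proof.
move=> sg; apply: complex_eqP.
  by rewrite Re_fourier [RHS]/= /ccoef /mean; congr Rintegral; apply/funext => x; rewrite cosk0 mulr1.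
rewrite Im_fourier// [RHS]/= /scoef; have -> : (fun x => g x * sink 0 x) = fun=> 0.
  by apply/funext => x; rewrite sink0 mulr0.
by rewrite int01_cst oppr0.
Qed.

Lemma Hper0_fourier0 l g : Hper0 l g -> fourier g 0 = 0.
Proof. by move=> h; rewrite fourier0; [case: h => _ ->|exact: Hper0_sqint h]. Qed.

Lemma sumle_l2 l (a : int -> R[i]) B : 0 <= l ->
  sumle (fun k => wt l k * normc (a k) ^+ 2) B -> sumle (fun k => normc (a k) ^+ 2) B.
Proof.
by move=> l0; apply: le_sumle => k; rewrite ler_peMl ?sqr_ge0 ?wt_ge1.
Qed.

Lemma cvge0P (T : Type) (F : set_system T) (f : T -> \bar R) : Filter F ->
  (forall x, (0 <= f x)%E) ->
  (f @ F --> 0%E) <-> (forall e : R, 0 < e -> \forall x \near F, (f x <= e%:E)%E).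
Proof.
move=> FF f0; split=> [|h].
  move=> /fine_cvgP[fin /cvgrPdist_le cv] e e0.
  near=> x; have fx : f x \is a fin_num by near: x.
  rewrite -(fineK fx) lee_fin.
  have : `|0 - fine (f x)| <= e by near: x; exact: cv.
  by rewrite sub0r normrN ger0_norm// fine_ge0.
apply/fine_cvgP; split.
  apply: filterS (h 1 ltr01) => x hx.
  by rewrite ge0_fin_numE ?f0// (le_lt_trans hx) ?ltry.
apply/cvgrPdist_le => e e0; apply: filterS (h e e0) => x hx.
have fx : f x \is a fin_num by rewrite ge0_fin_numE ?f0// (le_lt_trans hx) ?ltry.
rewrite sub0r normrN ger0_norm ?fine_ge0 ?f0// /=.
by rewrite -lee_fin fineK.
Unshelve. all: by end_near. Qed.

Lemma continuous_HperP l u : continuous_Hper l u <->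
  forall t, 0 <= t -> forall e : R, 0 < e -> exists2 d : R, 0 < d &
    forall s, 0 <= s -> `|s - t| < d -> (Hnorm l (fun x => u s x - u t x)%R <= e%:E)%E.
Proof.
split=> h t t0.
  move=> e e0; have := h t t0; rewrite cvge0P; last by move=> s; exact: Hnorm_ge0.
  move=> /(_ e e0) [d /= d0 hd]; exists d => // s s0 st.
  apply: (hd s); first by rewrite /= distrC.
  by rewrite /= in_itv/= s0.
rewrite cvge0P; last by move=> s; exact: Hnorm_ge0.
move=> e e0; have [d d0 hd] := h t t0 e e0.
exists d => //= s /= st; rewrite in_itv/= andbT => s0.
by apply: hd => //; rewrite distrC.
Qed.

Definition l2dist u s t : R := int01 (fun x => (u s x - u t x) ^+ 2).

Lemma l2_continuous l u : 0 <= l -> (forall t, 0 <= t -> Hper0 l (u t)) ->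
  continuous_Hper l u ->
  forall t, 0 <= t -> forall e : R, 0 < e -> exists2 d : R, 0 < d &
    forall s, 0 <= s -> `|s - t| < d -> l2dist u s t <= e.
Proof.
move=> l0 hu /continuous_HperP cu t t0 e e0.
have [d d0 hd] := cu t t0 (Num.sqrt e) ltac:(by rewrite sqrtr_gt0).
exists d => // s s0 st; apply: parseval_le.
  by apply: sqintB; apply: Hper0_sqint; exact: hu.
have := hd s s0 st; rewrite Hnorm_leP ?sqrtr_ge0// sqr_sqrtr ?ltW//.
exact: sumle_l2.
Qed.

Lemma fourier_sqrB g h k : sqint g -> sqint h ->
  fourier (fun x => g x ^+ 2) k - fourier (fun x => h x ^+ 2) k =
  fourier (fun x => (g x + h x) * (g x - h x)) k.
Proof.
move=> sg sh; rewrite -fourierB_intg; [|exact: intg_sqr..].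
by congr fourier; apply/funext => x; ring.
Qed.

Lemma ccontP (F : R -> R[i]) :
  (forall t e : R, 0 < e -> exists2 d : R, 0 < d & forall s, `|s - t| < d -> normc (F s - F t) <= e) ->
  ccont F.
Proof.
move=> h; split=> t; apply/cvgrPdist_le => e e0; have [d d0 hd] := h t e e0;
  exists d => // s /= st.
  by rewrite distrC -ReB (le_trans (ler_Re _))// hd// distrC.
by rewrite distrC -ImB (le_trans (ler_Im _))// hd// distrC.
Qed.

(** Clamping the time at 0 extends the trajectory continuously to the whole line. The difference of
    two squares is a product, one factor of which is small in L^2. *)
Lemma ccont_fourier_sqr l u k : 0 <= l -> (forall t, 0 <= t -> Hper0 l (u t)) ->
  continuous_Hper l u -> ccont (fun s => fourier (fun x => u (Num.max s 0) x ^+ 2) k).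
Proof.
move=> l0 hu cu; apply: ccontP => t e e0.
pose p s : R := Num.max s 0; have p0 s : 0 <= p s by rewrite /p le_max lexx orbT.
have pd s : `|p s - p t| <= `|s - t|.
  rewrite /p; have [h1|h1] := leP s 0; have [h2|h2] := leP t 0; rewrite ?subrr ?normr0//.
  - by have := ler_norm (- (s - t)); rewrite sub0r !normrN (gtr0_norm h2); lra.
  - by have := ler_norm (s - t); rewrite subr0 (gtr0_norm h1); lra.
have sq s : sqint (u (p s)) by apply: Hper0_sqint (hu _ (p0 s)).
pose M := int01 (fun x => u (p t) x ^+ 2).
have M0 : 0 <= M by apply: int01_ge0 => x; exact: sqr_ge0.
(* 8 M + 2 bounds the squared L^2 norm of the sum u(s) + u(t) as soon as [l2dist] is at most 1; c
   then makes its contribution at most e / 4. *)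
pose c := (4 * (8 * M + 2)) / e; have c0 : 0 < c.
  by rewrite divr_gt0// mulr_gt0// ltr_pwDr// mulr_ge0.
pose eta := Num.min 1 (e / 4 / c); have eta0 : 0 < eta.
  by rewrite lt_min ltr01 andTb; do 2 apply: divr_gt0 => //.
have [d d0 hd] := l2_continuous l0 hu cu (p0 t) eta0.
exists d => // s st; rewrite -/(p s) -/(p t) fourier_sqrB//.
have {}hd := hd _ (p0 s) (le_lt_trans (pd s) st).
under eq_fun do rewrite mulrC.
apply: (le_trans (normc_fourier_mul k c0 (sqintB (sq s) (sq t)) (sqintD (sq s) (sq t)))).
rewrite -/(l2dist u (p s) (p t)).
have h1 : c * l2dist u (p s) (p t) <= e / 4.
  rewrite mulrC -ler_pdivlMr// (le_trans hd)// /eta ge_min.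
  by rewrite lexx orbT.
have h2 : int01 (fun x => (u (p s) x + u (p t) x) ^+ 2) <= 8 * M + 2.
  have -> : (fun x => (u (p s) x + u (p t) x) ^+ 2) = (fun x => ((u (p s) x - u (p t) x) + 2 * u (p t) x) ^+ 2).
    by apply/funext => x; ring.
  apply: (le_trans (int01_sqD_le (sqintB (sq s) (sq t)) (sqintZ 2 (sq t)))).
  have -> : int01 (fun x => (2 * u (p t) x) ^+ 2) = 4 * M.
    rewrite /M -int01Z; last by case: (sq t).
    by congr int01; apply/funext => x; ring.
  rewrite -/(l2dist u (p s) (p t)); have : l2dist u (p s) (p t) <= 1.
    by rewrite (le_trans hd)// /eta ge_min lexx.
  lra.
have h3 : c^-1 * int01 (fun x => (u (p s) x + u (p t) x) ^+ 2) <= e / 4.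
  rewrite /c invf_div mulrAC ler_pdivrMr ?mulr_gt0 ?ltr_pwDr ?mulr_ge0//.
  have := e0; nra.
lra.
Qed.

End Sobolev.

(** * Fourier modes of mild solutions *)

Section Forcing.
Variable R : realType.
Notation mu := (@lebesgue_measure R).
Implicit Types (k j : int) (l : R) (n : nat) (g h : R -> R) (u v : R -> R -> R).

Lemma conjcE (z : R[i]) : conjc z = (Re z) +i* (- Im z).
Proof. by case: z. Qed.

Lemma fourierN (g : R -> R) k : sqint g -> fourier g (- k) = conjc (fourier g k).
Proof.
move=> sg; apply: complex_eqP; rewrite conjcE.
  by rewrite -[RHS]/(Re (fourier g k)) !Re_fourier ccoefN.
by rewrite -[RHS]/(- Im (fourier g k)) !Im_fourier// scoefN.
Qed.

Let aeF := ae_filter_ringOfSetsType mu.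

(** No regularity of [val] is needed: a simple function has finitely many values with measurable
    level sets, so every preimage is a finite union of these. *)
Lemma simple_measurable (s : R -> R -> R) (N : set R) (val : (R -> R) -> R) :
  finite_set (s @` `[0, +oo[) -> (forall g, measurable [set t | 0 <= t /\ s t = g]) ->
  measurable N ->
  measurable_fun [set: R] (fun t => if (0 <= t) && (t \notin N) then val (s t) else 0).
Proof.
move=> fs ms mN _ Y mY; rewrite setTI.
have mNc : measurable (~` N) by exact: measurableC.
rewrite [X in measurable X](_ : _ =
   (\bigcup_(g in (s @` `[0, +oo[) `&` [set g | Y (val g)]) ([set t | 0 <= t /\ s t = g] `&` ~` N))
   `|` ([set _ | Y 0] `&` (~` `[0, +oo[ `|` N))).
  apply: measurableU.
    apply: fin_bigcup_measurable; first exact: finite_setIl.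
    by move=> g _; exact: measurableI.
  apply: measurableI.
    have [Y0|Y0] := pselect (Y 0).
      by rewrite [X in measurable X](_ : _ = setT) //; apply/seteqP; split.
    by rewrite [X in measurable X](_ : _ = set0) //; apply/seteqP; split.
  by apply: measurableU => //; apply: measurableC; exact: measurable_itv.
apply/seteqP; split => t /=.
  have [t0|t0] := leP 0 t => /=; last first.
    by move=> Y0; right; split => //; left; rewrite in_itv/= andbT; apply/negP; rewrite -ltNge.
  have [tN|tN] := boolP (t \in N) => /= Yt.
    by right; split => //; right; rewrite -in_setE.
  left; exists (s t); first by split => //; exists t => //=; rewrite in_itv/= t0.
  by split => //; move: tN; rewrite notin_setE.
move=> [[g [_ Yg] [[t0 stg] tN]]|[Y0 [t0|tN]]].
- by rewrite t0 memNset//= stg.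
- by case: (leP 0 t) t0 => //= t0; rewrite in_itv/= t0.
- by rewrite mem_set//= andbF.
Qed.

(** A representative of the forcing on the Fourier side, set to 0 on a null set and at negative
    times, so that measurability, size, conjugate symmetry and zero mean hold at every time. Its
    coefficients are pointwise limits of those of simple functions. *)
Lemma forcing_version l f (D : R) : 0 <= D -> Linf l f -> (Linf_norm l f <= D%:E)%E ->
  exists F : int -> R -> R[i],
  [/\ forall k, measurable_fun [set: R] (fun s => Re (F k s)) /\
                measurable_fun [set: R] (fun s => Im (F k s)),
      forall k s, normc (F k s) <= D / wt (l / 2) k,
      forall k s, F (- k) s = conjc (F k s),
      forall s, F 0 s = 0 &
      {ae mu, forall s, 0 <= s -> forall k, fourier (f s) k = F k s}].
Proof.
move=> D0 [hf [s [hs fs ms cs]] _] /ess_supP hD.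
pose P t := 0 <= t -> [/\ Hper0 l (f t), Hnorm l (s n t \- f t) @[n --> \oo] --> 0%E &
  (Hnorm l (f t) <= D%:E)%E].
have [N [mN N0 PN]] : {ae mu, forall t, P t}.
  apply: (@filterS3 _ _ aeF _ _ _ _ _ hf cs hD) => t h1 h2 h3 t0; split.
  - exact: h1.
  - exact: h2.
  - by move: h3; rewrite patchE mem_set//= in_itv/= t0.
have {}PN t : 0 <= t -> t \notin N -> [/\ Hper0 l (f t), Hnorm l (s n t \- f t) @[n --> \oo] --> 0%E &
  (Hnorm l (f t) <= D%:E)%E].
  move=> t0; rewrite notin_setE => tN; apply: contrapT => h; apply: tN; apply: PN => /= Pt.
  exact/h/Pt.
pose F k t := if (0 <= t) && (t \notin N) then fourier (f t) k else 0.
have cvF k t : 0 <= t -> t \notin N -> forall e : R, 0 < e ->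
    \forall n \near \oo, normc (fourier (s n t) k - fourier (f t) k) <= e.
  move=> t0 tN e e0; have [hft ct _] := PN t t0 tN.
  have h := (cvge0P eventually_filter (fun n => Hnorm_ge0 l (s n t \- f t))).1 ct.
  have we : 0 < e * wt (l / 2) k by rewrite mulr_gt0 ?wt_gt0.
  have := h _ we; apply: filterS => n /Hnorm_coef => /(_ k (ltW we)).
  rewrite mulrC ler_pM2r ?wt_gt0//.
  have := fourierB k (Hper0_sqint (hs n t t0)) (Hper0_sqint hft).
  by move=> <-.
have mF (val : (R -> R) -> R) : (forall t, 0 <= t -> t \notin N -> val (s n t) @[n --> \oo] --> val (f t)) ->
    measurable_fun [set: R] (fun t => if (0 <= t) && (t \notin N) then val (f t) else 0).
  move=> cv; apply: (@measurable_fun_cvg _ (measurableTypeR R) _ setT (fun n t => if (0 <= t) && (t \notin N) then val (s n t) else 0)).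
    by move=> n; apply: simple_measurable.
  move=> t _; case: ifP => [/andP[t0 tN]|_]; last exact: cvg_cst.
  exact: cv.
exists F; split.
- move=> k; split.
    have := mF (fun g => Re (fourier g k)); rewrite /F.
    have -> : (fun t => Re (if (0 <= t) && (t \notin N) then fourier (f t) k else 0)) =
      (fun t => if (0 <= t) && (t \notin N) then Re (fourier (f t) k) else 0).
      by apply/funext => t; case: ifP.
    apply => t t0 tN; apply/cvgrPdist_le => e e0; apply: filterS (cvF k t t0 tN e e0) => n hn.
    by rewrite distrC -ReB (le_trans (ler_Re _)).
  have := mF (fun g => Im (fourier g k)); rewrite /F.
  have -> : (fun t => Im (if (0 <= t) && (t \notin N) then fourier (f t) k else 0)) =
    (fun t => if (0 <= t) && (t \notin N) then Im (fourier (f t) k) else 0).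
    by apply/funext => t; case: ifP.
  apply => t t0 tN; apply/cvgrPdist_le => e e0; apply: filterS (cvF k t t0 tN e e0) => n hn.
  by rewrite distrC -ImB (le_trans (ler_Im _)).
- move=> k t; rewrite /F; case: ifP => [/andP[t0 tN]|_]; last first.
    by rewrite normc0 divr_ge0// wt_ge0.
  have [_ _ h] := PN t t0 tN.
  by rewrite ler_pdivlMr ?wt_gt0// mulrC; exact: Hnorm_coef h.
- move=> k t; rewrite /F; case: ifP => [/andP[t0 tN]|_]; last by rewrite conjcE oppr0.
  by have [ft _ _] := PN t t0 tN; rewrite (fourierN _ (Hper0_sqint ft)).
- move=> t; rewrite /F; case: ifP => // /andP[t0 tN].
  by have [ft _ _] := PN t t0 tN; exact: Hper0_fourier0 ft.
- exists N; split => // t /= h; apply: contrapT => tN; apply: h => t0 k.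
  by rewrite /F t0 memNset.
Qed.

End Forcing.

(** * The Duhamel formula and differential equation of each mode *)

Section MildSolution.
Variables (R : realType) (l beta gamma : R).
Hypothesis l0 : 0 <= l.
Notation mu := (@lebesgue_measure R).
Implicit Types (k j : int) (n : nat) (u v : R -> R -> R).

Local Notation br := (br R).
Local Notation A := (Asymbol beta gamma).

Lemma Re_Asymbol k : Re (A k) = - (beta + gamma * freq k ^+ 2) / br k.
Proof. by rewrite /Asymbol /Aop /resolvent /Dx /br /=; ring. Qed.

Lemma Im_Asymbol k : Im (A k) = - freq k / br k.
Proof. by rewrite /Asymbol /Aop /resolvent /Dx /br /=; ring. Qed.

Definition burgers u k s : R[i] :=
  ((br k)^-1)%:C * convection (u (Num.max s 0)) k.

Lemma ccont_cstM (z : R[i]) (F : R -> R[i]) : ccont F -> ccont (fun s => z * F s).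
Proof.
move=> cF; apply: ccontM => //.
by split=> t; exact: cvg_cst.
Qed.

Lemma ccont_burgers u k : (forall t, 0 <= t -> Hper0 l (u t)) ->
  continuous_Hper l u -> ccont (burgers u k).
Proof.
move=> hu cu; apply: ccont_cstM; apply: ccont_cstM; apply: ccont_cstM.
exact: ccont_fourier_sqr cu.
Qed.

Lemma mild_integral f (F : int -> R -> R[i]) u k t :
  (forall t, 0 <= t -> Hper0 l (u t)) -> continuous_Hper l u ->
  lbm (F k) -> {ae mu, forall s, 0 <= s -> forall k, fourier (f s) k = F k s} ->
  cintegral `[0, t] (fun s => semigroup beta gamma (t - s)
              (resolvent (fun j => fourier (f s) j - convection (u s) j)) k) =
  cintegral `[0, t] (fun s => cexp ((t - s)%:C * A k) * (((br k)^-1)%:C * F k s - burgers u k s)).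
Proof.
move=> hu cu hF ae; apply: cintegral_ae_congr.
apply: (@filterS _ _ (ae_filter_ringOfSetsType mu) _ _ _ ae) => s h /=.
rewrite in_itv/= => /andP[s0 _]; rewrite /semigroup /resolvent /burgers h//.
by rewrite (max_idPl s0) mulrBr.
Qed.

Lemma mild_solution_duhamel f (F : int -> R -> R[i]) u :
  (forall k, lbm (F k)) -> {ae mu, forall s, 0 <= s -> forall k, fourier (f s) k = F k s} ->
  mild_solution l beta gamma f u ->
  forall t, 0 <= t -> forall k, fourier (u t) k =
    duhamel (A k) (fourier (u 0) k) (fun s => ((br k)^-1)%:C * F k s - burgers u k s) t.
Proof.
move=> hF ae [hu cu eq] t t0 k.
rewrite eq// duhamelE; last first.
  by apply: lbmB; [apply: lbmM => //; exact: lbm_cst|exact/ccont_lbm/ccont_burgers].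
by rewrite (mild_integral _ hu cu (hF k) ae).
Qed.

Lemma duhamelB (a w z : R[i]) g h t : lbm g -> lbm h ->
  duhamel a w g t - duhamel a z h t = duhamel a (w - z) (fun s => g s - h s) t.
Proof.
move=> hg hh; rewrite /duhamel -mulrBr; congr (_ * _).
rewrite [X in _ = _ + X](_ : _ = cintegral `[0, t] (fun s => cexp ((- s)%:C * a) * g s - cexp ((- s)%:C * a) * h s)).
  rewrite cintegralB; [ring|by apply: lbmM => //; exact: lbm_cexpN..].
by congr cintegral; apply/funext => s; rewrite mulrBr.
Qed.

(* The forcing cancels in the difference of two solutions, whose modes are
   therefore differentiable in time. *)
Lemma mild_difference_ode f u v : Linf l f -> mild_solution l beta gamma f u ->
  mild_solution l beta gamma f v -> forall k,
  exists2 W : R -> R[i],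
    (forall t, 0 <= t -> W t = fourier (fun x => u t x - v t x) k) &
    (forall t, 0 <= t -> cderiv W t (A k * W t -
      ((br k)^-1)%:C * ((2^-1)%:C * ((0 +i* freq k) *
       fourier (fun x => (v t x + u t x) * (u t x - v t x)) k)))).
Proof.
move=> hf hu hv k.
have [D D0 hD] : exists2 D : R, 0 <= D & (Linf_norm l f <= D%:E)%E.
  case: hf => _ _; case: (Linf_norm l f) => [r|//|] _.
    by exists `|r| => //; rewrite lee_fin ler_norm.
  by exists 0 => //; exact: leNye.
have [F [mF bF _ _ aeF]] := forcing_version D0 hf hD.
have lF j : lbm (F j).
  by have [m1 m2] := mF j; split => // T; exists (D / wt (l / 2) j) => s _.
have [uh uc _] := hu; have [vh vc _] := hv.
pose g s := burgers v k s - burgers u k s.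
have cg : ccont g.
  have h : ccont (fun s => burgers v k s + (-1) * burgers u k s).
    have [a1 a2] := ccont_burgers k vh vc; have [b1 b2] := ccont_cstM (-1) (ccont_burgers k uh uc).
    by split=> s; under eq_fun do rewrite ?ReD ?ImD; apply: cvgD; [exact: a1|exact: b1|exact: a2|exact: b2].
  by move: h; rewrite /g; under [X in ccont X -> _]eq_fun do rewrite mulN1r.
have [W hW dW] := duhamel_ode (A k) (fourier (u 0) k - fourier (v 0) k) cg.
have WE t : 0 <= t -> W t = fourier (fun x => u t x - v t x) k.
  move=> t0; rewrite hW// fourierB; [|exact: Hper0_sqint (uh _ t0)|exact: Hper0_sqint (vh _ t0)].
  rewrite (mild_solution_duhamel lF aeF hu t0 k) (mild_solution_duhamel lF aeF hv t0 k).
  have lb (z : R -> R -> R) : (forall t, 0 <= t -> Hper0 l (z t)) -> continuous_Hper l z ->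
      lbm (fun s => ((br k)^-1)%:C * F k s - burgers z k s).
    by move=> zh zc; apply: lbmB; [apply: lbmM => //; exact: lbm_cst|exact/ccont_lbm/ccont_burgers].
  rewrite duhamelB; [|exact: lb..].
  congr duhamel; apply/funext => s.
  by rewrite /g; ring.
exists W => // t t0; apply: cderiv_eq (dW t t0) _; congr (_ + _).
have su := Hper0_sqint (uh _ t0); have sv := Hper0_sqint (vh _ t0).
rewrite /g /burgers /convection /Dx (max_idPl t0).
have -> : (fun x => (v t x + u t x) * (u t x - v t x)) = (fun x => (u t x + v t x) * (u t x - v t x)).
  by apply/funext => x; rewrite [v t x + _]addrC.
by rewrite -fourier_sqrB//; ring.
Qed.

End MildSolution.

(** * Trigonometric polynomials with prescribed coefficients *)

Section TrigPoly.
Variable R : realType.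
Implicit Types (f g h : R -> R) (k j : int) (n : nat) (a b : int -> R).

Definition tpoly a b n : R -> R :=
  fun x => \sum_(k <- box n) (a k * cosk k x + b k * sink k x).

Lemma trig_tpoly a b n : trig (tpoly a b n).
Proof.
by apply: trig_sum => k; apply: trigD; apply: trigZ; [exact: trig_cosk|exact: trig_sink].
Qed.

Lemma sqint_tpoly a b n : sqint (tpoly a b n).
Proof. exact/sqint_trig/trig_tpoly. Qed.

Lemma int01_tpoly a b f n : intg f ->
  int01 (fun x => tpoly a b n x * f x) =
  \sum_(k <- box n) (a k * ccoef f k + b k * scoef f k).
Proof.
move=> sf; have -> : (fun x => tpoly a b n x * f x) =
    (fun x => \sum_(k <- box n) (a k * (f x * cosk k x) + b k * (f x * sink k x))).
  by apply/funext => x; rewrite /tpoly mulr_suml; apply: eq_bigr => k _; ring.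
have ic k : itg (fun x => f x * cosk k x).
  by apply: intgM_bounded sf _ (cosk_max k); exact: measurable_cosk.
have iss k : itg (fun x => f x * sink k x).
  by apply: intgM_bounded sf _ (sink_max k); exact: measurable_sink.
rewrite int01_sum; last by move=> k; apply: itgD; exact: itgZ.
by apply: eq_bigr => k _; rewrite int01D ?int01Z//; exact: itgZ.
Qed.

Lemma int01_tpoly_sqr a b n : (forall k, a (- k) = a k) -> (forall k, b (- k) = - b k) ->
  int01 (fun x => tpoly a b n x ^+ 2) = \sum_(k <- box n) (a k ^+ 2 + b k ^+ 2).
Proof.
move=> ha hb; under eq_fun do rewrite expr2.
rewrite int01_tpoly; last exact/sqint_intg/sqint_tpoly.
rewrite big_seq [RHS]big_seq; apply: eq_bigr => j; rewrite mem_box => jn.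
have -> : ccoef (tpoly a b n) j = a j.
  rewrite /ccoef int01_tpoly; last exact/sqint_intg/sqint_cosk.
  under eq_bigr do rewrite ccoef_cosk scoef_cosk mulr0 addr0 mulrA mulrDr mulrDl ![_ * _ / 2]mulrAC.
  by rewrite big_split/= !(@sum_box_delta _ _ (fun k => a k / 2)) ?abszN// ha; field.
have -> : scoef (tpoly a b n) j = b j.
  rewrite /scoef int01_tpoly; last exact/sqint_intg/sqint_sink.
  under eq_bigr do rewrite ccoef_sink scoef_sink mulr0 add0r mulrA mulrBr mulrBl ![_ * _ / 2]mulrAC.
  by rewrite sumrB/= !(@sum_box_delta _ _ (fun k => b k / 2)) ?abszN// hb; field.
by rewrite !expr2.
Qed.

Lemma is_derive_tpoly a b n (x : R) : is_derive x 1 (tpoly a b n)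
  (tpoly (fun k => freq k * b k) (fun k => - freq k * a k) n x).
Proof.
apply: isd_sum => k; apply: isd_eq (isdD (isdZ (a k) (is_derive_cosk k x)) (isdZ (b k) (is_derive_sink k x))) _.
by ring.
Qed.

(* The cubic term of the energy balance is an exact derivative. *)
Lemma int01_cubic a b n :
  int01 (fun x => tpoly (fun k => freq k * b k) (fun k => - freq k * a k) n x * tpoly a b n x ^+ 2) = 0.
Proof.
set p := tpoly a b n; set p' := tpoly _ _ n.
have dp (x : R) : is_derive x 1 p (p' x) by exact: is_derive_tpoly.
have dF (x : R) : is_derive x 1 (fun y => 3^-1 * (p y * (p y * p y))) (p' x * p x ^+ 2).
  apply: isd_eq (isdZ _ (isdM (dp x) (isdM (dp x) (dp x)))) _.
  by field.
have cF : continuous (fun x => p' x * p x ^+ 2).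
  have -> : (fun x => p' x * p x ^+ 2) = (fun x => p' x * (p x * p x)).
    by apply/funext => x; rewrite expr2.
  by move=> x; exact: isd_cont (isdM (is_derive_tpoly _ _ n x) (isdM (dp x) (dp x))).
rewrite (FTC01 dF cF).
have -> : p 1 = p 0; last by rewrite subrr.
rewrite /p /tpoly; apply: eq_bigr => k _.
by rewrite -[1]add0r cosk_periodic sink_periodic.
Qed.

Lemma tpoly_bounded a b n x :
  `|tpoly a b n x| <= \sum_(k <- box n) (`|a k| + `|b k|).
Proof.
rewrite (le_trans (ler_norm_sum _ _ _))//; apply: ler_sum => j _.
by rewrite (le_trans (ler_normD _ _))// lerD// normrM ler_piMr//; [exact: cosk_max|exact: sink_max].
Qed.

End TrigPoly.

(** * Maxima of time-periodic functions *)

Section TimePeriodic.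
Variable R : realType.
Notation mu := (@lebesgue_measure R).
Implicit Types (k : int) (u v : R -> R -> R) (theta : R).

Lemma aeeq_fourier (g h : R -> R) k : aeeq g h -> fourier g k = fourier h k.
Proof.
move=> gh; apply: cintegral_ae_congr.
by apply: (@filterS _ _ (ae_filter_ringOfSetsType mu) _ _ _ gh) => x e _; rewrite e.
Qed.

Lemma aeeq_int01_sqr (g h : R -> R) : aeeq g h ->
  int01 (fun x => g x ^+ 2) = int01 (fun x => h x ^+ 2).
Proof.
move=> gh; apply: Rintegral_ae_congr.
by apply: (@filterS _ _ (ae_filter_ringOfSetsType mu) _ _ _ gh) => x e _; rewrite e.
Qed.

Lemma periodic_reduce theta (phi : R -> R) : 0 < theta ->
  (forall t, 0 <= t -> phi (t + theta) = phi t) ->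
  forall t, 0 <= t -> exists2 r, 0 <= r <= theta & phi t = phi r.
Proof.
move=> th0 per t t0; pose n := Num.truncn (t / theta).
have td : 0 <= t / theta by rewrite divr_ge0// ltW.
have /andP[n1 n2] : n%:R <= t / theta < n.+1%:R by exact: truncn_itv.
have mult (m : nat) r : 0 <= r -> phi (r + theta *+ m) = phi r.
  move=> r0; elim: m => [|m ih]; first by rewrite mulr0n addr0.
  by rewrite mulrSr addrA per ?ih// addr_ge0// mulrn_wge0// ltW.
exists (t - theta *+ n); last first.
  rewrite -[in LHS](subrK (theta *+ n) t) mult// subr_ge0 -mulr_natl.
  by rewrite -ler_pdivlMr.
rewrite subr_ge0 -mulr_natl -ler_pdivlMr// n1 /= lerBlDr.
move: n2; rewrite ltr_pdivrMr// -natr1 mulrDl mul1r => /ltW.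
by rewrite addrC.
Qed.

(** The maximum over one period may be attained at time 0, which is a boundary point; one period
    later it is interior, and the derivative vanishes there. *)
Lemma periodic_max theta (phi dphi : R -> R) : 0 < theta ->
  (forall t : R, 0 <= t -> is_derive t 1 phi (dphi t)) ->
  (forall t, 0 <= t -> phi (t + theta) = phi t) ->
  exists t, [/\ 0 <= t, forall s, 0 <= s -> phi s <= phi t & dphi t = 0].
Proof.
move=> th0 dp per.
have cont : {within `[0, theta], continuous phi}.
  apply: continuous_in_subspaceT => t; rewrite inE/= in_itv/= => /andP[t0 _].
  exact: isd_cont (dp t t0).
have [c] := EVT_max (ltW th0) cont; rewrite in_itv/= => /andP[c0 cth] hc.
have hmax s : 0 <= s -> phi s <= phi (c + theta).
  move=> s0; have [r r0 ->] := periodic_reduce th0 per s0.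
  by rewrite per//; apply: hc; rewrite in_itv.
have ct0 : 0 < c + theta by rewrite ltr_wpDl.
exists (c + theta); split => //; first exact: ltW.
have h0 : is_derive (c + theta) 1 phi 0.
  apply: (@derive1_at_max _ phi 0 (3 * theta)).
  - by rewrite mulr_ge0// ltW.
  - move=> t; rewrite in_itv/= => /andP[/ltW t0 _].
    by have h := dp t t0; exact: ex_derive.
  - rewrite in_itv/= ct0/=; lra.
  - by move=> t; rewrite in_itv/= => /andP[/ltW t0 _]; exact: hmax.
have h1 := dp _ (ltW ct0).
by rewrite -(@derive_val _ _ _ _ _ _ _ h1) (@derive_val _ _ _ _ _ _ _ h0).
Qed.

Lemma l2_bounded l theta u : 0 <= l -> 0 < theta -> (forall t, 0 <= t -> Hper0 l (u t)) ->
  continuous_Hper l u -> time_periodic theta u ->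
  exists2 M : R, 0 <= M & forall t, 0 <= t -> int01 (fun x => u t x ^+ 2) <= M.
Proof.
move=> l0 th0 hu cu per; have [c1 _] := ccont_fourier_sqr 0 l0 hu cu.
(* The mode 0 of u^2 is the squared L^2 norm of u, so the continuity of coefficients of squares
   applies to it. *)
have e t : 0 <= t -> Re (fourier (fun x => u (Num.max t 0) x ^+ 2) 0) = int01 (fun x => u t x ^+ 2).
  move=> t0; rewrite (max_idPl t0) Re_fourier /ccoef.
  by congr int01; apply/funext => x; rewrite cosk0 mulr1.
have [c _ hc] := EVT_max (ltW th0) (continuous_subspaceT c1).
pose phi t := int01 (fun x => u t x ^+ 2).
exists (`|Re (fourier (fun x => u (Num.max c 0) x ^+ 2) 0)|) => // t t0.
have perphi s : 0 <= s -> phi (s + theta) = phi s.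
  by move=> s0; apply: aeeq_int01_sqr; exact: per.
have [r r0 hr] := periodic_reduce th0 perphi t0; rewrite -/(phi t) hr.
have /andP[r0' _] := r0.
by rewrite /phi -e// (le_trans _ (ler_norm _))// hc// in_itv.
Qed.

End TimePeriodic.

(** * Uniqueness *)

Section Coercive.
Variables (R : realType) (beta gamma : R).
Local Notation br := (br R).

Definition coercive (c0 : R) := 0 < c0 /\
  forall k : int, k != 0 -> c0 * br k <= beta + gamma * freq k ^+ 2.

(** On nonzero modes freq^2 >= 4 pi^2, and the condition on gamma makes beta + 4 pi^2 gamma
    positive. The ratio of dissipation to [br] equals d / (1 + P) at k = 1 and -1 and tends to gamma
    at high frequency; the smaller of the two values is a lower bound. *)
Lemma coercive_exists : Num.max 0 (- (beta / (4 * pi ^+ 2))) < gamma ->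
  exists c0, coercive c0.
Proof.
rewrite gt_max => /andP[g0]; have p0 : 0 < 4 * pi ^+ 2 :> R.
  by rewrite mulr_gt0// exprn_gt0// pi_gt0.
rewrite ltrNl ltr_pdivlMr// mulNr => hg.
pose P : R := 4 * pi ^+ 2; pose d := beta + gamma * P.
have d0 : 0 < d by rewrite /d /P; move: hg; lra.
have P1 : 0 < 1 + P by rewrite addr_gt0.
exists (Num.min gamma (d / (1 + P))); split.
  by rewrite lt_min g0 divr_gt0.
move=> k k0; have hf : P <= freq k ^+ 2.
  rewrite /freq exprMn exprMn /P -natrX ler_peMr ?(ltW p0)//.
  rewrite -real_normK ?num_real// expr_ge1//.
  by rewrite -intr_norm -natr_absz ler1n; lia.
set c := Num.min _ _; have c1 : c <= gamma by rewrite /c ge_min lexx.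
have c2 : c * (1 + P) <= d by rewrite -ler_pdivlMr// /c ge_min lexx orbT.
rewrite /br; have : 0 <= (gamma - c) * (freq k ^+ 2 - P) by rewrite mulr_ge0 ?subr_ge0.
by move: c2; rewrite /d; nra.
Qed.

End Coercive.

(** * Energy balance of one mode *)

Section ModeEnergy.
Variables (R : realType) (beta gamma c0 : R).
Hypothesis hc : coercive beta gamma c0.
Local Notation br := (br R).
Local Notation rk := (rk R).
Let c0_gt0 : 0 < c0. Proof. by case: hc. Qed.
Local Notation A := (Asymbol beta gamma).

Definition mode_rhs (k : int) (W H : R[i]) : R[i] :=
  A k * W - ((br k)^-1)%:C * ((2^-1)%:C * ((0 +i* freq k) * H)).

Definition ipc (z w : R[i]) : R := Re z * Re w + Im z * Im w.

Lemma ler_ipc z w : `|ipc z w| <= normc z * normc w.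
Proof.
have h0 : 0 <= normc z * normc w by rewrite mulr_ge0 ?normc_ge0.
rewrite -(ler_sqr (normr_ge0 _) h0) real_normK ?num_real// exprMn !sqr_normcE /ipc.
by have := sqr_ge0 (Re z * Im w - Im z * Re w); nra.
Qed.

Lemma is_derive_sqr_normc (W : R -> R[i]) t D : cderiv W t D ->
  is_derive t 1 (fun s => normc (W s) ^+ 2) (2 * ipc (W t) D).
Proof.
move=> [h1 h2].
have -> : (fun s => normc (W s) ^+ 2) = (fun s => Re (W s) * Re (W s) + Im (W s) * Im (W s)).
  by apply/funext => s; rewrite sqr_normcE !expr2.
by apply: isd_eq (isdD (isdM h1 h1) (isdM h2 h2)) _; rewrite /ipc; ring.
Qed.

Lemma ipc_mode_rhs k W H : ipc W (mode_rhs k W H) =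
  (- (beta + gamma * freq k ^+ 2) * normc W ^+ 2 -
   freq k / 2 * (Im W * Re H - Re W * Im H)) / br k.
Proof.
have b0 : br k != 0 by rewrite gt_eqF ?br_gt0.
rewrite /ipc /mode_rhs sqr_normcE ReB ImB.
have hR := Re_Asymbol beta gamma k; have hI := Im_Asymbol beta gamma k.
move: (A k) hR hI => a hR hI; rewrite !ReM !ImM hR hI /=.
by field.
Qed.

(** Where |W|^2 is critical, the dissipation, at least c0 br |W|^2, equals a flux of size at most
    |freq| / 2 times |W| |H|. Dividing by |W|, the quotient |freq| / br yields two powers of
    [rk]. *)
Lemma mode_max k W H : k != 0 -> ipc W (mode_rhs k W H) = 0 ->
  normc W <= normc H / (c0 * rk k ^+ 2).
Proof.
move=> k0; have [_ /(_ k k0) hk] := hc.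
have b0 := br_gt0 R k; have rk0 := rk_gt0 R k; have r0 : 0 < rk k ^+ 2 by rewrite exprn_gt0.
rewrite ipc_mode_rhs => /eqP; rewrite mulf_eq0 invr_eq0 (gt_eqF b0) orbF => /eqP h.
have [->|W0] := eqVneq (normc W) 0.
  by rewrite divr_ge0 ?normc_ge0// mulr_ge0// ltW.
have Wp : 0 < normc W by rewrite lt_neqAle eq_sym W0 normc_ge0.
have h1 : c0 * br k * normc W <= `|freq k| / 2 * normc H.
  rewrite -(ler_pM2r Wp); have -> : c0 * br k * normc W * normc W = c0 * br k * normc W ^+ 2 by ring.
  apply: (@le_trans _ _ ((beta + gamma * freq k ^+ 2) * normc W ^+ 2)).
    by rewrite ler_wpM2r ?sqr_ge0.
  have -> : (beta + gamma * freq k ^+ 2) * normc W ^+ 2 = - (freq k / 2 * (Im W * Re H - Re W * Im H)).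
    by move: h; lra.
  rewrite (le_trans (ler_norm _))// normrN normrM normrM.
  rewrite [`|2^-1|]ger0_norm ?invr_ge0//.
  have -> : `|freq k| / 2 * normc H * normc W = `|freq k| / 2 * (normc H * normc W) by ring.
  apply: ler_wpM2l; first by rewrite mulr_ge0 ?invr_ge0.
  (* The flux is the inner product of W with i H. *)
  have -> : Im W * Re H - Re W * Im H = ipc W ((- Im H) +i* Re H) by rewrite /ipc /=; ring.
  rewrite (le_trans (ler_ipc _ _))// mulrC ler_wpM2r ?normc_ge0//.
  rewrite -(ler_sqr (normc_ge0 _) (normc_ge0 _)) !sqr_normcE /= sqrrN; lra.
rewrite ler_pdivlMr ?mulr_gt0//.
have h2 := rk2_freq_le_br R k.
have H0 := normc_ge0 H.
rewrite -(ler_pM2l b0) mulrA.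
have -> : br k * normc W * (c0 * rk k ^+ 2) = c0 * br k * normc W * rk k ^+ 2 by ring.
apply: (@le_trans _ _ (`|freq k| / 2 * normc H * rk k ^+ 2)); first by rewrite ler_pM2r.
have -> : `|freq k| / 2 * normc H * rk k ^+ 2 = (rk k ^+ 2 * `|freq k|) / 2 * normc H by ring.
by rewrite ler_wpM2r// ler_pdivrMr// [leRHS]mulrC.
Qed.

End ModeEnergy.

(** * A small periodic solution against an arbitrary one *)

Section Uniqueness.
Variables (R : realType) (l beta gamma c0 theta : R).
Hypotheses (l0 : 0 <= l) (hc : coercive beta gamma c0) (th0 : 0 < theta).
Variables (f ut v : R -> R -> R) (x m : R).
Hypotheses (hf : Linf l f) (hut : mild_solution l beta gamma f ut)
  (hv : mild_solution l beta gamma f v)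
  (put : time_periodic theta ut) (pv : time_periodic theta v)
  (but : forall t, 0 <= t -> forall k, normc (fourier (ut t) k) <= x / rk R k ^+ 3)
  (mut : forall t, 0 <= t -> forall y, `|ut t y| <= m) (hm : m <= c0 / 2).
Local Notation br := (br R).
Local Notation rk := (rk R).
Let c0_gt0 : 0 < c0. Proof. by case: hc. Qed.

Let w t y := v t y - ut t y.
Let z t y := ut t y + v t y.
Let W t k := fourier (w t) k.
Let H t k := fourier (fun y => z t y * w t y) k.

Let su t : 0 <= t -> sqint (ut t).
Proof. by move=> t0; case: hut => h _ _; exact: Hper0_sqint (h t t0). Qed.
Let sv t : 0 <= t -> sqint (v t).
Proof. by move=> t0; case: hv => h _ _; exact: Hper0_sqint (h t t0). Qed.
Let sw t : 0 <= t -> sqint (w t).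
Proof. by move=> t0; apply: sqintB; [exact: sv|exact: su]. Qed.
Let sz t : 0 <= t -> sqint (z t).
Proof. by move=> t0; apply: sqintD; [exact: su|exact: sv]. Qed.

Let W0 t : 0 <= t -> W t 0 = 0.
Proof.
move=> t0; rewrite /W /w fourierB; [|exact: sv|exact: su].
case: hut => h _ _; case: hv => h' _ _.
by rewrite (Hper0_fourier0 (h t t0)) (Hper0_fourier0 (h' t t0)) subrr.
Qed.

Let Wper t k : 0 <= t -> W (t + theta) k = W t k.
Proof.
move=> t0; have tt0 : 0 <= t + theta by rewrite addr_ge0// ltW.
rewrite /W /w !fourierB; try (exact: su || exact: sv).
by rewrite (aeeq_fourier k (put t0)) (aeeq_fourier k (pv t0)).
Qed.

Let ode k : exists2 V : R -> R[i], (forall t, 0 <= t -> V t = W t k) &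
  (forall t, 0 <= t -> cderiv V t (mode_rhs beta gamma k (W t k) (H t k))).
Proof.
have [V hV dV] := mild_difference_ode l0 hf hv hut k.
exists V => // t t0; apply: cderiv_eq (dV t t0) _.
by rewrite /mode_rhs hV.
Qed.

Let mode_bound k (B : R) : (forall t, 0 <= t -> normc (H t k) <= B) ->
  forall t, 0 <= t -> normc (W t k) <= (B / c0) / rk k ^+ 2.
Proof.
move=> hB t t0; have B0 : 0 <= B by apply: le_trans (normc_ge0 _) (hB t t0).
have r0 : 0 < rk k ^+ 2 by rewrite exprn_gt0 ?rk_gt0.
have [->|k0] := eqVneq k 0.
  by rewrite W0// normc0 divr_ge0 ?divr_ge0// ltW// exprn_gt0 ?rk_gt0.
have [V hV dV] := ode k.
pose phi s := normc (V s) ^+ 2.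
pose dphi s := 2 * ipc (V s) (mode_rhs beta gamma k (W s k) (H s k)).
have dp (s : R) : 0 <= s -> is_derive s 1 phi (dphi s).
  by move=> s0; apply: is_derive_sqr_normc; exact: dV.
have pp s : 0 <= s -> phi (s + theta) = phi s.
  by move=> s0; rewrite /phi !hV ?Wper// addr_ge0// ltW.
have [s [s0 hs ds]] := periodic_max th0 dp pp.
have hW : normc (W t k) <= normc (W s k).
  have := hs t t0; rewrite /phi !hV// ler_sqr ?nnegrE ?normc_ge0//.
apply: (le_trans hW); rewrite -mulrA -invfM.
have ds0 : ipc (W s k) (mode_rhs beta gamma k (W s k) (H s k)) = 0.
  by move: ds; rewrite /dphi hV//; lra.
apply: (le_trans (mode_max hc k0 ds0)).
by rewrite ler_wpM2r ?hB// invr_ge0 mulr_ge0// ltW.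
Qed.

(** The start of the ladder: continuity and periodicity bound both L^2 norms in time, hence all
    coefficients of z w, uniformly in k. *)
Let ladder0 : exists C, forall t k, 0 <= t -> normc (W t k) <= C / rk k ^+ 2.
Proof.
have [u1 u2 _] := hut; have [v1 v2 _] := hv.
have [Mu Mu0 hMu] := l2_bounded l0 th0 u1 u2 put.
have [Mv Mv0 hMv] := l2_bounded l0 th0 v1 v2 pv.
exists ((2 * (4 * (Mu + Mv))) / c0) => t k; apply: mode_bound => {}t t0.
rewrite /H (le_trans (normc_fourier_mul k ltr01 (sz t0) (sw t0)))//.
rewrite invr1 !mul1r ler_pM2l//.
have h1 := int01_sqD_le (su t0) (sv t0).
have h2 := int01_sqD_le (sv t0) (sqintZ (-1) (su t0)).
have e1 : (fun y => (v t y + -1 * ut t y) ^+ 2) = (fun y => w t y ^+ 2).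
  by apply/funext => y; rewrite mulN1r.
have e2 : (fun y => (-1 * ut t y) ^+ 2) = (fun y => ut t y ^+ 2).
  by apply/funext => y; rewrite mulN1r sqrrN.
move: h2; rewrite e1 e2 => h2.
have := hMu t t0; have := hMv t t0.
move: h1; rewrite -/(z t).
by rewrite (_ : (fun y => (ut t y + v t y) ^+ 2) = (fun y => z t y ^+ 2))//; lra.
Qed.

Let zcoef t k : 0 <= t -> fourier (z t) k = 2%:C * fourier (ut t) k + W t k.
Proof.
move=> t0; rewrite /z /W /w fourierD ?fourierB; try (exact: su || exact: sv).
by rewrite rmorphMn /= rmorph1; ring.
Qed.

Let x0 : 0 <= x.
Proof.
have := but (lexx 0) 0; move=> /(le_trans (normc_ge0 _)).
by rewrite pmulr_lge0// invr_gt0 exprn_gt0 ?rk_gt0.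
Qed.

Let rk_weak k (i j : nat) (c : R) : 0 <= c -> (i <= j)%N -> c / rk k ^+ j <= c / rk k ^+ i.
Proof.
move=> c0' ij; rewrite ler_wpM2l// lef_pV2 ?posrE ?exprn_gt0 ?rk_gt0//.
by apply: ler_weXn2l => //; exact: rk_ge1.
Qed.

Let zbound t k C i : 0 <= t -> (i <= 3)%N -> normc (W t k) <= C / rk k ^+ i ->
  normc (fourier (z t) k) <= (2 * x + C) / rk k ^+ i.
Proof.
move=> t0 i3 hW; rewrite zcoef// (le_trans (normcD _ _))// mulrDl lerD//.
rewrite normcM normc_real ger0_norm// -mulrA ler_wpM2l//.
exact: le_trans (but t0 k) (rk_weak k x0 i3).
Qed.

(** Decay [rk ^ -2] of both factors gives [rk ^ -1] for the product, and [mode_bound] adds two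
    powers. *)
Let ladder1 : exists C, forall t k, 0 <= t -> normc (W t k) <= C / rk k ^+ 3.
Proof.
have [C hC] := ladder0.
exists ((10 * ((2 * x + C) * C)) / c0) => t k t0.
have := @mode_bound k (10 * ((2 * x + C) * C) / rk k).
have -> : 10 * ((2 * x + C) * C) / rk k / c0 / rk k ^+ 2 = 10 * ((2 * x + C) * C) / c0 / rk k ^+ 3.
  by field; rewrite !gt_eqF ?rk_gt0.
apply => // s s0; apply: convolution_bound; [exact: sz|exact: sw|].
by move=> n; apply: conv_rk1 => j; [apply: zbound => //; exact: hC|exact: hC].
Qed.

(** The ladder stops here: with decay [rk ^ -5] the coefficients of the derivative of w are at most
    of order [rk ^ -3], hence summable. *)
Let ladder2 : exists2 C, 0 <= C & forall t k, 0 <= t -> normc (W t k) <= C / rk k ^+ 5.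
Proof.
have [C hC] := ladder1.
have h t k : 0 <= t -> normc (W t k) <= ((40 * ((2 * x + C) * C)) / c0) / rk k ^+ 5.
  move=> t0; have := @mode_bound k (40 * ((2 * x + C) * C) / rk k ^+ 3).
  have -> : 40 * ((2 * x + C) * C) / rk k ^+ 3 / c0 / rk k ^+ 2 = 40 * ((2 * x + C) * C) / c0 / rk k ^+ 5.
    by field; rewrite !gt_eqF ?rk_gt0.
  apply => // s s0; apply: convolution_bound; [exact: sz|exact: sw|].
  by move=> n; apply: conv_rk3 => j; [apply: zbound => //; exact: hC|exact: hC].
exists ((40 * ((2 * x + C) * C)) / c0) => //.
have := le_trans (normc_ge0 _) (h 0 0 (lexx 0)).
by rewrite pmulr_lge0// invr_gt0 exprn_gt0 ?rk_gt0.
Qed.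

Let E n t := \sum_(k <- box n) br k * normc (W t k) ^+ 2.

(** Single modes reach their maxima at different times, whereas the cancellation of the cubic term
    needs all modes at one time. Hence the maximum of the truncated H^1 energy; its weight [br]
    cancels the factor 1 / br of the resolvent. *)
Let energy_max n : exists t, [/\ 0 <= t, forall s, 0 <= s -> E n s <= E n t &
  \sum_(k <- box n) (- (beta + gamma * freq k ^+ 2) * normc (W t k) ^+ 2 -
   freq k / 2 * (Im (W t k) * Re (H t k) - Re (W t k) * Im (H t k))) = 0].
Proof.
have hch k : {V : R -> R[i] | (forall t, 0 <= t -> V t = W t k) /\
  (forall t, 0 <= t -> cderiv V t (mode_rhs beta gamma k (W t k) (H t k)))}.
  by apply: cid; have [V h1 h2] := ode k; exists V.
pose V k := sval (hch k).
have hV k t : 0 <= t -> V k t = W t k.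
  exact: (svalP (hch k)).1.
have dV k t : 0 <= t -> cderiv (V k) t (mode_rhs beta gamma k (W t k) (H t k)).
  exact: (svalP (hch k)).2.
pose phi s := \sum_(k <- box n) br k * normc (V k s) ^+ 2.
pose dphi s := \sum_(k <- box n) br k * (2 * ipc (V k s) (mode_rhs beta gamma k (W s k) (H s k))).
have phiE s : 0 <= s -> phi s = E n s.
  by move=> s0; apply: eq_bigr => k _; rewrite hV.
have dp (s : R) : 0 <= s -> is_derive s 1 phi (dphi s).
  by move=> s0; apply: isd_sum => k; apply: isdZ; apply: is_derive_sqr_normc; exact: dV.
have pp s : 0 <= s -> phi (s + theta) = phi s.
  by move=> s0; rewrite !phiE ?addr_ge0 ?(ltW th0)//; apply: eq_bigr => k _; rewrite Wper.
have [t [t0 ht dt]] := periodic_max th0 dp pp.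
exists t; split => //.
  by move=> s s0; rewrite -(phiE s s0) -(phiE t t0); exact: ht.
apply: (@mulfI _ 2) => //; rewrite mulr0 -[RHS]dt /dphi mulr_sumr.
apply: eq_bigr => k _; rewrite hV// ipc_mode_rhs.
by field; rewrite gt_eqF ?br_gt0.
Qed.


Let Wsqr_le C t k : 0 <= C -> 0 <= t -> normc (W t k) <= C / rk k ^+ 5 ->
  normc (W t k) ^+ 2 <= C ^+ 2 * (rk k ^+ 3)^-1.
Proof.
move=> C0 t0 h; have r0 := rk_gt0 R k.
apply: (@le_trans _ _ ((C / rk k ^+ 5) ^+ 2)).
  by rewrite ler_sqr ?nnegrE ?normc_ge0// divr_ge0// exprn_ge0// ltW.
rewrite exprMn ler_wpM2l ?sqr_ge0// exprVn -exprM lef_pV2 ?posrE ?exprn_gt0//.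
by apply: ler_weXn2l => //; exact: rk_ge1.
Qed.

Let tail C : 0 <= C -> (forall t k, 0 <= t -> normc (W t k) <= C / rk k ^+ 5) ->
  forall tau : R, 0 < tau -> exists N, forall n t, (N <= n)%N -> 0 <= t ->
  int01 (fun y => w t y ^+ 2) <= \sum_(k <- box n) normc (W t k) ^+ 2 + tau.
Proof.
move=> C0 hC tau tau0.
have F0 k : 0 <= C ^+ 2 * (rk k ^+ 3)^-1 by rewrite mulr_ge0 ?sqr_ge0 ?rk3_inv_ge0.
have [N hN] := sumle_tail F0 (sumleZ (sqr_ge0 C) (sum_rk3 R)) tau0.
exists N => n t Nn t0; apply: parseval_le; first exact: sw.
move=> n'; rewrite (bigID (fun k : int => (N < `|k|)%N))/= addrC lerD//.
  rewrite -big_filter; apply: sum_uniq_sub.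
  - by move=> k; exact: sqr_ge0.
  - by rewrite filter_uniq ?box_uniq.
  - exact: box_uniq.
  - move=> k; rewrite mem_filter -leqNgt => /andP[kN _]; rewrite mem_box.
    exact: leq_trans kN Nn.
rewrite (le_trans _ (hN n'))//; apply: ler_sum => k _.
by apply: Wsqr_le => //; exact: hC.
Qed.

Let cwz t k : 0 <= t -> `|ccoef (w t) k| <= normc (W t k) /\ `|scoef (w t) k| <= normc (W t k).
Proof.
move=> t0; split; first by rewrite -Re_fourier ler_Re.
by rewrite -normrN -Im_fourier ?ler_Im//; exact: sw.
Qed.

Let p n t := tpoly (ccoef (w t)) (scoef (w t)) n.
Let p' n t := tpoly (fun k => freq k * scoef (w t) k) (fun k => - freq k * ccoef (w t) k) n.

(** The bound must not depend on the truncation n, which is chosen after C when the error is made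
    small. *)
Let p'_bound C n t y : (forall t k, 0 <= t -> normc (W t k) <= C / rk k ^+ 5) ->
  0 <= t -> `|p' n t y| <= 20 * pi * C.
Proof.
move=> hC t0; rewrite (le_trans (tpoly_bounded _ _ _ _))//.
have C0 : 0 <= C.
  have := le_trans (normc_ge0 _) (hC 0 0 (lexx 0)).
  by rewrite pmulr_lge0// invr_gt0 exprn_gt0 ?rk_gt0.
have -> : 20 * pi * C = 4 * pi * C * 5 :> R by ring.
have h : sumle (fun k => `|freq k * scoef (w t) k| + `|- freq k * ccoef (w t) k|) (4 * pi * C * 5).
  apply: le_sumle (sumleZ _ (sum_rk3 R)) => [k|]; last by rewrite !mulr_ge0 ?pi_ge0.
  have [h1 h2] := cwz k t0; rewrite (normrM (freq k)) (normrM (- freq k)) normrN -mulrDr.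
  have fk : `|freq k : R| <= 2 * pi * rk k ^+ 2.
    rewrite sqr_rk /freq normrM ger0_norm ?mulr_ge0 ?pi_ge0// ler_wpM2l ?mulr_ge0 ?pi_ge0//.
    by rewrite -intr_norm -natr_absz lerDr.
  apply: (@le_trans _ _ ((2 * pi * rk k ^+ 2) * (2 * (C / rk k ^+ 5)))).
    apply: ler_pM => //.
    by have := hC t k t0; move: h1 h2; lra.
  rewrite le_eqVlt; apply/orP; left; apply/eqP.
  by field; rewrite gt_eqF ?rk_gt0.
exact: h.
Qed.

Let int01_p'_sqr n t : 0 <= t -> int01 (fun y => p' n t y ^+ 2) <= E n t.
Proof.
move=> t0; have s := sw t0.
rewrite /p' int01_tpoly_sqr; last 2 first.
- by move=> k; rewrite freqN scoefN// mulrNN.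
- by move=> k; rewrite freqN ccoefN; ring.
apply: ler_sum => k _; rewrite /W sqr_normc_fourier// /br.
by have := sqr_ge0 (ccoef (w t) k); have := sqr_ge0 (scoef (w t) k); nra.
Qed.

Let flux_sum n t : 0 <= t ->
  \sum_(k <- box n) freq k / 2 * (Im (W t k) * Re (H t k) - Re (W t k) * Im (H t k)) =
  - (2^-1 * int01 (fun y => p' n t y * (z t y * w t y))).
Proof.
move=> t0; have ih := intg_mul (sz t0) (sw t0); have s := sw t0.
rewrite /p' int01_tpoly// mulr_sumr -sumrN; apply: eq_bigr => k _.
by rewrite /W /H !Re_fourier Im_fourier// Im_fourier_intg//; ring.
Qed.

Let m0 : 0 <= m. Proof. exact: le_trans (normr_ge0 _) (mut (lexx 0) 0). Qed.

(** Writing z w = 2 ut w + (w - p)(w + p) + p^2, the first term is controlled by the sup norm m of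
    ut, the second by the truncation error tau, and the last one, multiplied by p', has zero
    integral. The parameter eta weights w - p against w + p. *)
Let flux_bound C n t tau eta : 0 <= C -> (forall t k, 0 <= t -> normc (W t k) <= C / rk k ^+ 5) ->
  0 <= t -> 0 < eta -> int01 (fun y => w t y ^+ 2) <= \sum_(k <- box n) normc (W t k) ^+ 2 + tau ->
  int01 (fun y => p' n t y * (z t y * w t y)) <=
  m * (2 * E n t + tau) + 20 * pi * C * (eta^-1 * tau + eta * (20 * C ^+ 2)).
Proof.
move=> C0 hC t0 eta0 ht.
have s := sw t0; have spp : sqint (p' n t) by exact: sqint_tpoly.
have sp : sqint (p n t) by exact: sqint_tpoly.
have su' := su t0.
have [mp' _] := spp.
have b' y := p'_bound n y hC t0.
pose a1 y := ut t y * w t y; pose a2 y := (w t y - p n t y) * (w t y + p n t y).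
have su1 : sqint a1.
  rewrite /a1; under eq_fun do rewrite mulrC.
  by apply: (@sqintM_bounded _ _ _ m) => //; [case: su'|exact: mut].
have sd := sqintB s sp; have ss := sqintD s sp.
have i2 : intg a2 by exact: intg_mul.
have i1 : itg (fun y => p' n t y * a1 y) by exact: sqint_mul.
have j2 : itg (fun y => p' n t y * a2 y).
  by under eq_fun do rewrite mulrC; exact: intgM_bounded i2 mp' b'.
have j3 : itg (fun y => p' n t y * p n t y ^+ 2).
  by under eq_fun do rewrite mulrC; apply: intgM_bounded (intg_sqr sp) mp' b'.
have -> : (fun y => p' n t y * (z t y * w t y)) =
    (fun y => (2 * (p' n t y * a1 y) + p' n t y * a2 y) + p' n t y * p n t y ^+ 2).
  by apply/funext => y; rewrite /a1 /a2 /z /w; ring.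
rewrite int01D//; last by apply: itgD => //; exact: itgZ.
rewrite int01D//; last exact: itgZ.
rewrite int01Z// (int01_cubic (ccoef (w t)) (scoef (w t)) n) addr0.
have E2 : \sum_(k <- box n) normc (W t k) ^+ 2 <= E n t.
  by apply: ler_sum => k _; rewrite ler_peMl ?sqr_ge0 ?br_ge1.
have [_ iw2] := s; have [_ ip2] := spp; have [_ id2] := sd; have [_ is2] := ss.
have h1 : 2 * int01 (fun y => p' n t y * a1 y) <= m * (2 * E n t + tau).
  rewrite -int01Z//.
  apply: (@le_trans _ _ (m * (int01 (fun y => p' n t y ^+ 2) + int01 (fun y => w t y ^+ 2)))).
    rewrite -int01D// -int01Z; last exact: itgD.
    apply: int01_le; [exact: itgZ|by apply: itgZ; exact: itgD|].
    move=> y; have := mut t0 y; rewrite /a1 => hmy.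
    rewrite (le_trans (ler_norm _))// !normrM ger0_norm//.
    rewrite -[p' n t y ^+ 2]real_normK ?num_real// -[w t y ^+ 2]real_normK ?num_real//.
    set a := `|p' n t y|; set b := `|w t y|; set cc := `|ut t y| in hmy *.
    have ab : 0 <= a * b by rewrite mulr_ge0 ?normr_ge0.
    apply: (@le_trans _ _ (m * (2 * (a * b)))); last by rewrite ler_wpM2l//; have := sqr_ge0 (a - b); nra.
    by have := ler_wpM2r ab hmy; nra.
  rewrite ler_wpM2l//; have := int01_p'_sqr n t0; move: ht E2; lra.
have h2 : int01 (fun y => p' n t y * a2 y) <= 20 * pi * C * (eta^-1 * tau + eta * (20 * C ^+ 2)).
  have ia2 : itg (fun y => `|a2 y|) by apply: itg_norm; case: i2.
  have P0 : 0 <= 20 * pi * C by rewrite !mulr_ge0 ?pi_ge0.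
  apply: (@le_trans _ _ (20 * pi * C * int01 (fun y => `|a2 y|))).
    rewrite -int01Z//; apply: int01_le => //; first exact: itgZ.
    by move=> y; rewrite (le_trans (ler_norm _))// normrM ler_wpM2r.
  rewrite ler_wpM2l//.
  apply: (@le_trans _ _ (eta^-1 * int01 (fun y => (w t y - p n t y) ^+ 2) + eta * int01 (fun y => (w t y + p n t y) ^+ 2))).
    rewrite -!int01Z// -int01D; [|exact: itgZ..].
    apply: int01_le => //; first by apply: itgD; exact: itgZ.
    move=> y; rewrite /a2 normrM.
    rewrite -[(w t y - _) ^+ 2]real_normK ?num_real// -[(w t y + _) ^+ 2]real_normK ?num_real//.
    set a := `|_ - _|; set b := `|_ + _|.
    have : 0 <= (a - eta * b) ^+ 2 / eta by rewrite divr_ge0 ?sqr_ge0 ?ltW.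
    have -> : (a - eta * b) ^+ 2 / eta = eta^-1 * a ^+ 2 + eta * b ^+ 2 - 2 * (a * b).
      by field; rewrite gt_eqF.
    have ab : 0 <= a * b by rewrite mulr_ge0 ?normr_ge0.
    by move: ab; lra.
  have r1 := int01_resid_sqr n s.
  have r2 : int01 (fun y => (w t y - p n t y) ^+ 2) <= tau.
    by rewrite [leLHS]r1; move: ht; rewrite /W; lra.
  have w2 : int01 (fun y => w t y ^+ 2) <= C ^+ 2 * 5.
    apply: parseval_le => //; apply: le_sumle (sumleZ (sqr_ge0 C) (sum_rk3 R)) => k.
    by apply: Wsqr_le => //; exact: hC.
  have p2 : int01 (fun y => p n t y ^+ 2) <= C ^+ 2 * 5.
    rewrite /p int01_tpoly_sqr; [|by move=> k; rewrite ccoefN|by move=> k; rewrite scoefN].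
    apply: le_trans w2; rewrite (le_trans _ (bessel s n))//.
    by apply: ler_sum => k _; rewrite sqr_normc_fourier.
  have r3 := int01_sqD_le s sp.
  apply: lerD; rewrite ler_pM2l ?invr_gt0//.
  by rewrite (le_trans r3)//; move: w2 p2; lra.
by apply: lerD.
Qed.

Let W_eq0 t k : 0 <= t -> W t k = 0.
Proof.
move=> t0; have [C C0 hC] := ladder2.
pose P := 20 * pi * C; have P0 : 0 <= P by rewrite /P !mulr_ge0 ?pi_ge0.
pose K := c0 / 2 + P * (1 + 20 * C ^+ 2).
have K0 : 0 < K.
  by rewrite /K ltr_pwDl ?divr_gt0// mulr_ge0// addr_ge0// mulr_ge0 ?sqr_ge0.
have main eta : 0 < eta -> eta <= 1 -> c0 * normc (W t k) ^+ 2 <= K * eta.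
  (* With tau = eta^2 both parts of the truncation error, tau / eta and a multiple of eta, are of
     order eta. *)
  move=> eta0 eta1; have tau0 : 0 < eta ^+ 2 by rewrite exprn_gt0.
  have [N hN] := tail C0 hC tau0.
  pose n := maxn N `|k|%N.
  have [s [s0 hs es]] := energy_max n.
  have ht := hN n s (leq_maxl _ _) s0.
  have fb := flux_bound C0 hC s0 eta0 ht.
  have coer : c0 * E n s <= \sum_(j <- box n) (beta + gamma * freq j ^+ 2) * normc (W s j) ^+ 2.
    rewrite /E mulr_sumr; apply: ler_sum => j _.
    have [->|j0] := eqVneq j 0; first by rewrite W0// normc0 expr0n/= !mulr0.
    by rewrite mulrA ler_wpM2r ?sqr_ge0//; case: hc => _; apply.
  have es' : \sum_(j <- box n) (beta + gamma * freq j ^+ 2) * normc (W s j) ^+ 2 =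
      2^-1 * int01 (fun y => p' n s y * (z s y * w s y)).
    have := es; rewrite sumrB flux_sum// opprK.
    under [X in X + _]eq_bigr do rewrite mulNr.
    by rewrite sumrN; lra.
  have Ets : normc (W t k) ^+ 2 <= E n s.
    apply: le_trans (hs t t0).
    have kn : k \in box n by rewrite mem_box leq_maxr.
    rewrite /E (bigD1_seq k) ?box_uniq//=.
    apply: (@le_trans _ _ (br k * normc (W t k) ^+ 2)).
      by rewrite ler_peMl ?sqr_ge0 ?br_ge1.
    by rewrite lerDl sumr_ge0// => j _; rewrite mulr_ge0 ?sqr_ge0// ltW// br_gt0.
  have E0 : 0 <= E n s by apply: le_trans Ets; exact: sqr_ge0.
  have e1 : eta^-1 * eta ^+ 2 = eta by rewrite expr2 mulrA mulVf ?mul1r// gt_eqF.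
  move: fb; rewrite e1 -/P => fb.
  (* Together with the factor 1/2 in [es'], the bound m <= c0 / 2 lets the ut term use up half of c0
     E; the rest is at most K eta / 2. *)
  have mE : m * (2 * E n s + eta ^+ 2) <= c0 / 2 * (2 * E n s + eta ^+ 2).
    by rewrite ler_wpM2r// addr_ge0 ?sqr_ge0// mulr_ge0.
  have e2 : eta ^+ 2 <= eta by rewrite expr2 ler_piMr// ltW.
  have c1 : c0 / 2 * eta ^+ 2 <= c0 / 2 * eta by rewrite ler_wpM2l// divr_ge0// ltW.
  have fin : c0 * E n s <= K * eta.
    by move: coer fb mE c1; rewrite es' /K; lra.
  by rewrite (le_trans _ fin)// ler_pM2l.
apply: normc0_eq0; have a0 := normc_ge0 (W t k).
rewrite -(ler_sqr a0 (lexx 0)) expr0n/=.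
have : c0 * normc (W t k) ^+ 2 <= 0.
  apply/ler_addgt0Pr => e e0; rewrite add0r.
  have d0 : 0 < Num.min 1 (e / K) by rewrite lt_min ltr01 divr_gt0.
  apply: (le_trans (main _ d0 _)); first by rewrite ge_min lexx.
  by rewrite mulrC -ler_pdivlMr// ge_min lexx orbT.
by rewrite pmulr_rle0.
Qed.

Lemma uniqueness_fourier t k : 0 <= t -> fourier (v t) k = fourier (ut t) k.
Proof.
move=> t0; have := W_eq0 k t0; rewrite /W /w fourierB; [|exact: sv|exact: su].
by move=> /eqP; rewrite subr_eq0 => /eqP.
Qed.

End Uniqueness.

(** * Stability *)

Section Bootstrap.
Variable R : realType.

(** Let c be the supremum of the times up to which Y <= a. By continuity the bound still holds at c,
    there the step makes it strict, and continuity carries it beyond c. *)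
Lemma bootstrap (Y : R -> R) (a : R) : continuous Y -> Y 0 < a ->
  (forall T, 0 <= T -> (forall s, 0 <= s <= T -> Y s <= a) -> Y T < a) ->
  forall t, 0 <= t -> Y t < a.
Proof.
move=> cY Y0 step t1 t10; rewrite ltNge; apply/negP => Yt1.
pose G := [set t | 0 <= t <= t1 /\ forall s, 0 <= s <= t -> Y s <= a].
have G0 : G 0.
  split=> [|s /andP[s0 s1]]; first by rewrite lexx.
  by rewrite (_ : s = 0) ?ltW//; apply/eqP; rewrite eq_le s0 s1.
have hsG : has_sup G by split; [exists 0|exists t1 => t [/andP[]]].
pose c := sup G.
have c0 : 0 <= c by apply: ub_le_sup G0; case: hsG.
have ct1 : c <= t1 by apply: ge_sup; [exists 0|move=> t [/andP[]]].
have lt_c s : 0 <= s -> s < c -> Y s <= a.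
  move=> s0 sc; have e0 : 0 < c - s by rewrite subr_gt0.
  have [t [_ ht] st] := sup_adherent e0 hsG.
  apply: ht; rewrite s0 ltW//; move: st; rewrite -/c; lra.
have Yc : Y c < a.
  apply: step => // s /andP[s0]; rewrite le_eqVlt => /predU1P[->|]; last exact: lt_c.
  rewrite leNgt; apply/negP => aY.
  have e0 : 0 < Y c - a by rewrite subr_gt0.
  have /cvgrPdist_lt /(_ _ e0) [d /= d0 hd] := cY c.
  have [t Gt st] := sup_adherent d0 hsG.
  have tc : t <= c by apply: ub_le_sup Gt; case: hsG.
  have [/andP[t0 _] ht] := Gt.
  have : `|Y c - Y t| < Y c - a.
    apply: hd; rewrite /= ger0_norm ?subr_ge0//; move: st; rewrite -/c; lra.
  by move=> /(le_lt_trans (ler_norm _)); have := ht t; rewrite t0 lexx => /(_ isT); lra.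
have e0 : 0 < a - Y c by rewrite subr_gt0.
have /cvgrPdist_lt /(_ _ e0) [d /= d0 hd] := cY c.
have c1 : c < t1.
  rewrite lt_neqAle ct1 andbT; apply/eqP => e; move: Yt1; rewrite -e; lra.
pose t := Num.min (c + d / 2) t1.
have tc : c < t by rewrite lt_min c1 ltrDl divr_gt0.
have Gt : G t.
  split; first by rewrite (le_trans c0 (ltW tc)) /t ge_min lexx orbT.
  move=> s /andP[s0 st]; have [sc|cs] := ltP s c; first exact: lt_c.
  have sd : s <= c + d / 2 by rewrite (le_trans st)// /t ge_min lexx.
  have : `|Y c - Y s| < a - Y c.
    apply: hd; rewrite /= ler0_norm ?subr_le0//; lra.
  rewrite -normrN => /(le_lt_trans (ler_norm _)); lra.
by have := ub_le_sup (proj2 hsG) Gt; rewrite -/c leNgt tc.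
Qed.

(* The weight m exp(-s t / 2) that closes the estimate is the maximum of
   exp(s t / 2) Y(t), so no primitive of Y is needed. *)
Lemma exponential_decay (Y : R -> R) (y_ : nat -> R -> R) (dy_ : nat -> R -> R) (s T : R) :
  0 < s -> 0 <= T -> continuous Y ->
  (forall n (t : R), 0 <= t -> is_derive t 1 (y_ n) (dy_ n t)) ->
  (forall n t, 0 <= t -> y_ n t <= Y t) ->
  (forall t B, 0 <= t -> (forall n, y_ n t <= B) -> Y t <= B) ->
  (forall n t, 0 <= t <= T -> dy_ n t <= - s * y_ n t + s / 2 * Y t) ->
  forall t, 0 <= t <= T -> expR (s / 2 * t) * Y t <= Y 0.
Proof.
move=> s0 T0 cY dy yY lubY hdy t tT.
pose phi r := expR (s / 2 * r) * Y r.
have dexp (c r : R) : is_derive r 1 (fun x => expR (c * x)) (expR (c * r) * c).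
  by apply: isd_eq (isd_comp (is_derive_expR _) (isdZ c (isd_id r))) _; rewrite mulr1.
have cphi : continuous phi.
  by move=> r; apply: cvgM; [exact: isd_cont (dexp (s / 2) r)|exact: cY].
have [c cT hm] := EVT_max T0 (continuous_subspaceT cphi).
have hm' r : 0 <= r <= T -> phi r <= phi c by move=> h; apply: hm; rewrite in_itv.
move: cT; rewrite in_itv/= => /andP[c0 cT].
apply: (le_trans (hm' t tT)); set m := phi c in hm' *.
have key n : expR (s * c) * y_ n c <= Y 0 - m + m * expR (s / 2 * c).
  pose psi r := expR (s * r) * y_ n r - m * expR (s / 2 * r).
  pose dpsi r := (expR (s * r) * s * y_ n r + expR (s * r) * dy_ n r) - m * (expR (s / 2 * r) * (s / 2)).
  have dpsiP (r : R) : 0 <= r -> is_derive r 1 psi (dpsi r).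
    by move=> r0; exact: (isdB (isdM (dexp s r) (dy n r r0)) (isdZ m (dexp (s / 2) r))).
  have psi_le : psi c <= psi 0.
    have d1 r : r \in `]0, T[ -> derivable psi r 1.
      by rewrite in_itv/= => /andP[/ltW r0 _]; have h := dpsiP r r0; exact: ex_derive.
    have d2 r : r \in `]0, T[ -> derive1 psi r <= 0.
      rewrite in_itv/= => /andP[/ltW r0 /ltW rT].
      have h := dpsiP r r0; rewrite derive1E (@derive_val _ _ _ _ _ _ _ h) /dpsi.
      have rr : 0 <= r <= T by rewrite r0.
      have h1 := hdy n r rr; have h2 := hm' r rr.
      have e1 : expR (s * r) = expR (s / 2 * r) * expR (s / 2 * r).
        by rewrite -expRD; congr expR; field.
      have p0 := expR_gt0 (s / 2 * r); move: h2; rewrite /phi e1.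
      set x := expR (s / 2 * r) in p0 *; set y := y_ n r in h1 *; set d := dy_ n r in h1 *.
      set z := Y r in h1 * => h2.
      have : x * x * d <= x * x * (- s * y + s / 2 * z) by rewrite ler_pM2l// mulr_gt0.
      have : s / 2 * x * (x * z) <= s / 2 * x * m by rewrite ler_pM2l// mulr_gt0// divr_gt0.
      by lra.
    have d3 : {within `[0, T], continuous psi}.
      apply: continuous_in_subspaceT => r; rewrite inE/= in_itv/= => /andP[r0 _].
      exact: isd_cont (dpsiP r r0).
    exact: (ler0_derive1_nincr d1 d2 d3 (lexx 0) c0 cT).
  move: psi_le; rewrite /psi !mulr0 expR0 mul1r mulr1.
  have := yY n 0 (lexx 0); lra.
have e1 : expR (s * c) = expR (s / 2 * c) * expR (s / 2 * c).
  by rewrite -expRD; congr expR; field.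
have p0 := expR_gt0 (s * c).
(* Since m = e^(s c / 2) Y(c), multiplying by e^(s c) gives m e^(s c / 2) <= Y 0 - m + m e^(s c /
   2), that is m <= Y 0. *)
have : Y c <= (Y 0 - m + m * expR (s / 2 * c)) / expR (s * c).
  by apply: lubY => // n; rewrite ler_pdivlMr// mulrC.
rewrite ler_pdivlMr// e1 mulrA.
have -> : Y c * expR (s / 2 * c) * expR (s / 2 * c) = m * expR (s / 2 * c) by rewrite /m /phi; ring.
lra.
Qed.

End Bootstrap.

(** * Convolution of two elements of weighted l^2 *)

Section WeightedConvolution.
Variables (R : realType) (l : R).
Hypothesis l0 : 0 <= l.
Implicit Types (a b : int -> R[i]) (k : int) (n : nat).

Lemma conv_l2 a b k n A B : sumle (fun j => normc (a j) ^+ 2) A ->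
  sumle (fun j => normc (b j) ^+ 2) B ->
  (\sum_(j <- box n) normc (a j) * normc (b (k - j))) ^+ 2 <= A * B.
Proof.
move=> hA hB; apply: (le_trans (cauchy_schwarz_sum _ _ _)).
apply: ler_pM; try by apply: sumr_ge0 => j _; exact: sqr_ge0.
  exact: hA.
by apply: (sumle_shift (F := fun j => normc (b j) ^+ 2)) => // j; exact: sqr_ge0.
Qed.

(** The root of the weight is shared out between the factors, and Cauchy-Schwarz bounds each half.
    The bound is for each k and not summed over k, as H^l need not be an algebra; the factor 1 / br
    k of the resolvent makes it summable afterwards. *)
Lemma conv_weighted a b k n A B : sumle (fun j => wt l j * normc (a j) ^+ 2) A ->
  sumle (fun j => wt l j * normc (b j) ^+ 2) B ->
  wt l k * normc (\sum_(j <- box n) a j * b (k - j)) ^+ 2 <= 4 * 4 `^ l * (A * B).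
Proof.
move=> hA hB.
pose wa j := (wt (l / 2) j)%:C * a j; pose wb j := (wt (l / 2) j)%:C * b j.
have nw (z : int -> R[i]) j : normc ((wt (l / 2) j)%:C * z j) = wt (l / 2) j * normc (z j).
  by rewrite normcM normc_real ger0_norm ?wt_ge0.
have hwa : sumle (fun j => normc (wa j) ^+ 2) A.
  by move=> m; apply: le_trans (hA m); apply: ler_sum => j _; rewrite nw exprMn wt_half.
have hwb : sumle (fun j => normc (wb j) ^+ 2) B.
  by move=> m; apply: le_trans (hB m); apply: ler_sum => j _; rewrite nw exprMn wt_half.
have h1 := conv_l2 k n hwa (sumle_l2 l0 hB).
have h2 := conv_l2 k n (sumle_l2 l0 hA) hwb.
set S1 := \sum_(j <- _) _ in h1; set S2 := \sum_(j <- _) _ in h2.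
have l2 : 0 <= l / 2 by rewrite divr_ge0.
have S10 : 0 <= S1 by apply: sumr_ge0 => j _; rewrite mulr_ge0 ?normc_ge0.
have S20 : 0 <= S2 by apply: sumr_ge0 => j _; rewrite mulr_ge0 ?normc_ge0.
have main : wt (l / 2) k * normc (\sum_(j <- box n) a j * b (k - j)) <= 4 `^ (l / 2) * (S1 + S2).
  apply: (@le_trans _ _ (wt (l / 2) k * \sum_(j <- box n) normc (a j) * normc (b (k - j)))).
    rewrite ler_wpM2l ?wt_ge0// (le_trans (normc_sum _ _))//.
    by apply: ler_sum => j _; rewrite normcM.
  rewrite /S1 /S2 -big_split/= !mulr_sumr; apply: ler_sum => j _.
  rewrite !nw; have := @wt_quasi _ (l / 2) k j l2.
  have p0 : 0 <= normc (a j) * normc (b (k - j)) by rewrite mulr_ge0 ?normc_ge0.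
  move=> /(ler_wpM2r p0); lra.
rewrite -wt_half -exprMn.
apply: (@le_trans _ _ ((4 `^ (l / 2) * (S1 + S2)) ^+ 2)).
  by rewrite ler_sqr// nnegrE ?mulr_ge0 ?wt_ge0 ?normc_ge0 ?powR_ge0// addr_ge0.
have e4 : 4 `^ (l / 2) ^+ 2 = 4 `^ l :> R.
  by rewrite expr2 -powRD -?splitr//; apply/implyP => _.
rewrite exprMn e4 [4 * _]mulrC -mulrA ler_wpM2l ?powR_ge0//.
have := sqr_ge0 (S1 - S2); nra.
Qed.

End WeightedConvolution.

(** * The squared H^l norm as a real number *)

Section Hsquare.
Variables (R : realType) (l : R).
Implicit Types (a b : int -> R[i]).

(** [fine] sends an infinite sum to 0, which is why [hsqP] asks for some finite bound. *)
Definition hsq a : R := fine (\esum_(k in [set: int]) (wt l k * normc (a k) ^+ 2)%:E).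

Lemma hterm_ge0 a k : 0 <= wt l k * normc (a k) ^+ 2.
Proof. by rewrite mulr_ge0 ?wt_ge0 ?sqr_ge0. Qed.

Lemma hsq_ge0 a : 0 <= hsq a.
Proof. by apply/fine_ge0/esum_ge0 => k _; rewrite lee_fin hterm_ge0. Qed.

Lemma hsqP a C : sumle (fun k => wt l k * normc (a k) ^+ 2) C ->
  forall B, hsq a <= B <-> sumle (fun k => wt l k * normc (a k) ^+ 2) B.
Proof.
move=> hC B; rewrite -(esum_leP _ (hterm_ge0 a)) -lee_fin /hsq fineK//.
rewrite ge0_fin_numE ?esum_ge0//; last by move=> k _; rewrite lee_fin hterm_ge0.
by apply: le_lt_trans (ltry C); rewrite esum_leP//; exact: hterm_ge0.
Qed.

(** The free parameter matters for continuity in time: a small eta keeps the factor of the first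
    norm close to 1, while eta = 1 serves for rough bounds. *)
Lemma sumle_hD a b (A B eta : R) : 0 < eta -> sumle (fun k => wt l k * normc (a k) ^+ 2) A ->
  sumle (fun k => wt l k * normc (b k) ^+ 2) B ->
  sumle (fun k => wt l k * normc (a k + b k) ^+ 2) ((1 + eta) * A + (1 + eta^-1) * B).
Proof.
move=> e0 hA hB.
have e1 : 0 <= 1 + eta by rewrite addr_ge0// ltW.
have e2 : 0 <= 1 + eta^-1 by rewrite addr_ge0// invr_ge0 ltW.
apply: le_sumle (sumleD (sumleZ e1 hA) (sumleZ e2 hB)) => k /=.
have -> : (1 + eta) * (wt l k * normc (a k) ^+ 2) + (1 + eta^-1) * (wt l k * normc (b k) ^+ 2) =
  wt l k * ((1 + eta) * normc (a k) ^+ 2 + (1 + eta^-1) * normc (b k) ^+ 2) by ring.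
rewrite ler_wpM2l ?wt_ge0//.
have n0 := normc_ge0 (a k + b k).
have a0 := normc_ge0 (a k); have b0 := normc_ge0 (b k).
apply: (@le_trans _ _ ((normc (a k) + normc (b k)) ^+ 2)).
  by rewrite ler_sqr ?nnegrE ?addr_ge0// normcD.
set x := normc (a k); set y := normc (b k).
have : 0 <= (eta * x - y) ^+ 2 / eta by rewrite divr_ge0 ?sqr_ge0 ?ltW.
have -> : (eta * x - y) ^+ 2 / eta = eta * x ^+ 2 + eta^-1 * y ^+ 2 - 2 * (x * y).
  by field; rewrite gt_eqF.
lra.
Qed.

End Hsquare.

Lemma rate_sum (R : realType) (W w2 c d h b G : R) : W * h * (d * b) <= G * (d * b) ->
  W * (- c * w2 + d * (h * b)) <= - c * (W * w2) + d * G * b.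
Proof. by move=> H; rewrite [leRHS](_ : _ = - c * (W * w2) + G * (d * b)); [lra|ring]. Qed.

Lemma quarters (R : realType) (x y c : R) : x <= c / 4 -> y <= c / 4 -> x + y <= c / 2.
Proof. by move=> *; lra. Qed.

Lemma quasi_close (R : realType) (S T q eta e : R) : 0 <= S -> 0 <= T -> 0 < eta -> q <= 1 ->
  S <= (1 + eta) * T + (1 + eta^-1) * q -> T <= (1 + eta) * S + (1 + eta^-1) * q ->
  S <= (1 + 1) * T + (1 + 1) * q -> (1 + eta^-1) * q <= e / 2 -> eta * (2 * T + 2) <= e / 2 ->
  `|T - S| <= e.
Proof.
move=> S0 T0 eta0 q1 a1 a2 a3 q2 e1; have h : S <= 2 * T + 2 by lra.
have b1 : eta * S <= eta * (2 * T + 2) by rewrite ler_pM2l.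
have b2 : eta * T <= eta * (2 * T + 2) by rewrite ler_pM2l//; lra.
rewrite ler_norml; apply/andP; split; lra.
Qed.

(** * Exponential decay of small perturbations *)

Section Stability.
Variables (R : realType) (l beta gamma c0 rho : R).
Hypotheses (l0 : 0 <= l) (hc : coercive beta gamma c0) (rho0 : 0 <= rho).
Variables (f ut : R -> R -> R).
Hypotheses (hf : Linf l f) (hut : mild_solution l beta gamma f ut)
  (but : forall t, 0 <= t -> forall k, normc (fourier (ut t) k) <= rho / wt (l / 2 + 1) k)
  (hrho : 10 * 4 `^ l / c0 * (80 * rho ^+ 2) <= c0 / 4).
Local Notation br := (br R).
Let c0_gt0 : 0 < c0. Proof. by case: hc. Qed.
(** The product of 1 / (4 c0) from Young's inequality in [rate], 4 * 4^l from [conv_weighted], and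
    10 from the sum of 1 / br. *)
Let K1 := 10 * 4 `^ l / c0.
Let K1_gt0 : 0 < K1. Proof. by apply: divr_gt0 => //; apply: mulr_gt0 => //; exact: powR_gt0. Qed.
(** The size of y up to which the quadratic term K1 * 2 y stays below c0 / 4. *)
Let a := c0 / 4 / (2 * K1).
Let c4V_ge0 : 0 <= (4 * c0)^-1. Proof. by rewrite invr_ge0 mulr_ge0// ltW. Qed.
Let c2_ge0 : 0 <= c0 / 2. Proof. by rewrite divr_ge0// ltW. Qed.
Let K2_gt0 : 0 < 2 * K1. Proof. by rewrite mulr_gt0. Qed.
Let a_gt0 : 0 < a. Proof. by apply: divr_gt0; [exact: divr_gt0|exact: mulr_gt0]. Qed.

Section Perturbation.
Variable u : R -> R -> R.
Hypothesis hu : mild_solution l beta gamma f u.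

Let W t k := fourier (fun x => u t x - ut t x) k.
Let H t k := fourier (fun x => (ut t x + u t x) * (u t x - ut t x)) k.

Let su t : 0 <= t -> sqint (u t).
Proof. by move=> t0; case: hu => h _ _; exact: Hper0_sqint (h t t0). Qed.
Let sut t : 0 <= t -> sqint (ut t).
Proof. by move=> t0; case: hut => h _ _; exact: Hper0_sqint (h t t0). Qed.

Let W0 t : 0 <= t -> W t 0 = 0.
Proof.
move=> t0; rewrite /W fourierB; [|exact: su|exact: sut].
case: hut => h _ _; case: hu => h' _ _.
by rewrite (Hper0_fourier0 (h t t0)) (Hper0_fourier0 (h' t t0)) subrr.
Qed.

Let fin_coef g : Hper0 l g -> exists C, sumle (fun k => wt l k * normc (fourier g k) ^+ 2) C.
Proof.
by move=> [[_ /Hnorm_fin[b b0 /(Hnorm_leP _ _ b0) h]] _]; exists (b ^+ 2).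
Qed.

Let fin t : 0 <= t -> exists C, sumle (fun k => wt l k * normc (W t k) ^+ 2) C.
Proof.
move=> t0; have [h _ _] := hut; have [h' _ _] := hu.
have [C hC] := fin_coef (h t t0); have [D hD] := fin_coef (h' t t0).
exists ((1 + 1) * D + (1 + 1^-1) * C).
apply: le_sumle (sumle_hD ltr01 hD (_ : sumle (fun k => wt l k * normc (- fourier (ut t) k) ^+ 2) C)).
  by move=> k; rewrite /W fourierB//; [exact: su|exact: sut].
by apply: le_sumle hC => k; rewrite normcN.
Qed.

Let y t := hsq l (W t).

Let yP t B : 0 <= t -> y t <= B <-> sumle (fun k => wt l k * normc (W t k) ^+ 2) B.
Proof. by move=> t0; have [C hC] := fin t0; exact: hsqP hC B. Qed.

Let y_self t : 0 <= t -> sumle (fun k => wt l k * normc (W t k) ^+ 2) (y t).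
Proof. by move=> t0; apply/(yP _ t0). Qed.

Let Wdist t e : 0 <= t -> 0 < e -> exists2 d : R, 0 < d & forall s, 0 <= s -> `|s - t| < d ->
  sumle (fun k => wt l k * normc (W s k - W t k) ^+ 2) e.
Proof.
move=> t0 e0; have [h1 h2 _] := hut; have [h3 h4 _] := hu.
pose b := Num.sqrt (e / 4); have b0 : 0 < b by rewrite sqrtr_gt0 divr_gt0.
have b2 : b ^+ 2 = e / 4 by rewrite sqr_sqrtr// divr_ge0// ltW.
have [d1 d10 hd1] := (continuous_HperP l ut).1 h2 t t0 b b0.
have [d2 d20 hd2] := (continuous_HperP l u).1 h4 t t0 b b0.
exists (Num.min d1 d2); first by rewrite lt_min d10.
move=> s s0; rewrite lt_min => /andP[s1 s2].
have := hd1 s s0 s1; rewrite (Hnorm_leP _ _ (ltW b0)) => k1.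
have := hd2 s s0 s2; rewrite (Hnorm_leP _ _ (ltW b0)) => k2.
have k1' : sumle (fun k => wt l k * normc (- fourier (fun x => ut s x - ut t x) k) ^+ 2) (b ^+ 2).
  by apply: le_sumle k1 => k; rewrite normcN.
have := sumle_hD ltr01 k2 k1'; rewrite invr1 b2.
have -> : (1 + 1) * (e / 4) + (1 + 1) * (e / 4) = e by field.
apply: le_sumle => k; rewrite le_eqVlt; apply/orP; left; apply/eqP; congr (_ * normc _ ^+ 2).
by rewrite /W !fourierB; try (exact: su || exact: sut); ring.
Qed.

Let Y s := y (Num.max s 0).

Let y_quasi s t q eta : 0 <= s -> 0 <= t -> 0 < eta ->
  sumle (fun k => wt l k * normc (W s k - W t k) ^+ 2) q ->
  y s <= (1 + eta) * y t + (1 + eta^-1) * q.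
Proof.
move=> s0 t0 e0 hq; apply/(yP _ s0).
apply: le_sumle (sumle_hD e0 (y_self t0) hq) => k.
by rewrite [W t k + _]addrC subrK.
Qed.

(** The squared norm is an infinite sum, so continuity comes from the quasi-triangle inequality used
    in both directions: eta is small relative to y at the limit time, then q relative to eta. *)
Let Y_cont : continuous Y.
Proof.
move=> t; apply/cvgrPdist_le => e e0.
pose p s : R := Num.max s 0; have p0 s : 0 <= p s by rewrite /p le_max lexx orbT.
have pd s : `|p s - p t| <= `|s - t|.
  rewrite /p; have [h1|h1] := leP s 0; have [h2|h2] := leP t 0; rewrite ?subrr ?normr0//.
  - by have := ler_norm (- (s - t)); rewrite sub0r !normrN (gtr0_norm h2); lra.
  - by have := ler_norm (s - t); rewrite subr0 (gtr0_norm h1); lra.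
have yt0 := hsq_ge0 l (W (p t)).
pose eta := Num.min 1 (e / 2 / (2 * y (p t) + 2)).
have den : 0 < 2 * y (p t) + 2 by rewrite ltr_wpDl// mulr_ge0.
have eta0 : 0 < eta by rewrite lt_min ltr01 !divr_gt0.
pose q := Num.min 1 (e / 2 / (1 + eta^-1)).
have den2 : 0 < 1 + eta^-1 by rewrite addr_gt0// invr_gt0.
have q0 : 0 < q by rewrite lt_min ltr01 !divr_gt0.
have [d d0 hd] := Wdist (p0 t) q0.
exists d => // s /= st; rewrite /Y -/(p s) -/(p t).
have hs := hd (p s) (p0 s) (le_lt_trans (pd s) (_ : `|s - t| < d)).
have {}hs : sumle (fun k => wt l k * normc (W (p s) k - W (p t) k) ^+ 2) q.
  by apply: hs; rewrite distrC.
have hs' : sumle (fun k => wt l k * normc (W (p t) k - W (p s) k) ^+ 2) q.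
  by apply: le_sumle hs => k; rewrite normc_distC.
have a1 := y_quasi (p0 s) (p0 t) eta0 hs.
have a2 := y_quasi (p0 t) (p0 s) eta0 hs'.
have a3 := y_quasi (p0 s) (p0 t) ltr01 hs.
have q1 : q <= 1 by rewrite /q ge_min lexx.
have q2 : (1 + eta^-1) * q <= e / 2 by rewrite mulrC -ler_pdivlMr// /q ge_min lexx orbT.
have e1 : eta * (2 * y (p t) + 2) <= e / 2 by rewrite -ler_pdivlMr// /eta ge_min lexx orbT.
rewrite invr1 in a3.
exact: (quasi_close (hsq_ge0 l (W (p s))) (hsq_ge0 l (W (p t))) eta0 q1 a1 a2 a3 q2 e1).
Qed.

Let zcoef t k : 0 <= t -> fourier (fun x => ut t x + u t x) k = 2%:C * fourier (ut t) k + W t k.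
Proof.
move=> t0; rewrite /W fourierD ?fourierB; try (exact: su || exact: sut).
by rewrite rmorphMn /= rmorph1; ring.
Qed.

Let zsum t : 0 <= t -> sumle (fun k => wt l k * normc (fourier (fun x => ut t x + u t x) k) ^+ 2)
  (80 * rho ^+ 2 + 2 * y t).
Proof.
move=> t0.
have hU : sumle (fun k => wt l k * normc (2%:C * fourier (ut t) k) ^+ 2) (4 * rho ^+ 2 * 10).
  apply: le_sumle (sumleZ _ (sum_br R)) => [k|]; last by rewrite mulr_ge0 ?sqr_ge0.
  rewrite normcM normc_real ger0_norm// exprMn.
  have h : normc (fourier (ut t) k) ^+ 2 <= (rho / wt (l / 2 + 1) k) ^+ 2.
    by rewrite ler_sqr ?nnegrE ?normc_ge0 ?divr_ge0 ?wt_ge0// but.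
  apply: (@le_trans _ _ (wt l k * (2 ^+ 2 * (rho / wt (l / 2 + 1) k) ^+ 2))).
    by rewrite ler_wpM2l ?wt_ge0// ler_wpM2l.
  have w0 := wt_gt0 (l / 2) k; have b0 := br_gt0 R k; have b1 := br_ge1 R k.
  rewrite wtD wt1 -(wt_half l).
  have -> : wt (l / 2) k ^+ 2 * (2 ^+ 2 * (rho / (wt (l / 2) k * br k)) ^+ 2) = 4 * rho ^+ 2 * ((br k)^-1 * (br k)^-1).
    by field; rewrite !gt_eqF.
  have ib : 0 <= (br k)^-1 by rewrite invr_ge0 ltW.
  have i1 : (br k)^-1 <= 1 by rewrite invf_le1.
  apply: ler_wpM2l; first by rewrite mulr_ge0 ?sqr_ge0.
  by rewrite ler_piMl.
have := sumle_hD ltr01 hU (y_self t0).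
rewrite invr1; have -> : (1 + 1) * (4 * rho ^+ 2 * 10) + (1 + 1) * y t = 80 * rho ^+ 2 + 2 * y t by ring.
by apply: le_sumle => k; rewrite zcoef.
Qed.

Let Hbound t k : 0 <= t ->
  wt l k * normc (H t k) ^+ 2 <= 4 * 4 `^ l * ((80 * rho ^+ 2 + 2 * y t) * y t).
Proof.
move=> t0; have sz := sqintD (sut t0) (su t0); have sw := sqintB (su t0) (sut t0).
set G := leRHS; have w0 := wt_gt0 l k.
have y0 : 0 <= y t by exact: hsq_ge0.
have G0 : 0 <= G by rewrite /G !mulr_ge0 ?powR_ge0 ?addr_ge0 ?mulr_ge0 ?sqr_ge0.
have Gw : 0 <= G / wt l k by rewrite divr_ge0// ltW.
have hH : normc (H t k) <= Num.sqrt (G / wt l k).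
  apply: convolution_bound => // n.
  have := conv_weighted l0 k n (zsum t0) (y_self t0); rewrite -/G => h.
  rewrite -(ler_sqr (normc_ge0 _) (sqrtr_ge0 _)) (sqr_sqrtr Gw).
  by rewrite ler_pdivlMr// mulrC.
have : normc (H t k) ^+ 2 <= G / wt l k.
  rewrite -[leRHS](sqr_sqrtr Gw).
  by rewrite ler_sqr ?nnegrE ?normc_ge0 ?sqrtr_ge0.
by rewrite ler_pdivlMr// mulrC.
Qed.

(** Half of the dissipation 2 c0 |W|^2 pays for Young's inequality on the flux. As freq^2 <= br, the
    term in |H|^2 retains one factor 1 / br, which is needed for the sum over k. *)
Let rate k t : 0 <= t ->
  2 * ipc (W t k) (mode_rhs beta gamma k (W t k) (H t k)) <=
  - c0 * normc (W t k) ^+ 2 + (4 * c0)^-1 * (normc (H t k) ^+ 2 / br k).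
Proof.
move=> t0; have b0 := br_gt0 R k; have b1 := br_ge1 R k.
have H0 := normc_ge0 (H t k); have Wn := normc_ge0 (W t k).
have c4 : 0 <= (4 * c0)^-1 by rewrite invr_ge0 mulr_ge0// ltW.
have hpos : 0 <= (4 * c0)^-1 * (normc (H t k) ^+ 2 / br k).
  by apply: mulr_ge0 => //; rewrite divr_ge0 ?sqr_ge0// ltW.
have [k0|k0] := eqVneq k 0.
  have w0 : W t k = 0 by rewrite k0; exact: W0.
  by rewrite w0 normc0 /ipc [X in 2 * X](_ : _ = 0) ?expr0n /= ?mulr0 ?add0r// !mul0r addr0.
have [_ /(_ k k0) hk] := hc.
rewrite ipc_mode_rhs.
set X := Im (W t k) * Re (H t k) - Re (W t k) * Im (H t k).
have hX : `|X| <= normc (W t k) * normc (H t k).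
  have -> : X = ipc (W t k) ((- Im (H t k)) +i* Re (H t k)) by rewrite /ipc /X /=; ring.
  rewrite (le_trans (ler_ipc _ _))// ler_wpM2l//.
  by rewrite -(ler_sqr (normc_ge0 _) (normc_ge0 _)) !sqr_normcE /= sqrrN; lra.
set w := normc (W t k) in Wn hX *; set h := normc (H t k) in H0 hX hpos *.
have hfX : - (freq k * X) <= `|freq k| * (w * h).
  by rewrite (le_trans (ler_norm _))// normrN normrM ler_wpM2l.
have f2 : `|freq k : R| ^+ 2 <= br k by rewrite real_normK ?num_real// /br lerDr.
have key : `|freq k| * (w * h) / br k <= c0 * w ^+ 2 + (4 * c0)^-1 * (h ^+ 2 / br k).
  set F := `|freq k : R| in f2 *.
  have : 0 <= (2 * c0 * w - F * h / br k) ^+ 2 / (4 * c0).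
    by rewrite divr_ge0 ?sqr_ge0 ?mulr_ge0// ltW.
  have -> : (2 * c0 * w - F * h / br k) ^+ 2 / (4 * c0) =
     c0 * w ^+ 2 - F * (w * h) / br k + (4 * c0)^-1 * (h ^+ 2 / br k) * (F ^+ 2 / br k).
    by field; rewrite !gt_eqF.
  have : (4 * c0)^-1 * (h ^+ 2 / br k) * (F ^+ 2 / br k) <= (4 * c0)^-1 * (h ^+ 2 / br k).
    by rewrite ler_piMr// ler_pdivrMr// mul1r.
  lra.
have e : 2 * ((- (beta + gamma * freq k ^+ 2) * w ^+ 2 - freq k / 2 * X) / br k) =
   - 2 * ((beta + gamma * freq k ^+ 2) / br k) * w ^+ 2 + (- (freq k * X)) / br k.
  by field; rewrite gt_eqF.
rewrite e.
have h1 : (- (freq k * X)) / br k <= `|freq k| * (w * h) / br k.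
  by rewrite ler_wpM2r// invr_ge0 ltW.
have h2 : c0 * w ^+ 2 <= (beta + gamma * freq k ^+ 2) / br k * w ^+ 2.
  by rewrite ler_wpM2r ?sqr_ge0// ler_pdivlMr.
lra.
Qed.

Lemma perturbation_decay : y 0 < a -> forall t, 0 <= t -> expR (c0 / 2 * t) * y t <= y 0.
Proof.
move=> ya.
have ode k : exists2 V : R -> R[i], (forall t, 0 <= t -> V t = W t k) &
    (forall t, 0 <= t -> cderiv V t (mode_rhs beta gamma k (W t k) (H t k))).
  have [V hV dV] := mild_difference_ode l0 hf hu hut k.
  by exists V => // t t0; apply: cderiv_eq (dV t t0) _; rewrite /mode_rhs hV.
have hch k : {V : R -> R[i] | (forall t, 0 <= t -> V t = W t k) /\
  (forall t, 0 <= t -> cderiv V t (mode_rhs beta gamma k (W t k) (H t k)))}.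
  by apply: cid; have [V h1 h2] := ode k; exists V.
pose V k := sval (hch k).
have hV k t : 0 <= t -> V k t = W t k by exact: (svalP (hch k)).1.
have dV k t : 0 <= t -> cderiv (V k) t (mode_rhs beta gamma k (W t k) (H t k)).
  exact: (svalP (hch k)).2.
pose yn (n : nat) s := \sum_(k <- box n) wt l k * normc (V k s) ^+ 2.
pose dyn (n : nat) s := \sum_(k <- box n) wt l k * (2 * ipc (V k s) (mode_rhs beta gamma k (W s k) (H s k))).
have ynE n s : 0 <= s -> yn n s = \sum_(k <- box n) wt l k * normc (W s k) ^+ 2.
  by move=> s0; apply: eq_bigr => k _; rewrite hV.
have dyP n (s : R) : 0 <= s -> is_derive s 1 (yn n) (dyn n s).
  by move=> s0; apply: isd_sum => k; apply: isdZ; apply: is_derive_sqr_normc; exact: dV.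
have YE s : 0 <= s -> Y s = y s by move=> s0; rewrite /Y (max_idPl s0).
have yY n s : 0 <= s -> yn n s <= Y s.
  by move=> s0; rewrite ynE// YE//; exact: y_self.
have lub s B : 0 <= s -> (forall n, yn n s <= B) -> Y s <= B.
  by move=> s0 hB; rewrite YE//; apply/(yP _ s0) => n; rewrite -ynE.
have Y0 : Y 0 = y 0 by exact: YE.
have decay T : 0 <= T -> (forall s, 0 <= s <= T -> Y s <= a) ->
    forall t, 0 <= t <= T -> expR (c0 / 2 * t) * Y t <= Y 0.
  move=> T0 hT; apply: (exponential_decay c0_gt0 T0 Y_cont dyP yY lub).
  move=> n t /andP[t0 tT].
  have hya : y t <= a by rewrite -(YE _ t0); apply: hT; rewrite t0 tT.
  have y0 : 0 <= y t by exact: hsq_ge0.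
  rewrite (YE _ t0) (ynE _ _ t0) /dyn.
  pose G := 4 * 4 `^ l * ((80 * rho ^+ 2 + 2 * y t) * y t).
  have G0 : 0 <= G by rewrite /G !mulr_ge0 ?powR_ge0 ?addr_ge0 ?mulr_ge0 ?sqr_ge0.
  apply: (@le_trans _ _ (\sum_(k <- box n) (- c0 * (wt l k * normc (W t k) ^+ 2) + (4 * c0)^-1 * G * (br k)^-1))).
    apply: ler_sum => k _; rewrite (hV _ _ t0).
    have := ler_wpM2l (wt_ge0 l k) (rate k t0).
    have := ler_wpM2r (_ : 0 <= (4 * c0)^-1 * (br k)^-1) (Hbound k t0).
    have ib : 0 <= (4 * c0)^-1 * (br k)^-1.
      by apply: (mulr_ge0 c4V_ge0); rewrite invr_ge0; exact: ltW (br_gt0 R k).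
    move=> /(_ ib); rewrite -/G => h1 h2; apply: (le_trans h2).
    exact: rate_sum h1.
  rewrite big_split/= -mulr_sumr lerD2l -mulr_sumr.
  have c40 : 0 <= (4 * c0)^-1 * G by exact: mulr_ge0 c4V_ge0 G0.
  apply: (@le_trans _ _ ((4 * c0)^-1 * G * 10)); first exact: ler_wpM2l c40 _ _ (sum_br R n).
  (* The part coming from ut is at most c0 / 4 by [hrho] and the part quadratic in the perturbation
     by y <= a; their sum c0 / 2 is the rate that [exponential_decay] tolerates for s = c0. *)
  have -> : (4 * c0)^-1 * G * 10 = (K1 * (80 * rho ^+ 2) + K1 * (2 * y t)) * y t.
    by rewrite /G /K1; field; rewrite gt_eqF.
  apply: ler_wpM2r; first exact: y0.
  have h2 : K1 * (2 * y t) <= c0 / 4.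
    have -> : K1 * (2 * y t) = y t * (2 * K1) by ring.
    by rewrite -(ler_pdivlMr _ _ K2_gt0); exact: hya.
  exact: quarters hrho h2.
have Ya : forall t, 0 <= t -> Y t < a.
  apply: (bootstrap Y_cont); first by rewrite Y0; exact: ya.
  move=> T T0 hT; have := decay T T0 hT T; rewrite T0 lexx => /(_ isT).
  have yT0 : 0 <= Y T by rewrite (YE _ T0); exact: hsq_ge0.
  have h1 : 1 <= expR (c0 / 2 * T).
    by rewrite -[leLHS]expR0 ler_expR; exact: mulr_ge0 c2_ge0 T0.
  by move=> h2; apply: le_lt_trans ya; rewrite -Y0; apply: le_trans h2; rewrite ler_peMl.
move=> t t0; have := decay t t0 (fun s h => ltW (Ya s (proj1 (andP h)))) t.
by rewrite t0 lexx (YE _ t0) Y0 => h; exact: h isT.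
Qed.

End Perturbation.

Lemma stability : locally_stable l beta gamma f ut.
Proof.
exists (Num.sqrt (a / 2)); first by rewrite sqrtr_gt0 divr_gt0.
move=> u hu h0; have a2 : 0 < a / 2 by rewrite divr_gt0.
have b0 : 0 <= Num.sqrt (a / 2) by exact: sqrtr_ge0.
pose y t := hsq l (fun k => fourier (fun x => u t x - ut t x) k).
have y0a : y 0 < a.
  have hs : sumle (fun k => wt l k * normc (fourier (fun x => u 0 x - ut 0 x) k) ^+ 2) (a / 2).
    by have := (Hnorm_leP l _ b0).1 (ltW h0); rewrite sqr_sqrtr// ltW.
  have : y 0 <= a / 2 by apply/(hsqP hs).
  lra.
have dec := perturbation_decay hu y0a.
apply/(cvge0P _ (fun t => Hnorm_ge0 l _)) => e e0.
have y00 : 0 <= y 0 by exact: hsq_ge0.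
(* By e^x >= 1 + x, the factor e^(c0 t / 2) exceeds y 0 / e^2 for t >= T, so that the squared norm
   has dropped to e^2. *)
pose T := (2 / c0) * (y 0 / e ^+ 2).
exists (Num.max T 0); split; first exact: num_real.
move=> t; rewrite gt_max => /andP[tT t0].
have {}dec := dec t (ltW t0).
have he : 0 < e ^+ 2 by rewrite exprn_gt0.
have ye : y t <= e ^+ 2.
  have h1 : y 0 / e ^+ 2 <= expR (c0 / 2 * t).
    apply: le_trans (expR_ge1Dx _).
    have -> : y 0 / e ^+ 2 = c0 / 2 * T by rewrite /T; field; rewrite !gt_eqF.
    have cT : c0 / 2 * T <= c0 / 2 * t by apply: (ler_wpM2l c2_ge0); exact: ltW.
    by apply: (le_trans cT); rewrite lerDr ler01.
  have yt0 : 0 <= y t by exact: hsq_ge0.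
  rewrite ler_pdivrMr// in h1.
  have ep := expR_gt0 (c0 / 2 * t).
  by rewrite -(ler_pM2l ep) (le_trans dec).
apply/(Hnorm_leP _ _ (ltW e0)).
have [hu1 _ _] := hu; have [hut1 _ _] := hut.
have [C hC] : exists C, sumle (fun k => wt l k * normc (fourier (fun x => u t x - ut t x) k) ^+ 2) C.
  have fin_coef g : Hper0 l g -> exists C, sumle (fun k => wt l k * normc (fourier g k) ^+ 2) C.
    by move=> [[_ /Hnorm_fin[b bb0 /(Hnorm_leP _ _ bb0) h]] _]; exists (b ^+ 2).
  have [C hC] := fin_coef _ (hut1 t (ltW t0)); have [D hD] := fin_coef _ (hu1 t (ltW t0)).
  exists ((1 + 1) * D + (1 + 1^-1) * C).
  apply: le_sumle (sumle_hD ltr01 hD (_ : sumle (fun k => wt l k * normc (- fourier (ut t) k) ^+ 2) C)).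
    move=> k; rewrite fourierB//; [exact: Hper0_sqint (hu1 t (ltW t0))|exact: Hper0_sqint (hut1 t (ltW t0))].
  by apply: le_sumle hC => k; rewrite normcN.
by apply/(hsqP hC).
Qed.

End Stability.

(** * Existence *)

Section Synthesis.
Variable R : realType.
Notation mu := (@lebesgue_measure R).
Implicit Types (k j : int) (n m : nat) (x : R).

Section AbsoluteConvergence.
Variables (q G : int -> R) (B : R).
Hypotheses (qG : forall k, `|q k| <= G k) (GB : sumle G B).

Let G0 k : 0 <= G k. Proof. exact: le_trans (normr_ge0 _) (qG k). Qed.
Let Gs n := \sum_(k <- box n) G k.
Let qs n := \sum_(k <- box n) q k.

Lemma sum_box_ndecr (F : int -> R) : (forall k, 0 <= F k) ->
  nondecreasing_seq (fun n => \sum_(k <- box n) F k).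
Proof. by move=> F0 m n mn; exact: ler_sum_box. Qed.

Lemma cvg_sum_box (F : int -> R) C : (forall k, 0 <= F k) -> sumle F C ->
  cvgn (fun n => \sum_(k <- box n) F k).
Proof.
move=> F0 FC; apply: nondecreasing_is_cvgn; first exact: sum_box_ndecr.
by exists C => _ [n _ <-]; exact: FC.
Qed.

Lemma cvg_abs_sum_box : cvgn qs.
Proof.
have h1 := cvg_sum_box G0 GB.
have h2 : cvgn (fun n => \sum_(k <- box n) (q k + G k)).
  apply: (@cvg_sum_box _ (B + B)) => [k|n]; first by have := qG k; rewrite ler_norml; lra.
  rewrite big_split /= lerD//; apply: le_trans (GB n); apply: ler_sum => k _.
  by rewrite (le_trans (ler_norm _)).
have -> : qs = (fun n => \sum_(k <- box n) (q k + G k)) \- (fun n => \sum_(k <- box n) G k).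
  by apply/funext => n /=; rewrite -sumrB; apply: eq_bigr => k _; rewrite addrK.
exact: is_cvgB.
Qed.

(** G - q and G + q are nonnegative, so both one-sided bounds are the monotonicity of their partial
    sums. *)
Lemma abs_sum_box_dist m n : (m <= n)%N -> `|qs n - qs m| <= Gs n - Gs m.
Proof.
move=> mn; have h1 := ler_sum_box (F := fun k => G k - q k) (fun k => _) mn.
have h2 := ler_sum_box (F := fun k => G k + q k) (fun k => _) mn.
rewrite !sumrB in h1; rewrite !big_split /= in h2.
rewrite ler_norml /Gs /qs; apply/andP; split.
  suff : \sum_(k <- box m) G k + \sum_(k <- box m) q k <= \sum_(k <- box n) G k + \sum_(k <- box n) q k by lra.
  by apply: h2 => k; have := qG k; rewrite ler_norml; lra.
suff : \sum_(k <- box m) G k - \sum_(k <- box m) q k <= \sum_(k <- box n) G k - \sum_(k <- box n) q k by lra.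
by apply: h1 => k; have := qG k; rewrite ler_norml; lra.
Qed.

Lemma abs_sum_box_tail m : `|limn qs - qs m| <= limn Gs - Gs m.
Proof.
have cq := cvg_abs_sum_box; have cG := cvg_sum_box G0 GB.
have h1 : (fun n => `|qs n - qs m|) @ \oo --> `|limn qs - qs m|.
  by apply: cvg_norm; apply: cvgB => //; exact: cvg_cst.
have h2 : (fun n => Gs n - Gs m) @ \oo --> limn Gs - Gs m.
  by apply: cvgB => //; exact: cvg_cst.
apply: (ler_cvg_to h1 h2); near=> n; apply: abs_sum_box_dist.
by near: n; exact: nbhs_infty_ge.
Unshelve. all: by end_near. Qed.

Lemma lim_sum_box_le : limn Gs <= B.
Proof. by apply: limr_le; [exact: cvg_sum_box G0 GB|near=> n; exact: GB]. Unshelve. all: by end_near. Qed.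

End AbsoluteConvergence.

Definition synth (c : int -> R[i]) : R -> R :=
  fun x => limn (fun n => tpoly (fun k => Re (c k)) (fun k => - Im (c k)) n x).

Variables (c : int -> R[i]) (rho : R).
Hypotheses (cN : forall k, c (- k) = (Re (c k)) +i* (- Im (c k)))
  (cb : forall k, normc (c k) <= rho / br R k).

Let p n := tpoly (fun k => Re (c k)) (fun k => - Im (c k)) n.
Let q k x := Re (c k) * cosk k x + - Im (c k) * sink k x.
Let G k := 2 * rho * (br R k)^-1.

Let rho0 : 0 <= rho.
Proof. by have := le_trans (normc_ge0 _) (cb 0); rewrite pmulr_lge0// invr_gt0 br_gt0. Qed.

Let GB : sumle G (20 * rho).
Proof.
have -> : 20 * rho = 2 * rho * 10 by ring.
by apply: sumleZ; [rewrite mulr_ge0|exact: sum_br].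
Qed.

Let qG x k : `|q k x| <= G k.
Proof.
have -> : G k = rho / br R k + rho / br R k by rewrite /G; ring.
rewrite (le_trans (ler_normD _ _))// lerD// normrM.
  rewrite (le_trans (ler_piMr (normr_ge0 _) (cosk_max _ _)))//.
  exact: le_trans (ler_Re _) (cb k).
rewrite (le_trans (ler_piMr (normr_ge0 _) (sink_max _ _)))// normrN.
exact: le_trans (ler_Im _) (cb k).
Qed.

Let p_cvg x : p ^~ x @ \oo --> synth c x.
Proof. exact: (@cvg_abs_sum_box (q^~ x) G _ (qG x) GB). Qed.

Lemma synth_periodic : periodic1 (synth c).
Proof.
move=> x; rewrite /synth; congr (limn _); apply/funext => n.
by apply: eq_bigr => k _; rewrite cosk_periodic sink_periodic.
Qed.

Lemma measurable_synth : measurable_fun [set: R] (synth c).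
Proof.
apply: (@measurable_fun_cvg _ (measurableTypeR R) _ setT p).
  by move=> n; have [] := sqint_tpoly (fun k => Re (c k)) (fun k => - Im (c k)) n.
by move=> x _; exact: p_cvg.
Qed.

Lemma synth_max x : `|synth c x| <= 20 * rho.
Proof.
have h := @abs_sum_box_tail (q^~ x) G _ (qG x) GB 0.
have h2 := @lim_sum_box_le (q^~ x) G _ (qG x) GB.
have h0 : `|\sum_(k <- box 0) q k x| <= \sum_(k <- box 0) G k.
  by rewrite (le_trans (ler_norm_sum _ _ _))//; apply: ler_sum => k _; exact: qG.
have := ler_normD (synth c x - \sum_(k <- box 0) q k x) (\sum_(k <- box 0) q k x).
rewrite subrK => /le_trans; apply; apply: le_trans (lerD h h0) _.
by rewrite subrK.
Qed.

Lemma sqint_synth : sqint (synth c).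
Proof. exact: sqint_bounded measurable_synth synth_max. Qed.

Let fourier_p n k : (`|k| <= n)%N -> fourier (p n) k = c k.
Proof.
move=> kn; have sp : sqint (p n) by exact: sqint_tpoly.
have ReN j : Re (c (- j)) = Re (c j) by rewrite cN.
have ImN j : Im (c (- j)) = - Im (c j) by rewrite cN.
have kn' : (`|- k| <= n)%N by rewrite abszN.
apply: complex_eqP.
  rewrite Re_fourier /ccoef int01_tpoly; last exact/sqint_intg/sqint_cosk.
  under eq_bigr => j _ do rewrite ccoef_cosk scoef_cosk mulr0 addr0 mulrA mulrDr mulrDl.
  rewrite big_split /=.
  under eq_bigr => j _ do rewrite mulrAC.
  under [X in _ + X]eq_bigr => j _ do rewrite mulrAC.
  by rewrite !(sum_box_delta (fun j => Re (c j) / 2))// ReN -splitr.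
rewrite Im_fourier// /scoef int01_tpoly; last exact/sqint_intg/sqint_sink.
under eq_bigr => j _ do rewrite ccoef_sink scoef_sink mulr0 add0r mulrA mulrBr mulrBl.
rewrite sumrB.
under eq_bigr => j _ do rewrite mulrAC.
under [X in _ - X]eq_bigr => j _ do rewrite mulrAC.
rewrite !(sum_box_delta (fun j => - Im (c j) / 2))// ImN; lra.
Qed.

(** The partial sums converge uniformly, and by the Bessel inequality a uniformly small function has
    small coefficients. *)
Lemma fourier_synth k : fourier (synth c) k = c k.
Proof.
apply/eqP; rewrite -subr_eq0; apply/eqP/normc0_eq0/ler_addgt0Pr => e e0; rewrite add0r.
have cG := cvg_sum_box (fun k => le_trans (normr_ge0 _) (qG 0 k)) GB.
move/cvgrPdist_le : (cG) => /(_ _ e0)[N _ hN].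
pose n := maxn N `|k|%N; have kn : (`|k| <= n)%N by rewrite leq_maxr.
have sp : sqint (p n) by exact: sqint_tpoly.
rewrite -(fourier_p kn) -fourierB//; last exact: sqint_synth.
have sd := sqintB sqint_synth sp.
have hd x : `|synth c x - p n x| <= e.
  apply: le_trans (@abs_sum_box_tail (q^~ x) G _ (qG x) GB n) _.
  by apply: le_trans (ler_norm _) (hN n _); rewrite /= leq_maxl.
have := sumle1 k (fun j => sqr_ge0 _) (bessel sd) => h.
rewrite -(ler_sqr (normc_ge0 _) (ltW e0)) (le_trans h)//.
rewrite -[leRHS]int01_cst; apply: int01_le => [||x]; first by case: sd.
  exact: itg_cst.
by rewrite -[_ ^+ 2]real_normK ?num_real// ler_sqr ?nnegrE// ltW.
Qed.

End Synthesis.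

(** * Conjugation symmetry and the modulus of e^(hA) - 1 *)

Section Conjugation.
Variable R : realType.
Notation mu := (@lebesgue_measure R).
Implicit Types (z w A : R[i]) (F g : R -> R[i]) (k : int).

Lemma conjcM z w : conjc (z * w) = conjc z * conjc w. Proof. exact: rmorphM. Qed.
Lemma conjcD z w : conjc (z + w) = conjc z + conjc w. Proof. exact: rmorphD. Qed.
Lemma conjcV z : conjc z^-1 = (conjc z)^-1. Proof. exact: fmorphV. Qed.
Lemma conjc1B z : conjc (1 - z) = 1 - conjc z. Proof. by rewrite rmorphB rmorph1. Qed.

Lemma conjc_real (x : R) : conjc (x%:C) = x%:C.
Proof. by rewrite conjcE /= oppr0. Qed.

Lemma normc_conj z : normc (conjc z) = normc z.
Proof.
apply/eqP; rewrite -(eqrXn2 (n := 2))// ?normc_ge0// !sqr_normcE conjcE /= sqrrN.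
by [].
Qed.

Lemma conjc_cexp z : conjc (cexp z) = cexp (conjc z).
Proof. by rewrite !conjcE /cexp /= cosN sinN mulrN. Qed.

Lemma conjc_cintegral (a b : R) F : lbm F ->
  conjc (cintegral `[a, b] F) = cintegral `[a, b] (fun s => conjc (F s)).
Proof.
move=> hF; have [_ i2] := lbm_integrable a b hF.
rewrite conjcE /cintegral /=; congr (_ +i* _).
  by apply: eq_Rintegral => s _; rewrite conjcE.
rewrite -[LHS]mulN1r -RintegralZl//.
by apply: eq_Rintegral => s _; rewrite conjcE /= mulN1r.
Qed.

Lemma conjc_duhamel A w g t : lbm g ->
  conjc (duhamel A w g t) = duhamel (conjc A) (conjc w) (fun s => conjc (g s)) t.
Proof.
move=> hg; rewrite /duhamel conjcM conjcD conjc_cexp conjcM conjc_real.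
rewrite conjc_cintegral; last by apply: lbmM => //; exact: lbm_cexpN.
congr (_ * (_ + _)); apply: cintegral_congr => s _.
by rewrite conjcM conjc_cexp conjcM conjc_real.
Qed.

Lemma normc_cexp_sub1 A (h : R) : Re A <= 0 -> 0 <= h ->
  normc (cexp (h%:C * A) - 1) <= 2 * h * normc A.
Proof.
move=> A0 h0.
have bd (s : R) : 0 <= s -> normc (A * cexp (s%:C * A)) <= normc A.
  move=> s0; rewrite normcM normc_cexp ler_piMr ?normc_ge0//.
  by rewrite -expR0 ler_expR ReM /= mul0r subr0 mulr_ge0_le0.
have mvt (f df : R -> R) : (forall s : R, is_derive s 1 f (df s)) ->
    (forall s, 0 <= s -> `|df s| <= normc A) -> `|f h - f 0| <= h * normc A.
  move=> hd hb.
  have cf : {within `[0, h], continuous f}.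
    by apply: continuous_subspaceT => y; exact: isd_cont (hd y).
  have [c hc ->] := @MVT_segment _ f df 0 h h0 (fun x _ => hd x) cf.
  rewrite subr0 normrM (ger0_norm h0) mulrC ler_wpM2l//; apply: hb.
  by move: hc; rewrite in_itv/= => /andP[].
have e0 : cexp ((0 : R)%:C * A) = 1 by rewrite mul0r cexp0.
have hR := mvt _ _ (fun s => (cderiv_cexp A s).1) (fun s s0 => le_trans (ler_Re _) (bd s s0)).
have hI := mvt _ _ (fun s => (cderiv_cexp A s).2) (fun s s0 => le_trans (ler_Im _) (bd s s0)).
rewrite (le_trans (normc_le_ReIm _))// -[X in _ - X]e0 ReB ImB -mulrA mulr_natl mulr2n.
exact: lerD.
Qed.

End Conjugation.

(** * The periodic solution of one forced linear mode *)

Section PeriodicMode.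
Variable R : realType.
Notation mu := (@lebesgue_measure R).
Implicit Types (A : R[i]) (g h : R -> R[i]).

(* The initial value solves w = e^(th A) (w + int_0^th e^(- s A) g(s) ds), so
   that the mode takes the same value at the times 0 and th. *)
Definition periodic_duhamel (th : R) A g (t : R) : R[i] :=
  duhamel A ((1 - cexp (th%:C * A))^-1 *
    (cexp (th%:C * A) * cintegral `[0, th] (fun s => cexp ((- s)%:C * A) * g s))) g t.

(** A bound for the periodic solution operator: the integral over one period costs 2 th, and the
    initial value the same divided by 1 - e^(- c0 th), a lower bound for |1 - e^(th A)|. *)
Definition periodic_cst (th c0 : R) : R := 2 * th * ((1 - expR (- (c0 * th)))^-1 + 1).

Lemma periodic_cst_ge0 th c0 : 0 < th -> 0 < c0 -> 0 <= periodic_cst th c0.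
Proof.
move=> th0 c00; rewrite /periodic_cst mulr_ge0 ?(mulr_ge0 _ (ltW th0))// addr_ge0// invr_ge0 subr_ge0.
by rewrite -[leRHS]expR0 ler_expR oppr_le0 mulr_ge0// ltW.
Qed.

Lemma conjc_periodic_duhamel th A g t : lbm g ->
  conjc (periodic_duhamel th A g t) = periodic_duhamel th (conjc A) (fun s => conjc (g s)) t.
Proof.
move=> hg; rewrite /periodic_duhamel conjc_duhamel//; congr (duhamel _ _ _ _).
rewrite conjcM conjcV conjc1B conjcM conjc_cexp conjcM conjc_real.
rewrite conjc_cintegral; last by apply: lbmM => //; exact: lbm_cexpN.
congr (_ * (_ * _)); apply: cintegral_congr => s _.
by rewrite conjcM conjc_cexp conjcM conjc_real.
Qed.

Variables (th c0 M0 : R) (A : R[i]).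
Hypotheses (th0 : 0 < th) (c00 : 0 < c0) (ReA : Re A <= - c0) (AM : normc A <= M0).

Let q := 1 - expR (- (c0 * th)).
Let q0 : 0 < q.
Proof. by rewrite subr_gt0 -expR0 ltr_expR oppr_lt0 mulr_gt0. Qed.

Let E t := cexp (t%:C * A).
Let ED s t : E (s + t) = E s * E t.
Proof. by rewrite /E rmorphD /= mulrDl cexpD. Qed.
Let ENK t : E (- t) * E t = 1.
Proof. by rewrite -ED addNr /E mul0r cexp0. Qed.
Let E_le1 t : 0 <= t -> normc (E t) <= 1.
Proof.
move=> t0; rewrite normc_cexp -expR0 ler_expR ReM /= mul0r subr0 mulr_ge0_le0//.
by apply: le_trans ReA _; rewrite oppr_le0 ltW.
Qed.
Let I a b g := cintegral `[a, b] (fun s => E (- s) * g s).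
Let lbmE g : lbm g -> lbm (fun s => E (- s) * g s).
Proof. by move=> hg; apply: lbmM => //; exact: lbm_cexpN. Qed.
Let w0 g := (1 - E th)^-1 * (E th * I 0 th g).

Let q_le : q <= normc (1 - E th).
Proof.
have := ler_Re (1 - E th); apply: le_trans; rewrite ReB -[Re 1]/1.
apply: le_trans (ler_norm _); rewrite lerD2l lerN2.
apply: le_trans (ler_norm _) _; apply: le_trans (ler_Re _) _.
by rewrite normc_cexp ler_expR ReM /= mul0r subr0 mulrC -mulNr ler_wpM2r// ltW.
Qed.

Let nz : 1 - E th != 0.
Proof. by apply/eqP => e; have := q_le; rewrite e normc0 leNgt q0. Qed.

Let tail_bound a t B g : a <= t -> lbm g -> (forall s, a <= s <= t -> normc (g s) <= B) ->
  normc (E t * I a t g) <= 2 * B * (t - a).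
Proof.
move=> at_ hg hB; rewrite /I -cintegralZ; last exact: lbmE.
have e s : E t * (E (- s) * g s) = E (t - s) * g s by rewrite mulrA -ED.
apply: normc_cintegral => //; first by apply: lbmM (lbm_cst _) (lbmE hg).
move=> s /andP[as_ st]; rewrite e normcM.
apply: le_trans (hB s _); last by rewrite as_ st.
by rewrite ler_piMl ?normc_ge0// E_le1// subr_ge0.
Qed.

Let w0_bound B g : lbm g -> (forall s, 0 <= s <= th -> normc (g s) <= B) ->
  normc (w0 g) <= q^-1 * (2 * B * th).
Proof.
move=> hg hB; rewrite /w0 normcM.
have := tail_bound (ltW th0) hg hB; rewrite subr0 => h.
apply: ler_pM => //; rewrite ?normc_ge0//.
have e : normc (1 - E th)^-1 * normc (1 - E th) = 1.
  by rewrite -normcM mulVf// -[1]/(1%:C) normc_real normr1.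
have n0 : 0 < normc (1 - E th) by exact: lt_le_trans q_le.
have -> : normc (1 - E th)^-1 = (normc (1 - E th))^-1.
  have nn : normc (1 - E th) != 0 by rewrite gt_eqF.
  by apply: (mulIf nn); rewrite e mulVf.
by rewrite lef_pV2 ?posrE.
Qed.

Let periodic_duhamelE g t : periodic_duhamel th A g t = E t * (w0 g + I 0 t g). Proof. by []. Qed.

Let C1 := periodic_cst th c0.

Let periodic_duhamel_bound1 B g t : lbm g -> (forall s, 0 <= s <= th -> normc (g s) <= B) ->
  0 <= t <= th -> normc (periodic_duhamel th A g t) <= C1 * B.
Proof.
move=> hg hB /andP[t0 tth].
have B0 : 0 <= B by apply: le_trans (normc_ge0 (g 0)) (hB 0 _); rewrite lexx ltW.
rewrite periodic_duhamelE mulrDr (le_trans (normcD _ _))//.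
have h1 : normc (E t * w0 g) <= q^-1 * (2 * B * th).
  by rewrite normcM (le_trans _ (w0_bound hg hB))// ler_piMl ?normc_ge0// E_le1.
have h2 : normc (E t * I 0 t g) <= 2 * B * t.
  have hB' s : 0 <= s <= t -> normc (g s) <= B.
    by move=> /andP[s0 st]; apply: hB; rewrite s0 (le_trans st).
  by have := tail_bound t0 hg hB'; rewrite subr0.
have h3 : 2 * B * t <= 2 * B * th by rewrite ler_wpM2l// mulr_ge0.
have -> : C1 * B = q^-1 * (2 * B * th) + 2 * B * th by rewrite /C1 /periodic_cst -/q; ring.
by rewrite lerD// (le_trans h2).
Qed.

Lemma periodic_duhamel_shift g t : lbm g -> {ae mu, forall s, 0 <= s -> g (s + th) = g s} ->
  0 <= t -> periodic_duhamel th A g (t + th) = periodic_duhamel th A g t.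
Proof.
move=> hg pg t0; have hG := lbmE hg; rewrite !periodic_duhamelE.
have -> : I 0 (t + th) g = I 0 th g + E (- th) * I 0 t g.
  rewrite /I (cintegral_cat (b := th) hG) ?(ltW th0) ?lerDr//; congr (_ + _).
  rewrite -{1}[th]add0r cintegral_shift// -cintegralZ//.
  apply: cintegral_ae_congr.
  apply: (@filterS _ _ (ae_filter_ringOfSetsType mu) _ _ _ pg) => s h /=.
  by rewrite in_itv/= => /andP[s0 _]; rewrite h// opprD ED mulrCA mulrA.
have w : E th * (w0 g + I 0 th g) = w0 g.
  have e : (1 - E th) * w0 g = E th * I 0 th g by rewrite /w0 mulrA mulfV// mul1r.
  by rewrite mulrDr -e; ring.
rewrite addrA mulrDr ED -[X in X + _]mulrA w mulrDr; congr (_ + _).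
by rewrite -mulrA; congr (_ * _); rewrite mulrA [E th * _]mulrC ENK mul1r.
Qed.

Lemma periodic_duhamel_bound B g t : lbm g -> {ae mu, forall s, 0 <= s -> g (s + th) = g s} ->
  (forall s, normc (g s) <= B) -> 0 <= t -> normc (periodic_duhamel th A g t) <= C1 * B.
Proof.
move=> hg pg hB t0.
have pp s : 0 <= s -> normc (periodic_duhamel th A g (s + th)) = normc (periodic_duhamel th A g s).
  by move=> s0; rewrite periodic_duhamel_shift.
have [r r0 ->] := periodic_reduce th0 pp t0.
by apply: periodic_duhamel_bound1 => // s _; exact: hB.
Qed.

(** The value at t arises from the value at s by e^((t - s) A) and a Duhamel integral over [s, t].
    As |A| <= M0 with M0 uniform over the modes, differences in time lose no decay in k. *)
Lemma periodic_duhamel_lipschitz B g s t : lbm g -> {ae mu, forall s, 0 <= s -> g (s + th) = g s} ->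
  (forall s, normc (g s) <= B) -> 0 <= s -> s <= t ->
  normc (periodic_duhamel th A g t - periodic_duhamel th A g s) <= (2 * M0 * C1 + 2) * B * (t - s).
Proof.
move=> hg pg hB s0 st.
have B0 : 0 <= B by apply: le_trans (normc_ge0 (g 0)) (hB 0).
have ts : 0 <= t - s by rewrite subr_ge0.
have -> : periodic_duhamel th A g t - periodic_duhamel th A g s = (E (t - s) - 1) * periodic_duhamel th A g s + E t * I s t g.
  rewrite !periodic_duhamelE /I (cintegral_cat (b := s) (lbmE hg) s0 st) -!/(I _ _ _).
  have -> : E t = E (t - s) * E s by rewrite -ED subrK.
  ring.
rewrite (le_trans (normcD _ _))//.
have h1 := tail_bound st hg (fun r _ => hB r).
have A0 : Re A <= 0 by apply: le_trans ReA _; rewrite oppr_le0 ltW.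
have h2 : normc ((E (t - s) - 1) * periodic_duhamel th A g s) <= (2 * (t - s) * M0) * (C1 * B).
  rewrite normcM; apply: ler_pM; rewrite ?normc_ge0//; last exact: periodic_duhamel_bound.
  by rewrite (le_trans (normc_cexp_sub1 A0 ts))// ler_wpM2l// mulr_ge0.
have -> : (2 * M0 * C1 + 2) * B * (t - s) = (2 * (t - s) * M0) * (C1 * B) + 2 * B * (t - s) by ring.
exact: lerD.
Qed.

Lemma periodic_duhamelB g h t : lbm g -> lbm h ->
  periodic_duhamel th A g t - periodic_duhamel th A h t = periodic_duhamel th A (fun s => g s - h s) t.
Proof.
move=> hg hh; rewrite /periodic_duhamel duhamelB//; congr (duhamel _ _ _ _).
rewrite -mulrBr -mulrBr -cintegralB; try exact: lbmE.
by congr (_ * (_ * _)); apply: cintegral_congr => s _; rewrite mulrBr.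
Qed.

Lemma periodic_duhamel0 g : periodic_duhamel th A g 0 = w0 g.
Proof. by rewrite periodic_duhamelE /I cintegral_itv1 addr0 /E mul0r cexp0 mul1r. Qed.

Lemma periodic_duhamel_eq g t : periodic_duhamel th A g t = duhamel A (periodic_duhamel th A g 0) g t.
Proof. by rewrite periodic_duhamel0. Qed.

End PeriodicMode.

(** * Limits of geometrically convergent sequences *)

Section GeometricLimit.
Variable R : realType.

Lemma sumle_trans (F : int -> R) B C : B <= C -> sumle F B -> sumle F C.
Proof. by move=> BC h n; exact: le_trans (h n) BC. Qed.

Lemma ten_le_sqr4 : 10 <= 4 ^+ 2 :> R.
Proof. lra. Qed.

Lemma four_le_eight : 4 <= 8 :> R.
Proof. lra. Qed.

Lemma scale4_le (L d e : R) : 0 <= d -> d * (4 * (L + 1)) <= e -> 4 * (L * d) <= e.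
Proof. lra. Qed.

Lemma ler_add_geometric (x y C : R) : (forall n : nat, x <= y + C / 2 ^+ n) -> x <= y.
Proof.
move=> h; apply/ler_addgt0Pr => e e0.
have [C0|C0] := leP C 0.
  by have := h 0; rewrite expr0 divr1; lra.
pose n := Num.bound (C / e).
have h1 : C / e < n%:R by apply: archi_boundP; rewrite divr_ge0// ltW.
apply: (le_trans (h n)); rewrite lerD2l ler_pdivrMr ?exprn_gt0//.
have h2 : (n%:R : R) <= 2 ^+ n by rewrite -natrX ler_nat ltnW// ltn_expl.
by rewrite mulrC -ler_pdivrMr// (le_trans (ltW h1)).
Qed.

(** The intervals of radius 2 B / 2^n around x n are nested, and the limit of their left endpoints
    lies in all of them. *)
Lemma geometric_limit_real (x : nat -> R) (B : R) :
  (forall n, `|x n.+1 - x n| <= B / 2 ^+ n) ->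
  exists w, forall n, `|w - x n| <= 2 * B / 2 ^+ n.
Proof.
move=> hx; pose a n := x n - 2 * B / 2 ^+ n; pose b n := x n + 2 * B / 2 ^+ n.
have step n : 2 * B / 2 ^+ n.+1 = B / 2 ^+ n.
  by rewrite exprS; field; rewrite expf_neq0.
have hx2 n : - (B / 2 ^+ n) <= x n.+1 - x n <= B / 2 ^+ n by rewrite -ler_norml.
have da n : 2 * B / 2 ^+ n = B / 2 ^+ n + B / 2 ^+ n by ring.
have ia : nondecreasing_seq a.
  by apply/nondecreasing_seqP => n; rewrite /a step da; have := hx2 n; lra.
have ib : nonincreasing_seq b.
  by apply/nonincreasing_seqP => n; rewrite /b step da; have := hx2 n; lra.
have B0 : 0 <= B by have := le_trans (normr_ge0 _) (hx 0); rewrite expr0 divr1.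
have ab n m : a n <= b m.
  have e0 j : 0 <= 2 * B / 2 ^+ j by rewrite divr_ge0 ?exprn_ge0// mulr_ge0.
  have h1 := ia n (maxn n m) (leq_maxl _ _); have h2 := ib m (maxn n m) (leq_maxr _ _).
  by apply: (le_trans h1); apply: le_trans h2; rewrite /a /b; have := e0 (maxn n m); lra.
have ca : cvgn a by apply: nondecreasing_is_cvgn => //; exists (b 0) => _ [n _ <-].
exists (limn a) => n; rewrite ler_norml.
have h1 := nondecreasing_cvgn_le ia ca n.
have h2 : limn a <= b n by apply: limr_le => //; near=> m; exact: ab.
by move: h1 h2; rewrite /a /b => *; apply/andP; split; lra.
Unshelve. all: by end_near. Qed.

Lemma geometric_limit (z : nat -> R[i]) (B : R) :
  (forall n, normc (z n.+1 - z n) <= B / 2 ^+ n) ->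
  exists w, forall n, normc (w - z n) <= 4 * B / 2 ^+ n.
Proof.
move=> hz.
have [a ha] : exists a, forall n, `|a - Re (z n)| <= 2 * B / 2 ^+ n.
  by apply: geometric_limit_real => n; rewrite -ReB (le_trans (ler_Re _)).
have [b hb] : exists b, forall n, `|b - Im (z n)| <= 2 * B / 2 ^+ n.
  by apply: geometric_limit_real => n; rewrite -ImB (le_trans (ler_Im _)).
exists (a +i* b) => n; rewrite (le_trans (normc_le_ReIm _))// ReB ImB.
have -> : 4 * B / 2 ^+ n = 2 * B / 2 ^+ n + 2 * B / 2 ^+ n by ring.
exact: lerD.
Qed.

End GeometricLimit.

(** * Picard iteration for the periodic solution *)

Section Existence.
Variables (R : realType) (l beta gamma c0 theta D rho : R).
Notation mu := (@lebesgue_measure R).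
Local Notation br := (br R).
Local Notation A := (Asymbol beta gamma).
Local Notation V k := (wt (l / 2 + 1) k).
Hypotheses (l0 : 0 <= l) (hc : coercive beta gamma c0) (th0 : 0 < theta) (rho0 : 0 <= rho).
Variables (f : R -> R -> R) (F : int -> R -> R[i]).
Hypotheses (mF : forall k, measurable_fun [set: R] (fun s => Re (F k s)) /\
                measurable_fun [set: R] (fun s => Im (F k s)))
  (bF : forall k s, normc (F k s) <= D / wt (l / 2) k)
  (FN : forall k s, F (- k) s = conjc (F k s))
  (F0 : forall s, F 0 s = 0)
  (aeF : {ae mu, forall s, 0 <= s -> forall k, fourier (f s) k = F k s})
  (pf : ae_time_periodic theta f).

(** [M0] bounds the symbol of A on all modes, [K] is the convolution constant, [Bg] the size of
    forcing plus nonlinearity in the weight V, and [L] the resulting Lipschitz constant in time.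
    Below, [hBg] makes the ball of radius rho invariant and [hK] makes the Picard map halve
    distances. *)
Let M0 := `|beta| + `|gamma| + 1.
Let C1 := periodic_cst theta c0.
Let K := 20 * 4 `^ (l / 2 + 1).
Let Bg := D + K * rho ^+ 2 / 2.
Let L := (2 * M0 * C1 + 2) * Bg.
Hypotheses (hBg : C1 * Bg <= rho) (hK : C1 * (K * rho) <= 1 / 2).

Let c00 : 0 < c0. Proof. by case: hc. Qed.
Let D0 : 0 <= D.
Proof. by have := le_trans (normc_ge0 _) (bF 0 0); rewrite pmulr_lge0// invr_gt0 wt_gt0. Qed.
Let K0 : 0 < K. Proof. by rewrite mulr_gt0// powR_gt0. Qed.
Let Bg0 : 0 <= Bg. Proof. by rewrite addr_ge0// divr_ge0// mulr_ge0 ?sqr_ge0// ltW. Qed.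
Let C10 : 0 <= C1.
Proof. exact: periodic_cst_ge0. Qed.
Let L0 : 0 <= L.
Proof. by rewrite mulr_ge0// addr_ge0// mulr_ge0// mulr_ge0// !addr_ge0. Qed.

Let V0 k : 0 < V k. Proof. exact: wt_gt0. Qed.
Let lh0 : 0 <= l / 2. Proof. by rewrite divr_ge0. Qed.
Let VE k : V k = wt (l / 2) k * br k. Proof. by rewrite wtD wt1. Qed.
Let br_leV k : br k <= V k.
Proof. by rewrite VE ler_peMl ?wt_ge1// ltW// br_gt0. Qed.

Let ReA k : k != 0 -> Re (A k) <= - c0.
Proof.
move=> k0; have [_ /(_ k k0) hk] := hc.
by rewrite Re_Asymbol mulNr lerN2 ler_pdivlMr ?br_gt0.
Qed.

Let normA k : normc (A k) <= M0.
Proof.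
have b0 := br_gt0 R k; have b1 := br_ge1 R k.
rewrite (le_trans (normc_le_ReIm _))// Re_Asymbol Im_Asymbol !normrM !normrN.
have -> : `|(br k)^-1| = (br k)^-1 by rewrite gtr0_norm// invr_gt0.
apply: lerD; rewrite ler_pdivrMr//; last by rewrite mul1r freq_le_br.
rewrite (le_trans (ler_normD _ _))// mulrDl lerD//; first by rewrite ler_peMr.
rewrite normrM ler_wpM2l// ger0_norm ?sqr_ge0// /br lerDr//.
Qed.

Let lF k : lbm (F k).
Proof. by have [m1 m2] := mF k; split => // T; exists (D / wt (l / 2) k) => s _. Qed.

Let pF k : {ae mu, forall s, 0 <= s -> F k (s + theta) = F k s}.
Proof.
have h2 := ae_shift theta aeF.
apply: (@filterS3 _ _ (ae_filter_ringOfSetsType mu) _ _ _ _ _ aeF h2 pf) => s a1 a2 a3 s0.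
rewrite -a1// -a2; last by rewrite addr_ge0// ltW.
exact: aeeq_fourier (a3 s0).
Qed.

(* The bounds hold with constants independent of the Picard step, which makes
   this set of trajectories closed under pointwise limits. *)
Definition admissible (c : R -> int -> R[i]) :=
  [/\ forall t k, c t (- k) = conjc (c t k), forall t, c t 0 = 0,
      forall t k, normc (c t k) <= rho / V k,
      forall s t k, normc (c s k - c t k) <= L * `|s - t| / V k &
      forall t k, 0 <= t -> c (t + theta) k = c t k].

Definition trajectory (c : R -> int -> R[i]) (t : R) : R -> R := synth (c t).

Section Admissible.
Variable c : R -> int -> R[i].
Hypothesis hadm : admissible c.
Local Notation u := (trajectory c).

Let cN t k : c t (- k) = (Re (c t k)) +i* (- Im (c t k)).
Proof. by have [-> _ _ _ _] := hadm; rewrite conjcE. Qed.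

Let cb t k : normc (c t k) <= rho / br k.
Proof.
have [_ _ h _ _] := hadm; rewrite (le_trans (h t k))// ler_wpM2l//.
by rewrite lef_pV2 ?posrE ?br_gt0.
Qed.

Lemma admissible_fourier t k : fourier (u t) k = c t k.
Proof. exact: fourier_synth (cN t) (cb t) k. Qed.

Lemma admissible_sqint t : sqint (u t).
Proof. exact: sqint_synth (cb t). Qed.

Lemma admissible_max t x : `|u t x| <= 20 * rho.
Proof. exact: synth_max (cb t) x. Qed.

(** V^2 is the H^l weight times br^2, so a bound M / V leaves M^2 / br^2, whose sum is at most 10
    M^2. *)
Lemma sumle_wt (z : int -> R[i]) (M : R) : 0 <= M -> (forall k, normc (z k) <= M / V k) ->
  sumle (fun k => wt l k * normc (z k) ^+ 2) (M ^+ 2 * 10).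
Proof.
move=> M_ge0 hz; apply: le_sumle (sumleZ (sqr_ge0 M) (sum_br R)) => k.
have w0 := wt_gt0 (l / 2) k; have b0 := br_gt0 R k; have b1 := br_ge1 R k.
have h : normc (z k) ^+ 2 <= (M / V k) ^+ 2.
  by rewrite ler_sqr ?nnegrE ?normc_ge0 ?divr_ge0 ?wt_ge0.
apply: (le_trans (ler_wpM2l (wt_ge0 l k) h)); rewrite VE -(wt_half l).
have -> : wt (l / 2) k ^+ 2 * (M / (wt (l / 2) k * br k)) ^+ 2 = M ^+ 2 * ((br k)^-1 * (br k)^-1).
  by field; rewrite !gt_eqF.
apply: ler_wpM2l; first exact: sqr_ge0.
have ib : 0 <= (br k)^-1 by rewrite invr_ge0 ltW.
have i1 : (br k)^-1 <= 1 by rewrite invf_le1.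
by rewrite ler_piMl.
Qed.

Lemma admissible_Hper0 t : Hper0 l (u t).
Proof.
have [_ c0E cV _ _] := hadm; have sq := admissible_sqint t.
split; last first.
  have := admissible_fourier t 0; rewrite fourier0// c0E => h.
  by have := congr1 Re h.
split; first by split; [exact: synth_periodic (c t)|exact: sq.1|exact: sq.2].
apply: (@le_lt_trans _ _ (rho * 4)%:E); last exact: ltry.
apply/Hnorm_leP; first by rewrite mulr_ge0.
have hs := sumle_wt rho0 (fun k => cV t k).
have -> : (fun k => wt l k * normc (fourier (u t) k) ^+ 2) = (fun k => wt l k * normc (c t k) ^+ 2).
  by apply/funext => k; rewrite admissible_fourier.
apply: sumle_trans hs; rewrite exprMn; apply: ler_wpM2l; [exact: sqr_ge0|exact: ten_le_sqr4].
Qed.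

Lemma admissible_continuous : continuous_Hper l u.
Proof.
have [_ _ _ cL _] := hadm.
apply/continuous_HperP => t t0 e e0.
have L1 : 0 < 4 * (L + 1) by rewrite mulr_gt0// ltr_wpDl.
exists (e / (4 * (L + 1))); first by rewrite divr_gt0.
move=> s s0 /ltW; rewrite ler_pdivlMr// => hst; apply/(Hnorm_leP _ _ (ltW e0)).
have hM : 0 <= L * `|s - t| by rewrite mulr_ge0.
have hs := sumle_wt hM (fun k => cL s t k).
have -> : (fun k => wt l k * normc (fourier (fun x => u s x - u t x) k) ^+ 2) =
    (fun k => wt l k * normc (c s k - c t k) ^+ 2).
  by apply/funext => k; rewrite fourierB ?admissible_fourier//; exact: admissible_sqint.
apply: sumle_trans hs.
have h : 4 * (L * `|s - t|) <= e by exact: scale4_le hst.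
have h2 : (4 * (L * `|s - t|)) ^+ 2 <= e ^+ 2.
  by rewrite (ler_sqr (mulr_ge0 (ler0n R 4) hM) (ltW e0)).
apply: le_trans h2; rewrite [leRHS]exprMn mulrC; apply: ler_wpM2r; first exact: sqr_ge0.
exact: ten_le_sqr4.
Qed.

Lemma admissible_periodic t : 0 <= t -> u (t + theta) = u t.
Proof. by move=> t0; have [_ _ _ _ p] := hadm; rewrite /trajectory; congr synth; apply/funext => k; exact: p. Qed.

Lemma convection_le (z : R[i]) k (M : R) : normc z <= M / V k ->
  normc (((br k)^-1)%:C * ((2^-1)%:C * ((0 +i* freq k) * z))) <= M / 2 / V k.
Proof.
move=> hz; have b0 := br_gt0 R k.
rewrite !normcM !normc_real !ger0_norm ?invr_ge0 ?(ltW b0)//.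
have -> : normc (0 +i* (freq k : R)) = `|freq k|.
  apply/eqP; rewrite -(eqrXn2 (n := 2))// ?normc_ge0// sqr_normcE /= expr0n/= add0r.
  by rewrite real_normK ?num_real.
have h1 : `|freq k| / br k <= 1 by rewrite ler_pdivrMr// mul1r freq_le_br.
have -> : (br k)^-1 * (2^-1 * (`|freq k| * normc z)) = `|freq k| / br k * (normc z / 2) by ring.
apply: (@le_trans _ _ (normc z / 2)); first by rewrite ler_piMl// divr_ge0// normc_ge0.
by rewrite mulrAC ler_wpM2r.
Qed.

Lemma burgers_bound k s : normc (burgers u k s) <= K * rho ^+ 2 / 2 / V k.
Proof.
have [_ _ cV _ _] := hadm.
apply: convection_le; under eq_fun do rewrite expr2.
apply: convolution_bound => [||n]; [exact: admissible_sqint..|].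
apply: conv_wt => // j; rewrite admissible_fourier; exact: cV.
Qed.

Definition rhs k s := ((br k)^-1)%:C * F k s - burgers u k s.

Lemma lbm_rhs k : lbm (rhs k).
Proof.
apply: lbmB; first by apply: lbmM => //; exact: lbm_cst.
exact/ccont_lbm/(ccont_burgers l0 k (fun t _ => admissible_Hper0 t) admissible_continuous).
Qed.

Lemma rhs_bound k s : normc (rhs k s) <= Bg / V k.
Proof.
have b0 := br_gt0 R k; have w0 := wt_gt0 (l / 2) k.
rewrite (le_trans (normcB _ _))// /Bg mulrDl lerD//; last exact: burgers_bound.
rewrite normcM normc_real gtr0_norm ?invr_gt0//.
have -> : D / V k = (br k)^-1 * (D / wt (l / 2) k) by rewrite VE; field; rewrite !gt_eqF.
by rewrite ler_wpM2l// invr_ge0 ltW.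
Qed.

Lemma rhs_periodic k : {ae mu, forall s, 0 <= s -> rhs k (s + theta) = rhs k s}.
Proof.
apply: (@filterS _ _ (ae_filter_ringOfSetsType mu) _ _ _ (pF k)) => s h s0.
have st : 0 <= s + theta by rewrite addr_ge0// ltW.
by rewrite /rhs (h s0) /burgers (max_idPl s0) (max_idPl st) (admissible_periodic s0).
Qed.

Lemma rhsN k s : rhs (- k) s = conjc (rhs k s).
Proof.
have i2 := intg_sqr (admissible_sqint (Num.max s 0)).
have cB (z w : R[i]) : conjc (z - w) = conjc z - conjc w by exact: rmorphB.
rewrite /rhs cB conjcM conjc_real -FN; congr (_ * _ - _).
  by rewrite /br freqN sqrrN.
rewrite /burgers /convection /Dx !conjcM !conjc_real.
have -> : br (- k) = br k by rewrite /br freqN sqrrN.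
congr (_ * (_ * (_ * _))); first by rewrite conjcE /= freqN.
apply: complex_eqP; rewrite conjcE.
  by rewrite -[RHS]/(Re (fourier _ k)) !Re_fourier ccoefN.
rewrite -[RHS]/(- Im (fourier _ k)) !Im_fourier_intg//.
by rewrite /scoef; under eq_fun do rewrite sinkN mulrN -mulN1r; rewrite int01Z ?mulN1r//; exact: intgM_bounded i2 (measurable_sink k) (sink_max k).
Qed.

Lemma rhs0 s : rhs 0 s = 0.
Proof. by rewrite /rhs F0 mulr0 /burgers /convection /Dx freq0 mul0r !mulr0 subrr. Qed.

End Admissible.

Lemma AsymbolN k : A (- k) = conjc (A k).
Proof.
have bN : br (- k) = br k by rewrite /br freqN sqrrN.
apply: complex_eqP; rewrite conjcE.
  by rewrite -[RHS]/(Re (A k)) !Re_Asymbol bN freqN sqrrN.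
by rewrite -[RHS]/(- Im (A k)) !Im_Asymbol bN freqN mulNr.
Qed.

(** The mean is set to 0 by hand: A 0 = - beta need not be negative, and 1 - e^(theta A) can vanish
    there. The time is clamped at 0 to make the bounds hold on the whole line. *)
Definition picard (c : R -> int -> R[i]) (t : R) (k : int) : R[i] :=
  if k == 0 then 0 else periodic_duhamel theta (A k) (rhs c k) (Num.max t 0).

Lemma picard0 c t : picard c t 0 = 0.
Proof. by rewrite /picard eqxx. Qed.

Lemma picardE c t k : k != 0 -> picard c t k = periodic_duhamel theta (A k) (rhs c k) (Num.max t 0).
Proof. by rewrite /picard => /negbTE ->. Qed.

Lemma picard_admissible c : admissible c -> admissible (picard c).
Proof.
move=> hadm; have mt0 t : 0 <= Num.max t 0 :> R by rewrite le_max lexx orbT.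
split.
- move=> t k; have [->|k0] := eqVneq k 0; first by rewrite oppr0 picard0 conjcE oppr0.
  rewrite !picardE ?oppr_eq0// conjc_periodic_duhamel; last exact: lbm_rhs.
  by rewrite -AsymbolN; congr periodic_duhamel; apply/funext => s; exact: rhsN.
- by move=> t; exact: picard0.
- move=> t k; have [->|k0] := eqVneq k 0.
    by rewrite picard0 normc0 divr_ge0// wt_ge0.
  rewrite picardE//.
  have := periodic_duhamel_bound th0 c00 (ReA k0) (lbm_rhs hadm k) (rhs_periodic hadm k) (rhs_bound hadm k) (mt0 t).
  move=> /le_trans; apply; rewrite mulrA ler_wpM2r//.
  by rewrite invr_ge0 wt_ge0.
- have lip s t k : s <= t -> normc (picard c s k - picard c t k) <= L * `|s - t| / V k.
    move=> st; have [->|k0] := eqVneq k 0.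
      by rewrite !picard0 subrr normc0 divr_ge0 ?wt_ge0// mulr_ge0.
    rewrite !(picardE _ _ k0).
    have mst : Num.max s 0 <= Num.max t 0 by rewrite ge_max !le_max st lexx orbT.
    have d : Num.max t 0 - Num.max s 0 <= `|s - t|.
      rewrite distrC ger0_norm ?subr_ge0//.
      by have [h1|h1] := leP s 0; have [h2|h2] := leP t 0; rewrite ?subrr ?subr_ge0//; lra.
    have := periodic_duhamel_lipschitz th0 c00 (ReA k0) (normA k) (lbm_rhs hadm k) (rhs_periodic hadm k) (rhs_bound hadm k) (mt0 s) mst.
    rewrite normc_distC => /le_trans; apply.
    rewrite -/M0 -/C1 mulrA -/L mulrAC ler_wpM2r ?invr_ge0 ?wt_ge0//.
    by rewrite ler_wpM2l.
  move=> s t k; have [/lip//|ts] := leP s t.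
  by rewrite normc_distC distrC; apply: lip; exact: ltW.
- move=> t k t0; have [->|k0] := eqVneq k 0; first by rewrite !picard0.
  rewrite !(picardE _ _ k0).
  have st : 0 <= t + theta by rewrite addr_ge0// ltW.
  rewrite (max_idPl t0) (max_idPl st).
  exact: (periodic_duhamel_shift th0 c00 (ReA k0) (lbm_rhs hadm k) (rhs_periodic hadm k) t0).
Qed.

Let burgers_diff c d eta k s : admissible c -> admissible d ->
  (forall t k, normc (c t k - d t k) <= eta / V k) ->
  normc (burgers (trajectory c) k s - burgers (trajectory d) k s) <= K * rho * eta / V k.
Proof.
move=> hc1 hd1 hcd; have sc := admissible_sqint hc1 (Num.max s 0); have sd := admissible_sqint hd1 (Num.max s 0).
have [_ _ cV _ _] := hc1; have [_ _ dV _ _] := hd1.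
rewrite /burgers /convection /Dx -!mulrBr (fourier_sqrB k sc sd).
have -> : K * rho * eta / V k = K * (2 * rho * eta) / 2 / V k by field; rewrite gt_eqF.
apply: convection_le; apply: convolution_bound; [exact: sqintD|exact: sqintB|move=> n].
apply: conv_wt => // j.
  rewrite fourierD// !admissible_fourier// (le_trans (normcD _ _))//.
  have -> : 2 * rho / V j = rho / V j + rho / V j by ring.
  exact: lerD.
by rewrite fourierB// !admissible_fourier.
Qed.

Lemma picard_contract c d eta : admissible c -> admissible d ->
  (forall t k, normc (c t k - d t k) <= eta / V k) ->
  forall t k, normc (picard c t k - picard d t k) <= eta / 2 / V k.
Proof.
move=> hc1 hd1 hcd t k.
have eta0 : 0 <= eta.
  by have := le_trans (normc_ge0 _) (hcd 0 0); rewrite pmulr_lge0// invr_gt0.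
have mt0 : 0 <= Num.max t 0 :> R by rewrite le_max lexx orbT.
have [->|k0] := eqVneq k 0.
  rewrite !picard0 subrr normc0; apply: divr_ge0; last exact: wt_ge0.
  exact: divr_ge0 eta0 (ler0n R 2).
rewrite !(picardE _ _ k0) periodic_duhamelB; [|exact: lbm_rhs..].
have bd s : normc (rhs c k s - rhs d k s) <= K * rho * eta / V k.
  have -> : rhs c k s - rhs d k s = - (burgers (trajectory c) k s - burgers (trajectory d) k s).
    have cancel (x a b : R[i]) : x - a - (x - b) = - (a - b) by ring.
    exact: cancel.
  by rewrite normcN; exact: burgers_diff.
have pp : {ae mu, forall s, 0 <= s -> rhs c k (s + theta) - rhs d k (s + theta) = rhs c k s - rhs d k s}.
  apply: (@filterS2 _ _ (ae_filter_ringOfSetsType mu) _ _ _ _ (rhs_periodic hc1 k) (rhs_periodic hd1 k)).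
  by move=> s h1 h2 s0; rewrite (h1 s0) (h2 s0).
have lb := lbmB (lbm_rhs hc1 k) (lbm_rhs hd1 k).
have := periodic_duhamel_bound th0 c00 (ReA k0) lb pp bd mt0.
move=> /le_trans; apply.
have -> : periodic_cst theta c0 * (K * rho * eta / V k) = C1 * (K * rho) * (eta / V k).
  by rewrite /C1; ring.
have -> : eta / 2 / V k = 1 / 2 * (eta / V k) by field; rewrite gt_eqF.
by rewrite ler_wpM2r// divr_ge0// wt_ge0.
Qed.

Lemma admissible_zero : admissible (fun _ _ => 0).
Proof.
split.
- by move=> t k; rewrite conjcE oppr0.
- by [].
- by move=> t k; rewrite normc0 divr_ge0// wt_ge0.
- by move=> s t k; rewrite subrr normc0 divr_ge0 ?wt_ge0// mulr_ge0.
- by [].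
Qed.

Let it n := iter n picard (fun _ _ => 0).

Let it_admissible n : admissible (it n).
Proof.
elim: n => [|n IH]; [exact: admissible_zero|exact: picard_admissible].
Qed.

Let it_diff n t k : normc (it n.+1 t k - it n t k) <= rho / 2 ^+ n / V k.
Proof.
elim: n t k => [|n IH] t k.
  rewrite expr0 divr1 subr0; have [_ _ h _ _] := it_admissible 1; exact: h.
have := picard_contract (it_admissible n.+1) (it_admissible n) IH t k.
by rewrite exprSr invfM mulrA.
Qed.

(** The limit is taken separately for each time and mode. The rate of convergence is uniform
    relative to 1 / V, so the conditions defining [admissible] survive, the error constant 8 being
    twice 4 from two limits compared at once. *)
Lemma fixed_point_exists : exists2 c, admissible c & picard c = c.
Proof.
have lim t k : {w | forall n, normc (w - it n t k) <= 4 * (rho / V k) / 2 ^+ n}.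
  apply: cid; apply: (geometric_limit (z := fun n => it n t k)) => n.
  by rewrite mulrAC; exact: it_diff.
pose c t k := sval (lim t k).
have cl n t k : normc (c t k - it n t k) <= 4 * rho / 2 ^+ n / V k.
  by have := svalP (lim t k) n; congr (_ <= _); ring.
have cl' n t k : normc (c t k - it n t k) <= 4 * (rho / V k) / 2 ^+ n.
  exact: svalP (lim t k) n.
have tri (z w : R[i]) M e1 : normc (z - w) <= e1 -> normc w <= M -> normc z <= M + e1.
  by move=> h1 h2; rewrite -[z](subrK w) (le_trans (normcD _ _))// addrC lerD.
have tri2 (z z' w w' : R[i]) e1 : normc (z - w) <= e1 -> normc (z' - w') <= e1 ->
    normc (z - z' - (w - w')) <= 2 * e1.
  move=> h1 h2; have -> : z - z' - (w - w') = (z - w) - (z' - w') by ring.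
  by rewrite (le_trans (normcB _ _))// mulr_natl mulr2n lerD.
have cadm : admissible c.
  split.
  - move=> t k; apply/eqP; rewrite -subr_eq0; apply/eqP/normc0_eq0.
    apply: (ler_add_geometric (C := 8 * (rho / V k))) => n; rewrite add0r.
    have [hN _ _ _ _] := it_admissible n.
    have cB (z w : R[i]) : conjc (z - w) = conjc z - conjc w by exact: rmorphB.
    have h1 := cl' n t (- k); rewrite wtN hN in h1.
    have h2 : normc (conjc (c t k) - conjc (it n t k)) <= 4 * (rho / V k) / 2 ^+ n.
      by rewrite -cB normc_conj.
    have := tri2 _ _ _ _ _ h1 h2; rewrite subrr subr0.
    by congr (_ <= _); ring.
  - move=> t; apply: normc0_eq0; apply: (ler_add_geometric (C := 4 * (rho / V 0))) => n.
    have [_ h0 _ _ _] := it_admissible n.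
    by have := cl' n t 0; rewrite h0 subr0 add0r.
  - move=> t k; apply: (ler_add_geometric (C := 4 * (rho / V k))) => n.
    have [_ _ hV _ _] := it_admissible n; exact: tri (cl' n t k) (hV t k).
  - move=> s t k; apply: (ler_add_geometric (C := 8 * (rho / V k))) => n.
    have [_ _ _ hL _] := it_admissible n.
    have := tri _ _ _ _ (tri2 _ _ _ _ _ (cl' n s k) (cl' n t k)) (hL s t k).
    by congr (_ <= _ + _); ring.
  - move=> t k t0; apply/eqP; rewrite -subr_eq0; apply/eqP/normc0_eq0.
    apply: (ler_add_geometric (C := 8 * (rho / V k))) => n; rewrite add0r.
    have [_ _ _ _ hp] := it_admissible n.
    have := tri2 _ _ _ _ _ (cl' n (t + theta) k) (cl' n t k); rewrite hp// subrr subr0.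
    by congr (_ <= _); ring.
exists c => //; apply/funext => t; apply/funext => k.
apply/eqP; rewrite -subr_eq0; apply/eqP/normc0_eq0.
apply: (ler_add_geometric (C := 8 * (rho / V k))) => n; rewrite add0r.
have h1 := picard_contract cadm (it_admissible n) (cl n) t k.
have h2 := cl' n.+1 t k.
(* Both [picard c] and c are within a multiple of 2^-n of the iterate n + 1. *)
have -> : picard c t k - c t k = (picard c t k - picard (it n) t k) - (c t k - it n.+1 t k).
  have sub3 (x y z : R[i]) : x - y = (x - z) - (y - z) by ring.
  exact: sub3.
apply: (le_trans (normcB _ _)); apply: (le_trans (lerD h1 h2)).
have r0 : 0 <= rho / V k by rewrite divr_ge0// wt_ge0.
have p0 : 0 <= (2 ^+ n)^-1 :> R by rewrite invr_ge0 exprn_ge0.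
have -> : 4 * rho / 2 ^+ n / 2 / V k + 4 * (rho / V k) / 2 ^+ n.+1 = 4 * (rho / V k) / 2 ^+ n.
  by rewrite exprS; field; rewrite !gt_eqF ?exprn_gt0.
apply: ler_wpM2r => //; apply: ler_wpM2r => //; exact: four_le_eight.
Qed.

Lemma periodic_solution : exists ut,
  [/\ mild_solution l beta gamma f ut, time_periodic theta ut,
      forall t k, normc (fourier (ut t) k) <= rho / V k &
      forall t x, `|ut t x| <= 20 * rho].
Proof.
have [c hadm fix_c] := fixed_point_exists; have [_ c0E cV _ _] := hadm.
have mild : mild_solution l beta gamma f (trajectory c).
  split; [by move=> t _; exact: admissible_Hper0|exact: admissible_continuous|move=> t t0 k].
  rewrite (@mild_integral R l beta gamma f F (trajectory c) k t (fun s _ => admissible_Hper0 hadm s) (admissible_continuous hadm) (lF k) aeF).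
  rewrite -/(rhs c k _) /semigroup !admissible_fourier//.
  (* The mean mode is not a periodic Duhamel formula; there both the solution and the right-hand
     side vanish. *)
  have [->|k0] := eqVneq k 0.
    rewrite !c0E mulr0 add0r (cintegral_congr (G := fun=> 0 * 0)) => [|s _]; last first.
      by rewrite -/(rhs c 0 s) rhs0 !mulr0.
    by rewrite (cintegralZ _ _ _ (lbm_cst 0)) mul0r.
  have cE s : 0 <= s -> c s k = periodic_duhamel theta (A k) (rhs c k) s.
    by move=> s0; rewrite -{1}fix_c picardE// (max_idPl s0).
  rewrite (cE t t0) (cE 0 (lexx 0)) periodic_duhamel_eq duhamelE; last exact: lbm_rhs.
  by [].
exists (trajectory c); split => //.
- by move=> t t0; apply: aeW => x; rewrite admissible_periodic.
- by move=> t k; rewrite admissible_fourier.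
- by move=> t x; exact: admissible_max.
Qed.

End Existence.

(** * A periodic function is determined by its Fourier coefficients *)

Section FourierInjective.
Variable R : realType.
Notation mu := (@lebesgue_measure R).

Lemma periodic1_int (g : R -> R) (m : int) x : periodic1 g -> g (x + m%:~R) = g x.
Proof.
move=> pg; have pn (n : nat) y : g (y + n%:R) = g y.
  by elim: n y => [|n IH] y; rewrite ?addr0// -natr1 addrA pg.
case: m => n; first exact: pn.
by rewrite NegzE mulrNz -pmulrn -[LHS](pn n.+1) subrK.
Qed.

(** The integer translates of [0, 1] cover the line, and countably many null sets form a null set.
    The boolean chooses the direction of the translation. *)
Lemma ae01_ae (g : R -> R) : periodic1 g ->
  {ae mu, forall x, 0 <= x <= 1 -> g x = 0} -> {ae mu, forall x, g x = 0}.
Proof.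
move=> pg h.
have hn (b : bool) (n : nat) : {ae mu, forall x, 0 <= x + (-1) ^+ b * n%:R <= 1 -> g x = 0}.
  have := ae_shift ((-1) ^+ b * n%:R) h.
  apply: (@filterS _ _ (ae_filter_ringOfSetsType mu)) => x hx /hx.
  have -> : (-1) ^+ b * n%:R = (if b then - n%:Z else n%:Z)%:~R :> R.
    by case: b {hx} => /=; rewrite ?expr1 ?expr0 ?mulN1r ?mul1r// mulrNz.
  by rewrite periodic1_int.
have h1 := ae_foralln (hn true); have h2 := ae_foralln (hn false).
apply: (@filterS2 _ _ (ae_filter_ringOfSetsType mu) _ _ _ _ h1 h2) => x a1 a2.
have [x0|x0] := leP 0 x.
  apply: (a1 (Num.truncn x)); rewrite expr1 mulN1r.
  by have /andP[b1 b2] := truncn_itv x0; rewrite subr_ge0 b1/=; move: b2; rewrite -natr1; lra.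
have nx : 0 <= - x by rewrite oppr_ge0 ltW.
apply: (a2 (Num.truncn (- x)).+1); rewrite expr0 mul1r.
by have /andP[b1 b2] := truncn_itv nx; move: b1 b2; rewrite -!natr1 => *; apply/andP; split; lra.
Qed.

Lemma fourier_inj (g h : R -> R) : L2T g -> L2T h ->
  (forall k, fourier g k = fourier h k) -> aeeq g h.
Proof.
move=> lg lh gh; have sg := L2T_sqint lg; have sh := L2T_sqint lh.
have sd := sqintB sg sh; have [pg _ _] := lg; have [ph _ _] := lh.
pose d x := g x - h x.
have z : int01 (fun x => d x ^+ 2) <= 0.
  apply: parseval_le => // n; rewrite big1// => k _.
  by rewrite fourierB// gh subrr normc0 expr0n.
have {}z : int01 (fun x => d x ^+ 2) = 0.
  by apply/eqP; rewrite eq_le z int01_ge0// => x; exact: sqr_ge0.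
have [md id2] := sd.
have md2 : measurable_fun [set: R] (fun x => d x ^+ 2) by exact: measurable_funX.
have fin : (\int[mu]_(x in `[0%R, 1%R]) `|(d x ^+ 2)%R%:E| = 0)%E.
  under eq_integral => x _ do rewrite gee0_abs ?lee_fin ?sqr_ge0//.
  have f1 : (\int[mu]_(x in `[0%R, 1%R]) (d x ^+ 2)%R%:E)%E \is a fin_num.
    exact: integrable_fin_num id2.
  by rewrite -(fineK f1); congr EFin.
have /ae_eq_integral_abs hz := fin.
have mI : measurable (`[0, 1]%classic : set (measurableTypeR R)) by [].
have mf : measurable_fun (`[0, 1]%classic : set (measurableTypeR R)) (fun x : R => (d x ^+ 2)%:E).
  by apply: measurable_funTS; exact/measurable_EFinP.
have dz : {ae mu, forall x, 0 <= x <= 1 -> d x = 0}.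
  apply: (@filterS _ _ (ae_filter_ringOfSetsType mu) _ _ _ (hz mI mf)) => x hx x01.
  by have := hx x01 => -[] /eqP; rewrite sqrf_eq0 => /eqP.
have pd : periodic1 d by move=> x; rewrite /d pg ph.
apply: (@filterS _ _ (ae_filter_ringOfSetsType mu) _ _ _ (ae01_ae pd dz)) => x.
by move=> /eqP; rewrite subr_eq0 => /eqP.
Qed.

End FourierInjective.

(** * Choice of the constants and conclusion *)

Lemma small_radius (R : realType) (a b m e e' : R) : 0 <= a -> 0 <= b -> 0 <= m -> 0 < e -> 0 < e' ->
  exists2 rho : R, 0 < rho & [/\ a * rho <= 1 / 2, b * rho ^+ 2 <= e & m * rho <= e'].
Proof.
move=> a0 b0 m0 e0 e'0.
have a1 : 0 < a + 1 by rewrite ltr_wpDl.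
have b1 : 0 < b + 1 by rewrite ltr_wpDl.
have m1 : 0 < m + 1 by rewrite ltr_wpDl.
pose rho := Num.min (Num.min 1 (1 / 2 / (a + 1))) (Num.min (e / (b + 1)) (e' / (m + 1))).
have r0 : 0 < rho by rewrite !lt_min ltr01 !divr_gt0.
have r1 : rho <= 1 by rewrite !ge_min lexx.
have r2 : rho * (a + 1) <= 1 / 2 by rewrite -ler_pdivlMr// !ge_min lexx orbT.
have r3 : rho * (b + 1) <= e by rewrite -ler_pdivlMr// !ge_min lexx !orbT.
have r4 : rho * (m + 1) <= e' by rewrite -ler_pdivlMr// !ge_min lexx !orbT.
exists rho => //; split; [lra| |lra].
have : b * rho ^+ 2 <= b * rho by rewrite ler_wpM2l// expr2 ler_piMl// ltW.
lra.
Qed.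

(** The contraction condition keeps the quadratic part below rho / 4, and this D contributes at most
    rho / 2. *)
Lemma small_data (R : realType) (C K rho : R) : 0 <= C -> 0 < rho -> C * (K * rho) <= 1 / 2 ->
  exists2 D : R, 0 < D & C * (D + K * rho ^+ 2 / 2) <= rho.
Proof.
move=> C0 r0 h; have C1 : 0 < 2 * (C + 1) by rewrite mulr_gt0// ltr_wpDl.
exists (rho / (2 * (C + 1))); first by rewrite divr_gt0.
have h1 : C * (rho / (2 * (C + 1))) <= rho / 2.
  have -> : rho / 2 = (C + 1) * (rho / (2 * (C + 1))) by field; rewrite gt_eqF// ltr_wpDl.
  by rewrite ler_wpM2r ?divr_ge0// ?ltW//; lra.
have h2 : C * (K * rho) * rho <= 1 / 2 * rho by rewrite ler_wpM2r// ltW.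
lra.
Qed.

Theorem theorem1p5 (R : realType) (l beta gamma theta : R)
    (hl : 0 <= l)
    (hgamma : Num.max 0 (- (beta / (4 * pi ^+ 2))) < gamma)
    (htheta : 0 < theta) :
  exists2 delta : R, 0 < delta &
    forall (phi : R -> R) (f : R -> R -> R),
      Hper0 l phi ->
      Linf l f ->
      ae_time_periodic theta f ->
      (\forall t \ae (@lebesgue_measure R), 0 <= t < theta -> mean (f t) = 0) ->
      (Hnorm l phi + Linf_norm l f <= delta%:E)%E ->
      exists ut : R -> R -> R,
        [/\ mild_solution l beta gamma f ut,
            time_periodic theta ut,
            (forall v : R -> R -> R,
               mild_solution l beta gamma f v -> time_periodic theta v ->
               forall t : R, 0 <= t -> aeeq (v t) (ut t)) &
            locally_stable l beta gamma f ut].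
Proof.
have [c0 hc] := coercive_exists hgamma; have c00 : 0 < c0 by case: hc.
have l2 : 0 <= l / 2 by rewrite divr_ge0.
pose C1 := periodic_cst theta c0; pose K : R := 20 * 4 `^ (l / 2 + 1).
have C10 : 0 <= C1 by exact: periodic_cst_ge0.
have K0 : 0 <= K by rewrite mulr_ge0// powR_ge0.
have b0 : 0 <= 10 * 4 `^ l / c0 * 80 by rewrite mulr_ge0// divr_ge0 ?mulr_ge0 ?powR_ge0// ltW.
have e0 : 0 < c0 / 4 by rewrite divr_gt0.
have e1 : 0 < c0 / 2 by rewrite divr_gt0.
(* The three conditions on rho are the contraction of the Picard map, the absorption of the ut term
   in the stability estimate, and the sup norm bound 20 rho <= c0 / 2 for uniqueness. *)
have [rho rho_gt0 [h1 h2 h3]] := small_radius (mulr_ge0 C10 K0) b0 (ler0n R 20) e0 e1.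
have hK : C1 * (K * rho) <= 1 / 2 by rewrite mulrA.
have [D D0 hD] := small_data C10 rho_gt0 hK.
exists D => // phi f _ hf pf _ hsmall.
have fD : (Linf_norm l f <= D%:E)%E.
  by apply: le_trans hsmall; rewrite leeDr// Hnorm_ge0.
have [F [mF bF FN F0 aeF]] := forcing_version (ltW D0) hf fD.
have [ut [mut put but sut]] := periodic_solution hl hc htheta (ltW rho_gt0) mF bF FN F0 aeF pf hD hK.
exists ut; split => //.
- move=> v mv pv t t0; have [hut _ _] := mut; have [hv _ _] := mv.
  apply: fourier_inj; [by case: (hv t t0) => -[]|by case: (hut t t0) => -[]|move=> k].
  (* The weight V dominates [br], hence half of [rk ^ 3]: this is the scale of the uniqueness
     ladder. *)
  have but' s : 0 <= s -> forall j, normc (fourier (ut s) j) <= 2 * rho / rk R j ^+ 3.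
    move=> s0 j; apply: (le_trans (but s j)).
    have bj := br_gt0 R j; have rj : 0 < rk R j ^+ 3 by rewrite exprn_gt0// rk_gt0.
    have wj : br R j <= wt (l / 2 + 1) j by rewrite wtD wt1 ler_peMl ?wt_ge1// ltW.
    rewrite ler_pdivrMr ?wt_gt0// mulrAC ler_pdivlMr// [2 * rho]mulrC -mulrA ler_pM2l//.
    by apply: (le_trans (rk3_le_br R j)); rewrite ler_pM2l.
  exact: (uniqueness_fourier hl hc htheta hf mut mv put pv but' (fun s _ y => sut s y) h3 k t0).
- apply: (stability hl hc (ltW rho_gt0) hf mut (fun t _ => but t)).
  by rewrite mulrA.
Qed.
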